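(* Let $\phi_0\in\mathbb{R}$ and $\alpha_0>0$. Let $\{\eta_t\}_{t\ge 1}$ be a sequence of i.i.d. symmetric random variables such that $\sigma_{\gamma_0}^2:=\mathrm{var}\big(\log|\phi_0+\eta_t\sqrt{\alpha_0}|\big)\in(0,\infty)$, and put $\gamma_0:=E\log|\phi_0+\eta_t\sqrt{\alpha_0}|$. Let $y_0$ be a symmetric random variable with $P(y_0=0)=0$, independent of $\{\eta_t:t\ge 1\}$, and define $$y_t=\phi_0 y_{t-1}+\eta_t\sqrt{\alpha_0 y_{t-1}^2},\qquad t\ge 1.$$ Then $$\frac{|y_{[ns]}|^{1/\sqrt{n}}}{\exp(s\gamma_0\sqrt{n})}\Longrightarrow \exp\{\sigma_{\gamma_0}\mathbb{B}(s)\}\qquad\text{as } n\to\infty\ \text{ in } \mathbb{D}[0,1],$$ where both sides are regarded as processes indexed by $s\in[0,1]$ and $\mathbb{B}$ is a standard Brownian motion on $[0,1]$.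
   Context: $[a]$ denotes the integral part of a real number $a$. ''$\Longrightarrow$'' denotes weak convergence. $\mathbb{D}[0,1]$ is the space of functions on $[0,1]$ that are right continuous and have left limits, endowed with the Skorokhod topology. A random variable $X$ is symmetric if $X$ and $-X$ have the same distribution. The $\eta_t$ are not required to have mean zero or variance one, and $\sigma_{\gamma_0}$ is the positive square root of $\sigma_{\gamma_0}^2$. *)

(* Defs.v *)
From HB Require Import structures.
From mathcomp Require Import all_boot all_order all_algebra.
From mathcomp Require Import all_classical all_reals all_analysis.
From mathcomp Require Import lra.

Set Implicit Arguments.
Unset Strict Implicit.
Unset Printing Implicit Defensive.

Import Order.TTheory GRing.Theory Num.Theory.
Import numFieldNormedType.Exports.

Local Open Scope classical_set_scope.
Local Open Scope ring_scope.

Section time_change.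
Context {R : realType}.
Implicit Types (lam mu : R -> R).

Definition time_change (lam : R -> R) : Prop :=
  [/\ {within `[0, 1], continuous lam},
      {in `[0, 1] &, {homo lam : s t / s < t}} &
      lam @` `[0, 1] = `[0, 1]%classic].

Lemma time_change_in lam t :
  time_change lam -> t \in `[0, 1] -> lam t \in `[0, 1].
Proof.
move=> [_ _ im] t01.
have : (lam @` `[0, 1]) (lam t) by exists t.
by rewrite im.
Qed.

Lemma time_change_surj lam t :
  time_change lam -> t \in `[0, 1] -> exists2 s, s \in `[0, 1] & lam s = t.
Proof.
move=> [_ _ im] t01.
have : `[0, 1]%classic t by [].
by rewrite -im => -[s s01 <-]; exists s.
Qed.

Lemma time_change_inc_surj lam :
  {in `[0, 1] &, {homo lam : s t / s < t}} ->
  lam @` `[0, 1] = `[0, 1]%classic -> time_change lam.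
Proof.
move=> inc im; split => //.
have lemono : {in `[0, 1] &, {mono lam : s t / s <= t}} by exact: le_mono_in.
have in01 t : t \in `[0, 1] -> lam t \in `[0, 1].
  move=> t01; have : (lam @` `[0, 1]) (lam t) by exists t.
  by rewrite im.
have z01 : (0 : R) \in `[0, 1] by rewrite in_itv /= lexx ler01.
have o01 : (1 : R) \in `[0, 1] by rewrite in_itv /= lexx ler01.
have l0 : lam 0 = 0.
  have : `[0, 1]%classic (0 : R) by [].
  rewrite -im => -[s s01 ls].
  apply/eqP; rewrite eq_le; apply/andP; split.
    rewrite -[X in _ <= X]ls lemono //; move: s01.
    by rewrite /= in_itv /= => /andP[].
  by move: (in01 _ z01); rewrite in_itv /= => /andP[].
have l1 : lam 1 = 1.
  have : `[0, 1]%classic (1 : R) by [].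
  rewrite -im => -[s s01 ls].
  apply/eqP; rewrite eq_le; apply/andP; split.
    by move: (in01 _ o01); rewrite in_itv /= => /andP[].
  rewrite -[X in X <= _]ls lemono //; move: s01.
  by rewrite /= in_itv /= => /andP[].
apply: segment_inc_surj_continuous => //.
by rewrite l0 l1 /set_surj im.
Qed.

Lemma time_change_id : time_change id.
Proof.
apply: time_change_inc_surj; first by move=> ? ? _ _.
by rewrite image_id.
Qed.

Lemma time_change_comp lam mu :
  time_change lam -> time_change mu -> time_change (mu \o lam).
Proof.
move=> hl hm; case: (hl) => _ il iml; case: (hm) => _ im imm.
apply: time_change_inc_surj.
  move=> s t s01 t01 st /=; apply: im; try exact: time_change_in.
  exact: il.
by rewrite -image_comp iml imm.
Qed.

Lemma time_change_inv lam : time_change lam ->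
  exists2 mu, time_change mu & {in `[0, 1], cancel mu lam}.
Proof.
move=> hl; case: (hl) => _ il iml.
have /choice [mu hmu] : forall t, exists s,
    t \in `[0, 1] -> s \in `[0, 1] /\ lam s = t.
  move=> t; have [t01|_] := boolP (t \in `[0, 1]); last by exists 0.
  by have [s s01 ls] := time_change_surj hl t01; exists s.
have mono : {in `[0, 1] &, {mono lam : s t / s < t}}.
  exact/leW_mono_in/le_mono_in.
exists mu; last by move=> t /hmu[].
apply: time_change_inc_surj.
  move=> s t s01 t01 st.
  have [m1 e1] := hmu _ s01; have [m2 e2] := hmu _ t01.
  by rewrite -mono // e1 e2.
rewrite predeqE => t; split => [[s s01 <-]|t01]; first by have [] := hmu _ s01.
have l01 : lam t \in `[0, 1] by exact: time_change_in.
exists (lam t) => //.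
have [m1 e1] := hmu _ l01.
by apply: (inc_inj_in (le_mono_in il)).
Qed.

End time_change.

Section cadlag.
Context {R : realType}.

Definition cadlag (x : R -> R) : Prop :=
  (forall t : R, t \in `[0, 1[ -> x @ t^'+ --> x t) /\
  (forall t : R, t \in `]0, 1] -> cvg (x @ t^'-)).

(* Functions on [0, 1] are represented by their extension by 0, so that equality
   of elements is equality of functions on [0, 1]. *)
Record skorokhod := Skorokhod {
  sk_path :> R -> R ;
  sk_cadlag : cadlag sk_path ;
  sk_out : forall t : R, t \notin `[0, 1] -> sk_path t = 0 }.

Lemma skorokhod_eq (x y : skorokhod) :
  {in `[0, 1], sk_path x =1 sk_path y} -> x = y.
Proof.
case: x y => [x cx ox] [y cy oy] /= xy.
have {}xy : x = y.
  apply/funext => t; have [t01|t01] := boolP (t \in `[0, 1]).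
    exact: xy.
  by rewrite ox // oy.
by subst y; congr Skorokhod; exact: Prop_irrelevance.
Qed.

Lemma cadlag_bounded (x : skorokhod) : exists M : R, forall t : R, `|x t| <= M.
Proof.
pose bnd (a b : R) := exists M : R, forall t : R, t \in `[a, b] -> `|x t| <= M.
have bnd_cat a b c : bnd a b -> bnd b c -> bnd a c.
  move=> [M hM] [N hN]; exists (Num.max M N) => t; rewrite in_itv /=.
  move=> /andP[at_ tc]; rewrite le_max.
  have [tb|bt] := leP t b; first by rewrite hM ?in_itv /= ?at_.
  by rewrite hN ?orbT // in_itv /= (ltW bt).
have bnd_sub a b a' b' : a <= a' -> b' <= b -> bnd a b -> bnd a' b'.
  move=> aa bb [M hM]; exists M => t; rewrite in_itv /= => /andP[h1 h2].
  by apply: hM; rewrite in_itv /= (le_trans aa) // (le_trans h2).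
have bnd1 a : bnd a a.
  exists `|x a| => t; rewrite in_itv /= => /andP[h1 h2].
  by rewrite (_ : t = a) //; apply/eqP; rewrite eq_le h1 h2.
have [xr xl] := sk_cadlag x.
have right t : t \in `[0, 1[ -> exists2 e, 0 < e & bnd t (t + e).
  move=> t01; have /cvgrPdist_lt/(_ _ ltr01) := xr t t01.
  rewrite near_withinE => /nbhs_ballP[e /= e0 he].
  exists (e / 2); first exact: divr_gt0.
  exists (`|x t| + 1) => u; rewrite in_itv /= => /andP[tu ut].
  move: tu; rewrite le_eqVlt => /orP[/eqP <-|tu]; first by rewrite lerDl.
  have := he u; rewrite /ball /= => /(_ _ tu).
  have -> : `|t - u| < e by rewrite ltr0_norm ?subr_lt0 //; lra.
  move=> /(_ isT) h.
  have := ler_distD (x t) 0 (x u); rewrite !sub0r !normrN; lra.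
have left t : t \in `]0, 1] -> exists2 e, 0 < e & bnd (t - e) t.
  move=> t01; have /cvg_ex[l /cvgrPdist_lt/(_ _ ltr01)] := xl t t01.
  rewrite near_withinE => /nbhs_ballP[e /= e0 he].
  exists (e / 2); first exact: divr_gt0.
  exists (Num.max `|x t| (`|l| + 1)) => u; rewrite in_itv /= => /andP[tu ut].
  rewrite le_max.
  move: ut; rewrite le_eqVlt => /orP[/eqP ->|ut]; first by rewrite lexx.
  have := he u; rewrite /ball /= => /(_ _ ut).
  have -> : `|t - u| < e by rewrite gtr0_norm ?subr_gt0 //; lra.
  move=> /(_ isT) h; apply/orP; right.
  have := ler_distD l 0 (x u); rewrite !sub0r !normrN; lra.
pose S := [set t : R | t \in `[0, 1] /\ bnd 0 t].
have S0 : S 0 by split; [rewrite in_itv /= lexx ler01|exact: bnd1].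
have S1 : ubound S 1 by move=> t [+ _]; rewrite in_itv /= => /andP[].
have hS : has_sup S by split; [exists 0|exists 1].
pose c := sup S.
have c0 : 0 <= c by apply: ub_le_sup => //; exists 1.
have c1 : c <= 1 by apply: ge_sup => //; exists 0.
have Sc : bnd 0 c.
  move: c0; rewrite le_eqVlt => /orP[/eqP <- //|c0].
  have [|e e0 be] := left c; first by rewrite in_itv /= c0.
  have [s [s01 bs] sc] := sup_adherent e0 hS.
  have sc' : s <= c by apply: ub_le_sup => //; exists 1.
  by apply: bnd_cat bs _; apply: bnd_sub be => //; exact: ltW.
have {}c1 : c = 1.
  apply/eqP; rewrite eq_le c1 /= leNgt; apply/negP => c1'.
  have [|e e0 be] := right c; first by rewrite in_itv /= c0.
  pose m := Num.min (c + e) 1.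
  have cm : c < m by rewrite lt_min ltrDl e0.
  suff Sm : S m by have := ub_le_sup hS.2 Sm; rewrite leNgt cm.
  split; first by rewrite in_itv /= (le_trans c0 (ltW cm)) ge_min lexx orbT.
  by apply: bnd_cat Sc _; apply: bnd_sub be; rewrite ?lexx // ge_min lexx.
move: Sc; rewrite c1 => -[M hM]; exists (Num.max M 0) => t; rewrite le_max.
have [t01|t01] := boolP (t \in `[0, 1]); first by rewrite hM.
by rewrite sk_out // normr0 lexx orbT.
Qed.

(* The distance is Billingsley's metric for the Skorokhod topology: the infimum
   over time changes lam of max (sup |lam - id|) (sup |x - y \o lam|). *)
Definition skorokhod_within (x y : skorokhod) (e : R) : Prop :=
  exists2 lam, time_change lam & forall t : R, t \in `[0, 1] ->
    `|lam t - t| <= e /\ `|x t - y (lam t)| <= e.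

Definition skorokhod_dist (x y : skorokhod) : R :=
  inf [set e | skorokhod_within x y e].

Lemma skorokhod_within_ge0 x y e : skorokhod_within x y e -> 0 <= e.
Proof.
move=> [lam _ /(_ 0)]; rewrite in_itv /= lexx ler01 => /(_ isT)[h _].
exact: le_trans h.
Qed.

Lemma has_inf_skorokhod x y : has_inf [set e | skorokhod_within x y e].
Proof.
split; last by exists 0 => e; exact: skorokhod_within_ge0.
have [M hM] := cadlag_bounded x; have [N hN] := cadlag_bounded y.
exists (M + N), id => [|t _]; first exact: time_change_id.
have M0 : 0 <= M by exact: le_trans (hM 0).
have N0 : 0 <= N by exact: le_trans (hN 0).
rewrite subrr normr0 addr_ge0 //; split => //.
by rewrite (le_trans (ler_normB _ _)) // lerD.
Qed.

Lemma skorokhod_within_sym x y e :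
  skorokhod_within x y e -> skorokhod_within y x e.
Proof.
move=> [lam hl h]; have [mu hm lamK] := time_change_inv hl.
exists mu => // t t01.
have [] := h (mu t) (time_change_in hm t01).
by rewrite lamK // => h1 h2; rewrite distrC (distrC (y t)).
Qed.

Lemma skorokhod_within_trans x y z e1 e2 : skorokhod_within x y e1 ->
  skorokhod_within y z e2 -> skorokhod_within x z (e1 + e2).
Proof.
move=> [l1 hl1 h1] [l2 hl2 h2]; exists (l2 \o l1) => [|t t01 /=].
  exact: time_change_comp.
have [a1 b1] := h1 t t01.
have [a2 b2] := h2 (l1 t) (time_change_in hl1 t01).
split.
  by rewrite (le_trans (ler_distD (l1 t) _ _)) // addrC lerD.
by rewrite (le_trans (ler_distD (y (l1 t)) _ _)) // lerD.
Qed.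

Lemma skorokhod_dist_within x y e :
  skorokhod_dist x y < e -> exists2 e', e' < e & skorokhod_within x y e'.
Proof.
by case: (has_inf_skorokhod x y) => n0 _ /(inf_lt n0)[e' h ee]; exists e'.
Qed.

Lemma skorokhod_dist_le x y e : skorokhod_within x y e -> skorokhod_dist x y <= e.
Proof. by move=> h; apply: ge_inf => //; case: (has_inf_skorokhod x y). Qed.

Lemma skorokhod_distxx x : skorokhod_dist x x = 0.
Proof.
have [n0 _] := has_inf_skorokhod x x.
apply/eqP; rewrite eq_le; apply/andP; split.
  apply: skorokhod_dist_le; exists id => [|t _]; first exact: time_change_id.
  by rewrite !subrr normr0.
by apply: lb_le_inf => // e; exact: skorokhod_within_ge0.
Qed.

Lemma skorokhod_dist_sym x y : skorokhod_dist x y = skorokhod_dist y x.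
Proof.
by congr inf; rewrite predeqE => e; split; exact: skorokhod_within_sym.
Qed.

Lemma skorokhod_dist_triangle y x z :
  skorokhod_dist x z <= skorokhod_dist x y + skorokhod_dist y z.
Proof.
apply/ler_addgt0Pr => e e0; have e20 : 0 < e / 2 by exact: divr_gt0.
have [|e1 e1lt h1] := @skorokhod_dist_within x y (skorokhod_dist x y + e / 2).
  by rewrite ltrDl.
have [|e2 e2lt h2] := @skorokhod_dist_within y z (skorokhod_dist y z + e / 2).
  by rewrite ltrDl.
have := skorokhod_dist_le (skorokhod_within_trans h1 h2); lra.
Qed.

Lemma skorokhod_dist_positivity x y : skorokhod_dist x y = 0 -> x = y.
Proof.
move=> xy0; apply: skorokhod_eq => t t01.
have close e : 0 < e -> skorokhod_within x y e.
  move=> e0; have [|e' e'e [lam hl h]] := @skorokhod_dist_within x y e.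
    by rewrite xy0.
  exists lam => // s /h[h1 h2].
  by split; [exact: le_trans h1 (ltW e'e)|exact: le_trans h2 (ltW e'e)].
suff h e : 0 < e -> `|x t - y t| <= e *+ 3.
  apply/eqP; rewrite -subr_eq0 -normr_le0; apply/ler_addgt0Pr => e e0.
  have := h (e / 3); rewrite divr_gt0 // => /(_ isT); rewrite -mulr_natr; lra.
move=> e0; move: (t01); rewrite in_itv /= => /andP[t0].
rewrite le_eqVlt => /orP[/eqP t1|t1].
  have [lam hl h] := close _ e0.
  have lamt : lam t = t.
    have [s s01 ls] := time_change_surj hl t01.
    have : s <= t by move: s01; rewrite t1 in_itv /= => /andP[].
    rewrite le_eqVlt => /orP[/eqP st|st]; first by rewrite -[in LHS]st ls.
    have [_ inc _] := hl; have := inc _ _ s01 t01 st.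
    have := time_change_in hl t01; rewrite in_itv /= => /andP[_].
    rewrite ls -t1; lra.
  have [_] := h t t01; rewrite lamt -mulr_natr; lra.
have t01' : t \in `[0, 1[ by rewrite in_itv /= t0.
have [xr _] := sk_cadlag x; have [yr _] := sk_cadlag y.
have /cvgrPdist_lt/(_ _ e0) := xr t t01'.
rewrite near_withinE => /nbhs_ballP[dx /= dx0 hx].
have /cvgrPdist_lt/(_ _ e0) := yr t t01'.
rewrite near_withinE => /nbhs_ballP[dy /= dy0 hy].
pose dl := Num.min (Num.min dx dy) (1 - t).
have dl0 : 0 < dl by rewrite !lt_min dx0 dy0 subr_gt0.
have [dlx dly dlt] : [/\ dl <= dx, dl <= dy & dl <= 1 - t].
  by rewrite !ge_min !lexx !orbT.
pose u := t + dl / 2.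
have [] : 0 < Num.min e (dl / 4) /\ u \in `[0, 1].
  by rewrite lt_min e0 divr_gt0 // in_itv /= /u; split => //; lra.
move=> /close[lam hl h] u01; have [] := h u u01.
rewrite !le_min => /andP[_ lu] /andP[xu _].
have {hx} := hx u; rewrite /ball /=.
have -> : `|t - u| < dx by rewrite /u opprD addNKr normrN gtr0_norm; lra.
have -> : t < u by rewrite /u; lra.
move=> /(_ isT isT) hx.
move: lu; rewrite ler_norml => /andP[lu1 lu2].
have {hy} := hy (lam u); rewrite /ball /=.
have tl : t < lam u by move: lu1; rewrite /u; lra.
have -> : `|t - lam u| < dy.
  by rewrite ltr0_norm ?subr_lt0 //; move: lu2; rewrite /u; lra.
move=> /(_ isT tl) hy.
have h1 := ler_distD (x u) (x t) (y t).
have h2 := ler_distD (y (lam u)) (x u) (y t).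
move: hy; rewrite distrC => hy.
rewrite -mulr_natr; lra.
Qed.

HB.instance Definition _ := gen_eqMixin skorokhod.
HB.instance Definition _ := gen_choiceMixin skorokhod.
HB.instance Definition _ := isMetric.Build R skorokhod skorokhod_distxx
  skorokhod_dist_positivity skorokhod_dist_sym skorokhod_dist_triangle.

Lemma cadlag_cst0 : cadlag (fun _ : R => 0 : R).
Proof.
split=> t _; first exact: cvg_cst.
by apply/cvg_ex; exists 0; exact: cvg_cst.
Qed.

HB.instance Definition _ := isPointed.Build skorokhod
  (Skorokhod cadlag_cst0 (fun t _ => erefl)).

End cadlag.
Arguments skorokhod R : clear implicits.

Definition borel (S : ptopologicalType) := g_sigma_algebraType (@open S).


Section weak_convergence.
Context d (T : measurableType d) d' (T' : measurableType d') (R : realType).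
Variables (P : probability T R) (P' : probability T' R).

Definition weakly_converges (S : ptopologicalType)
    (X : nat -> {RV P >-> borel S}) (Y : {RV P' >-> borel S}) : Prop :=
  forall f : S -> R, continuous f -> (exists M : R, forall x, `|f x| <= M) ->
  ('E_P[fun w => f (X n w)] @[n --> \oo] --> 'E_P'[fun w => f (Y w)])%E.

(* Real processes indexed by [0, 1] converge weakly in D[0, 1] when they are
   (the coordinates of) random elements of that space which do so; values at
   times outside [0, 1] are irrelevant. *)
Definition weakly_converges_D01 (X : nat -> R -> T -> R) (Y : R -> T' -> R)
    : Prop :=
  exists (XD : nat -> {RV P >-> borel (skorokhod R)})
         (YD : {RV P' >-> borel (skorokhod R)}),
  [/\ forall n w, {in `[0, 1], forall s, sk_path (XD n w) s = X n s w},
      forall w, {in `[0, 1], forall s, sk_path (YD w) s = Y s w} &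
      weakly_converges XD YD].

End weak_convergence.

Section probability.
Context d (T : measurableType d) (R : realType).
Variable P : probability T R.

Definition identically_distributed (X Y : T -> R) : Prop :=
  forall A : set R, measurable A -> P (X @^-1` A) = P (Y @^-1` A).

Definition symmetric_rv (X : T -> R) : Prop :=
  identically_distributed X (fun w => - X w).

Definition mutually_independent (I : eqType) (X : I -> T -> R) : Prop :=
  forall (J : seq I) (A : I -> set R), uniq J ->
  (forall i, i \in J -> measurable (A i)) ->
  P (\bigcap_(i in [set` J]) X i @^-1` A i)
    = (\prod_(i <- J) P (X i @^-1` A i))%E.

Definition sigma_generated (I : Type) (X : I -> T -> R) : set (set T) :=
  <<s \bigcup_i preimage_set_system setT (X i) measurable >>.

Definition independent_of_family (I : Type) (Y : T -> R) (X : I -> T -> R)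
    : Prop :=
  forall (A : set R) (E : set T), measurable A -> sigma_generated X E ->
  P (Y @^-1` A `&` E) = (P (Y @^-1` A) * P E)%E.

(* Mean and variance of an extended-real random variable: log 0 is -oo, so that
   the variance of log |Z| is +oo when P (Z = 0) > 0, whereas the real-valued ln
   has ln 0 = 0. *)
Definition emean (X : T -> \bar R) : \bar R := (\int[P]_w X w)%E.

Definition evariance (X : T -> \bar R) : \bar R :=
  (\int[P]_w (X w - emean X) ^+ 2)%E.

(* Only the values at times in [0, 1] matter. *)
Record standard_brownian_motion (B : R -> {RV P >-> R}) : Prop := {
  bm_start : P [set w | B 0 w = 0] = 1%E ;
  bm_independent_increments : forall (k : nat) (t : nat -> R),
    0 <= t 0%N -> (forall i, (i < k)%N -> t i <= t i.+1) -> t k <= 1 ->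
    mutually_independent (fun (i : 'I_k) w => B (t i.+1) w - B (t i) w) ;
  bm_gaussian_increments : forall s t : R, 0 <= s -> s < t -> t <= 1 ->
    forall A : set R, measurable A ->
    P ((fun w => B t w - B s w) @^-1` A) = normal_prob 0 (Num.sqrt (t - s)) A ;
  bm_continuous : forall w, {within `[0, 1], continuous (fun s : R => B s w)} }.

End probability.

(* The noise is indexed from 1 on: eta 0 is not used. *)
Fixpoint ar_path (R : realType) (T : Type) (phi0 alpha0 : R)
    (eta : nat -> T -> R) (y0 : T -> R) (t : nat) (w : T) : R :=
  if t is t'.+1 then
    let y := ar_path phi0 alpha0 eta y0 t' w in
    phi0 * y + eta t w * Num.sqrt (alpha0 * y ^+ 2)
  else y0 w.

(* Main.v *)
From HB Require Import structures.
Require Import Defs.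
From mathcomp Require Import all_boot all_order all_algebra.
From mathcomp Require Import all_classical all_reals all_analysis.
From mathcomp Require Import measurable_realfun lra ring.

(* Since eta_t is symmetric and independent of the sign of y_{t-1}, the variables
   eta_t sgn(y_{t-1}) are again i.i.d. with the law of eta_1, and
   y_t = y_{t-1} (phi0 + eta_t sgn(y_{t-1}) sqrt alpha0).  Hence log |y_t| is a
   random walk with i.i.d. increments of variance sigma0^2, and the process of
   the theorem is almost surely the exponential of its centered rescaling, so
   Donsker's theorem and the continuity of x |-> exp x on D[0, 1] conclude.
   Donsker's theorem is obtained by comparing the walk with the increments of
   the Brownian motion over the grid i / n: both are rows of i.i.d. centered
   variables of variance sigma0^2 / n.  For a Lipschitz functional, the walk is
   replaced by its values at the ends of m blocks, at a cost controlled by a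
   maximal inequality; the laws of the m block sums are then compared by
   Lindeberg's replacement argument.  Because the Brownian motion is given,
   neither tightness nor a central limit theorem is needed. *)

Set Implicit Arguments.
Unset Strict Implicit.
Unset Printing Implicit Defensive.

Import Order.TTheory GRing.Theory Num.Theory.
Import numFieldNormedType.Exports.

Local Open Scope classical_set_scope.
Local Open Scope ring_scope.

(** * Smoothing and Taylor estimates *)

(** Cutting the walk into m blocks requires the probability that some block oscillates by more than
    [eps] to vanish as m grows. With variances alone, each block contributes a quantity of order V /
    (m eps^2), where V is the total variance, and the sum over the blocks does not vanish. Fourth
    moments would give m (V / m)^2 / eps^4, but the logarithms have only two moments. The function
    [psi] reconciles both: it is of fourth order at 0, so that its drift along the walk is of
    fourth-moment type, and of second order at infinity, so that n E psi (X / sqrt n) tends to 0 by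
    dominated convergence. This limit is also the Lindeberg condition of the replacement argument,
    hence the single parameter [rho] used throughout. Steps are exchanged inside iterated
    convolution operators, which only see the laws; the walk and the Brownian motion therefore need
    not live on a common probability space. The constants are fixed in the order [eps], m, smoothing
    error, [e], and only then n. *)

Section psi.
Context {R : realType}.
Implicit Types s u x : R.

(* A smooth function comparable to min (x^2, x^4): it controls both the Lindeberg
   remainders and, being at least 1/2 outside [-1, 1], exit probabilities; its
   integral is finite under a second moment assumption only. *)
Definition psi x : R := x ^+ 4 / (1 + x ^+ 2).

(** The derivative of [psi], read off from psi x = x^2 - 1 + 1 / (1 + x^2). *)
Definition dpsi x : R := 2 * x - 2 * x / (1 + x ^+ 2) ^+ 2.

Lemma psi_ge0 x : 0 <= psi x.
Proof. by rewrite divr_ge0 ?exprn_even_ge0// addr_ge0// sqr_ge0. Qed.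

Lemma psi_le4 x : psi x <= x ^+ 4.
Proof.
rewrite ler_pdivrMr ?ltr_wpDr ?sqr_ge0// ler_peMr ?exprn_even_ge0//.
by rewrite lerDl sqr_ge0.
Qed.

Lemma psi_le2 x : psi x <= x ^+ 2.
Proof.
have x20 : 0 <= x ^+ 2 by exact: sqr_ge0.
rewrite ler_pdivrMr ?ltr_wpDr// -[4%N]/((2 + 2)%N) exprD ler_wpM2l//; lra.
Qed.

Lemma psi_ge_half x : 1 <= `|x| -> 1 / 2 <= psi x.
Proof.
move=> x1; have x21 : 1 <= x ^+ 2 by rewrite -real_normK ?num_real// exprn_ege1.
rewrite ler_pdivlMr; last by lra.
rewrite -[4%N]/((2 + 2)%N) exprD; nra.
Qed.

(** The second derivative of [psi] vanishes at 0, so the second-order term costs only s^2 u^2 and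
    what remains is of the size of psi u. A remainder of order u^2 would lose the quadratic
    dependence on the block variance in the maximal inequality. For a centered step u, the linear
    term has mean zero. *)
Lemma psi_taylor s u :
  psi (s + u) <= psi s + dpsi s * u + 8 * (s ^+ 2 * u ^+ 2 + psi u).
Proof.
set q := 1 + s ^+ 2; set r := 1 + (s + u) ^+ 2; set v := 1 + u ^+ 2.
have q1 : 1 <= q by rewrite lerDl sqr_ge0.
have r1 : 1 <= r by rewrite lerDl sqr_ge0.
have v1 : 1 <= v by rewrite lerDl sqr_ge0.
(* The exact remainder, with u^2 factored out. The fraction is bounded in [h1] and 1 - 1 / (q r) in
   [h2]; the coefficients 5 + 3 and 2 + 2 are at most 8. *)
have -> : psi (s + u) = psi s + dpsi s * u +
    u ^+ 2 * (1 - (q * r)^-1 + (4 * s ^+ 2 + 2 * s * u) / (q ^+ 2 * r)).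
  rewrite /psi /dpsi -/q -/r.
  have -> : (s + u) ^+ 4 = (r - 1) ^+ 2 by rewrite /r; ring.
  have -> : s ^+ 4 = (q - 1) ^+ 2 by rewrite /q; ring.
  have rE : r = q + 2 * s * u + u ^+ 2 by rewrite /r /q; ring.
  have q0 : q != 0 by lra.
  have r0 : r != 0 by lra.
  have sE : s ^+ 2 = q - 1 by rewrite /q; ring.
  apply/eqP; rewrite -subr_eq0; apply/eqP.
  transitivity ((q^+2 * (r-1)^+2 - q * (q-1)^+2 * r - (2 * s * q ^+ 2 * r - 2 * s * r) * u
     - u^+2 * (q ^+ 2 * r - q + 4 * s^+2 + 2 * s * u)) / (q^+2 * r)).
    by field; rewrite q0 r0.
  by rewrite rE {}sE /q; field; rewrite -/q -rE q0 r0.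
rewrite lerD2l.
have -> : psi u = u ^+ 2 * (u ^+ 2 / v) by rewrite /psi -/v; ring.
rewrite (_ : 8 * _ = u ^+ 2 * (8 * (s ^+ 2 + u ^+ 2 / v))); last ring.
rewrite ler_wpM2l ?sqr_ge0//.
have uv0 : 0 <= u ^+ 2 / v by rewrite divr_ge0 ?sqr_ge0//; lra.
have h1 : (4 * s ^+ 2 + 2 * s * u) / (q ^+ 2 * r) <= 5 * s ^+ 2 + 2 * (u ^+ 2 / v).
  have qr1 : 1 <= q ^+ 2 * r by rewrite mulr_ege1// exprn_ege1.
  apply: (@le_trans _ _ ((5 * s ^+ 2) / (q ^+ 2 * r) + u ^+ 2 / (q ^+ 2 * r))).
    rewrite -mulrDl ler_wpM2r ?invr_ge0//; first by lra.
    by have := sqr_ge0 (s - u); rewrite sqrrB; lra.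
  apply: lerD.
    rewrite ler_pdivrMr; last exact: lt_le_trans ltr01 qr1.
    by rewrite ler_peMr// mulr_ge0// sqr_ge0.
  rewrite mulrCA ler_wpM2l ?sqr_ge0//.
  rewrite -[2]invrK -invfM lef_pV2 ?posrE; [|lra|lra].
  rewrite ler_pdivrMl//.
  apply: (@le_trans _ _ (2 * (q * r))); last first.
    rewrite ler_pM2l// ler_wpM2r ?expr2 ?ler_peMr//; lra.
  rewrite /v /q /r.
  have := sqr_ge0 (2 * s + u); have := sqr_ge0 (s * (s + u)); nra.
have h2 : 1 - (q * r)^-1 <= 3 * s ^+ 2 + 2 * (u ^+ 2 / v).
  have qV : 0 < q^-1 <= 1 by rewrite invr_gt0 invf_le1//; lra.
  have rV : 0 < r^-1 <= 1 by rewrite invr_gt0 invf_le1//; lra.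
  have hq : 1 - q^-1 <= s ^+ 2.
    have -> : 1 - q^-1 = s ^+ 2 / q by rewrite /q; field; rewrite -/q; lra.
    rewrite ler_pdivrMr; last exact: lt_le_trans ltr01 q1.
    by rewrite ler_peMr// sqr_ge0.
  have hr : 1 - r^-1 <= 2 * s ^+ 2 + 2 * (u ^+ 2 / v).
    have -> : 1 - r^-1 = (s + u) ^+ 2 / r by rewrite /r; field; rewrite -/r; lra.
    rewrite ler_pdivrMr; last lra.
    have : (s + u) ^+ 2 <= 2 * s ^+ 2 + 2 * u ^+ 2.
      by have := sqr_ge0 (s - u); rewrite sqrrB sqrrD; lra.
    have uvE : u ^+ 2 / v * v = u ^+ 2 by rewrite divfK//; lra.
    have uvE2 : u ^+ 2 / v = 1 - v^-1 by rewrite /v; field; rewrite -/v; lra.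
    have vV : 0 < v^-1 <= 1 by rewrite invr_gt0 invf_le1//; lra.
    rewrite /r => h.
    have [h'|h'] := leP ((s + u) ^+ 2) (u ^+ 2 / v * 2).
      have : 0 <= (s+u)^+2 by exact: sqr_ge0.
      have : 0 <= s ^+ 2 by exact: sqr_ge0.
      nra.
    nra.
  rewrite invfM; nra.
lra.
Qed.

End psi.

Section taylor.
Context {R : realType}.
Implicit Types f g df : R -> R.

Lemma is_derive_translate f df (k : R) : (forall x : R, is_derive x 1 f (df x)) ->
  forall t : R, is_derive t 1 (fun t => f (t + k)) (df (t + k)).
Proof.
move=> fdf t.
have h1 : is_derive (t + k) 1 f (df (t + k)) by exact: fdf.
have h2 : is_derive t 1 (fun t => t + k) 1 by apply: is_derive_eq; rewrite addr0.
by have := @is_derive1_comp R f (fun t => t + k) t _ _ h1 h2; rewrite mulr1.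
Qed.

Lemma mvt_bound f df (B u : R) : (forall t : R, is_derive t 1 f (df t)) ->
  (forall t, `|t| <= `|u| -> `|df t| <= B) -> `|f u - f 0| <= B * `|u|.
Proof.
move=> fdf dfB.
have cf a b : {within `[a, b], continuous f}.
  by apply: derivable_within_continuous => x _; exact: ex_derive.
have [u0|u0] := leP 0 u.
  have [c] := MVT_segment u0 (fun x _ => fdf x) (cf 0 u).
  rewrite in_itv/= => /andP[c0 cu] ->; rewrite subr0 normrM ler_wpM2r//.
  by apply: dfB; rewrite !ger0_norm.
have [c] := MVT_segment (ltW u0) (fun x _ => fdf x) (cf u 0).
rewrite in_itv/= => /andP[uc c0]; rewrite sub0r distrC => ->.
rewrite normrM normrN ler_wpM2r//.
by apply: dfB; rewrite !ler0_norm ?lerN2// ltW.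
Qed.

Lemma taylor2_bound g (g1 g2 : R -> R) (L L' : R) x u :
  (forall x : R, is_derive x 1 g (g1 x)) -> (forall x : R, is_derive x 1 g1 (g2 x)) ->
  (forall x y, `|g2 x - g2 y| <= L * `|x - y|) ->
  (forall x y, `|g2 x - g2 y| <= L') ->
  let r := `|g (x + u) - g x - g1 x * u - g2 x * (u ^+ 2 / 2)| in
  r <= L * `|u| ^+ 3 /\ r <= L' * `|u| ^+ 2.
Proof.
move=> dg dg1 gL gL'.
have L0 : 0 <= L by have := le_trans (normr_ge0 _) (gL 1 0); rewrite subr0 normr1 mulr1.
pose r1 t := g1 (x + t) - g1 x - g2 x * t.
pose r0 t := g (x + t) - g x - g1 x * t - g2 x * (t ^+ 2 / 2).
have shift f df : (forall x : R, is_derive x 1 f (df x)) ->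
    forall t : R, is_derive t 1 (fun t => f (x + t)) (df (x + t)).
  move=> fdf t; rewrite [x + t]addrC.
  by under eq_fun do rewrite [x + _]addrC; exact: is_derive_translate.
have dr1 (t : R) : is_derive t 1 r1 (g2 (x + t) - g2 x).
  have h := shift _ _ dg1 t.
  rewrite /r1; apply: is_derive_eq.
  rewrite /GRing.scale/=; ring.
have dr0 (t : R) : is_derive t 1 r0 (r1 t).
  have h := shift _ _ dg t.
  rewrite /r0; apply: is_derive_eq.
  by rewrite /r1 /GRing.scale/=; field.
have r1E : r1 0 = 0 by rewrite /r1 addr0 subrr mulr0 subr0.
have r0E : r0 0 = 0 by rewrite /r0 addr0 expr0n/=; lra.
have L'0 : 0 <= L' by exact: le_trans (normr_ge0 _) (gL' 0 0).
split.
- rewrite -[X in `|X|]/(r0 u) -[r0 u]subr0 -r0E exprSr mulrA.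
  apply: (mvt_bound dr0) => t tu.
  rewrite -[r1 t]subr0 -r1E.
  apply: (@le_trans _ _ (L * `|u| * `|t|)).
    apply: (mvt_bound dr1) => s st; apply: le_trans (gL _ _) _.
    by rewrite addrAC subrr add0r ler_wpM2l// (le_trans st).
  by rewrite expr2 mulrA ler_wpM2l// mulr_ge0.
- rewrite -[X in `|X|]/(r0 u) -[r0 u]subr0 -r0E exprSr expr1 mulrA.
  apply: (mvt_bound dr0) => t tu.
  rewrite -[r1 t]subr0 -r1E.
  apply: (@le_trans _ _ (L' * `|t|)).
    by apply: (mvt_bound dr1) => s st; exact: gL'.
  by rewrite ler_wpM2l.
Qed.

End taylor.

(** * Smoothing by moving averages *)

Section moving_average.
Context {R : realType}.
Variable d : R.
Hypothesis d0 : 0 < d.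
Implicit Types (f : R -> R) (x y t : R).

Local Notation mu := (@lebesgue_measure R).

Definition moving_average f x : R := d^-1 * \int[mu]_(t in `[x, x + d]) f t.

Lemma integrable_continuous f a b : continuous f -> mu.-integrable `[a, b] (EFin \o f).
Proof.
move=> cf; apply: continuous_compact_integrable; first exact: segment_compact.
exact: continuous_subspaceT.
Qed.

Lemma is_derive_moving_average f (x : R) : continuous f ->
  is_derive x 1 (moving_average f) (d^-1 * (f (x + d) - f x)).
Proof.
(* A primitive based at x - 1, so that x and x + d both lie to the right of the base point, where
   the fundamental theorem of calculus applies. *)
move=> cf; pose F y := \int[mu]_(t in `[x - 1, y]) f t.
have dF (y : R) : x - 1 < y -> is_derive y 1 F (f y).
  move=> xy; have [||||h <-] := @continuous_FTC1_closed R f (x - 1) y (y + 1).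
  - by rewrite ltrDl.
  - exact: integrable_continuous.
  - exact: xy.
  - exact: cf.
  by rewrite derive1E; exact: derivableP.
have h1 : is_derive x 1 F (f x) by apply: dF; lra.
have h2 : is_derive x 1 (fun y => F (y + d)) (f (x + d)).
  have h3 : is_derive (x + d) 1 F (f (x + d)) by apply: dF; move: d0; lra.
  have h4 : is_derive x 1 (fun t => t + d) 1 by apply: is_derive_eq; rewrite addr0.
  by have := @is_derive1_comp R F (fun t => t + d) x _ _ h3 h4; rewrite mulr1.
apply: (@near_eq_is_derive _ _ _ (fun y => d^-1 * (F (y + d) - F y))).
- have : \forall y \near x, x - 1 < y by apply: lt_nbhsr; rewrite ltrBlDr ltrDl.
  apply: filterS => y xy; rewrite /moving_average; congr (_ * _).
  rewrite /F Rintegral_itvB ?bnd_simp//; [|exact: integrable_continuous|lra|by move: d0; lra].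
  rewrite Rintegral_itv_obnd_cbnd//.
  by apply: integrableS (integrable_continuous y (y + d) cf) => //; exact: subset_itv_oc_cc.
Qed.

Lemma moving_average_near f (C c : R) x : continuous f ->
  (forall t : R, x <= t <= x + d -> `|f t - c| <= C) -> `|moving_average f x - c| <= C.
Proof.
move=> cf fC.
have muE : fine (mu `[x, x + d]) = d.
  by rewrite lebesgue_measure_itv/= lte_fin ltrDl d0 -EFinB/=; lra.
have int_c r : \int[mu]_(t in `[x, x + d]) r = r * d by rewrite Rintegral_cst// muE.
have i1 := integrable_continuous x (x + d) cf.
have i2 r : mu.-integrable `[x, x + d] (EFin \o (fun _ : R => r)).
  by apply: integrable_continuous => y; exact: cvg_cst.
have -> : moving_average f x - c = d^-1 * \int[mu]_(t in `[x, x + d]) (f t - c).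
  rewrite RintegralB// int_c /moving_average mulrBr [c * d]mulrC mulKf ?gt_eqF//.
rewrite normrM gtr0_norm ?invr_gt0// ler_pdivrMl// mulrC -int_c.
have i3 : mu.-integrable `[x, x + d] (EFin \o (fun t => f t - c)).
  by apply: integrable_continuous => y; apply: cvgB; [exact: cf|exact: cvg_cst].
apply: le_trans (le_normr_Rintegral _ i3) _ => //.
apply: le_Rintegral => //.
exact: (integrable_norm i3).
Qed.

End moving_average.

Section smoothing.
Context {R : realType}.

Definition lipschitz_bounded (C : R) (f : R -> R) : Prop :=
  (forall x, `|f x| <= C) /\ (forall x y, `|f x - f y| <= C * `|x - y|).

Lemma lipschitz_continuous (C : R) (f : R -> R) :
  (forall x y, `|f x - f y| <= C * `|x - y|) -> continuous f.
Proof.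
move=> fC x; apply/cvgrPdist_le => /= e e0.
have C0 : 0 <= C by have := le_trans (normr_ge0 _) (fC 1 0); rewrite subr0 normr1 mulr1.
have Ce : 0 < e / (C + 1) by rewrite divr_gt0//; lra.
apply/nbhs_ballP; exists (e / (C + 1)) => //= y; rewrite /ball/= => xy.
apply: le_trans (fC _ _) _.
apply: (@le_trans _ _ (C * (e / (C + 1)))); first by rewrite ler_wpM2l// ltW.
rewrite mulrA ler_pdivrMr; last by lra.
by rewrite mulrDr mulr1 mulrC lerDl ltW.
Qed.

(** The derivatives enter only through the Taylor inequality, so that a convolution keeps the same
    constants by integrating the inequality, without differentiation under the integral sign. *)
Record smooth_triple (C L : R) (g g1 g2 : R -> R) : Prop := {
  st0 : lipschitz_bounded C g ;
  st1 : lipschitz_bounded C g1 ;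
  st2 : lipschitz_bounded C g2 ;
  st_taylor : forall x u,
    let r := `|g (x + u) - g x - g1 x * u - g2 x * (u ^+ 2 / 2)| in
    r <= L * `|u| ^+ 3 /\ r <= L * `|u| ^+ 2 }.

(* Averaging twice over windows of length d turns a bounded Lipschitz function into
   one with a bounded Lipschitz second derivative. *)
Lemma smoothing (C d : R) : 0 < d -> exists C' L : R, forall f : R -> R,
  lipschitz_bounded C f -> exists g g1 g2,
    smooth_triple C' L g g1 g2 /\ forall x, `|g x - f x| <= 2 * C * d.
Proof.
move=> d0.
(* [g] and [g1] are bounded by C, [g2] by 2 C / d, and [g2] is Lipschitz with constant 4 C / d^2.
   These depend on f only through C; the factor 2 in 2 C' covers the oscillation of [g2]. *)
pose C' := Num.max C (Num.max (2 * C / d) (4 * C / d ^+ 2)).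
exists C', (2 * C'); move=> f [fM fK].
have C0 : 0 <= C by exact: le_trans (normr_ge0 _) (fM 0).
have cf : continuous f := lipschitz_continuous fK.
pose g3 := moving_average d f; pose g := moving_average d g3.
have dg3 (x : R) : is_derive x 1 g3 (d^-1 * (f (x + d) - f x)) by exact: is_derive_moving_average.
have cg3 : continuous g3.
  move=> x; apply: differentiable_continuous; apply/derivable1_diffP; exact: ex_derive.
pose g1 x := d^-1 * (g3 (x + d) - g3 x).
pose g2 x := d^-1 * (d^-1 * (f (x + d + d) - f (x + d)) - d^-1 * (f (x + d) - f x)).
have dg (x : R) : is_derive x 1 g (g1 x) by exact: is_derive_moving_average.
have dg1 (x : R) : is_derive x 1 g1 (g2 x).
  have h1 := dg3 x.
  have h2 : is_derive x 1 (fun y => g3 (y + d)) (d^-1 * (f (x + d + d) - f (x + d))).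
    exact: (is_derive_translate d dg3).
  by rewrite /g1; apply: is_derive_eq; rewrite /GRing.scale.
have bounded_mvt (h dh : R -> R) (B : R) : (forall x : R, is_derive x 1 h (dh x)) ->
    (forall x, `|dh x| <= B) -> forall x y, `|h x - h y| <= B * `|x - y|.
  move=> hdh dB x y.
  have hs (t : R) : is_derive t 1 (fun t => h (t + y)) (dh (t + y)).
    exact: is_derive_translate.
  by have := mvt_bound hs (u := x - y) (fun t _ => dB _); rewrite subrK add0r.
have fd x : `|f (x + d) - f x| <= C * d.
  by apply: le_trans (fK _ _) _; rewrite addrAC subrr add0r gtr0_norm.
have dV : 0 < d^-1 by rewrite invr_gt0.
have g3M x : `|g3 x| <= C.
  by rewrite -[g3 x]subr0; apply: moving_average_near => // t _; rewrite subr0.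
have g3K : forall x y, `|g3 x - g3 y| <= C * `|x - y|.
  apply: bounded_mvt dg3 _ => x.
  by rewrite normrM gtr0_norm// ler_pdivrMl// mulrC.
have g3d x : `|g3 (x + d) - g3 x| <= C * d.
  by apply: le_trans (g3K _ _) _; rewrite addrAC subrr add0r gtr0_norm.
have gM x : `|g x| <= C.
  by rewrite -[g x]subr0; apply: moving_average_near => // t _; rewrite subr0.
have g1M x : `|g1 x| <= C.
  by rewrite normrM gtr0_norm// ler_pdivrMl// mulrC.
have gK := bounded_mvt _ _ _ dg g1M.
have g2M x : `|g2 x| <= 2 * C / d.
  rewrite normrM gtr0_norm// mulrC; apply: ler_wpM2r; first exact: ltW.
  apply: le_trans (ler_normB _ _) _.
  rewrite -[2]/(1 + 1) mulrDl !mul1r lerD// normrM gtr0_norm// ler_pdivrMl// mulrC//.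
have g1K := bounded_mvt _ _ _ dg1 g2M.
have g2K x y : `|g2 x - g2 y| <= 4 * C / d ^+ 2 * `|x - y|.
  have -> : g2 x - g2 y = d^-1 ^+ 2 * ((f (x + d + d) - f (y + d + d)) -
      2 * (f (x + d) - f (y + d)) + (f x - f y)) by rewrite /g2; ring.
  rewrite normrM gtr0_norm ?exprn_gt0//.
  rewrite (_ : 4 * C / d ^+ 2 * `|x - y| = d^-1 ^+ 2 * (4 * C * `|x - y|)); last first.
    by rewrite exprVn; ring.
  apply: ler_wpM2l; first by rewrite exprn_ge0// ltW.
  have e1 := fK (x + d + d) (y + d + d).
  have e2 := fK (x + d) (y + d).
  have e3 := fK x y.
  have E z : x + z - (y + z) = x - y by ring.
  move: e1 e2; rewrite -!(addrA _ d d) !E => e1 e2.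
  apply: le_trans (ler_normD _ _) _.
  have := ler_normB (f (x + (d + d)) - f (y + (d + d))) (2 * (f (x + d) - f (y + d))).
  rewrite [`|2 * _|]normrM (ger0_norm (ler0n _ 2)); lra.
have [C1 C2 C3] : [/\ C <= C', 2 * C / d <= C' & 4 * C / d ^+ 2 <= C'].
  by rewrite /C' !le_max !lexx !orbT.
have up a b (h : R -> R) : a <= C' -> b <= C' -> (forall x, `|h x| <= a) ->
    (forall x y, `|h x - h y| <= b * `|x - y|) -> lipschitz_bounded C' h.
  move=> aC bC h1 h2; split => [x|x y]; first exact: le_trans (h1 x) aC.
  by apply: le_trans (h2 x y) _; rewrite ler_wpM2r.
exists g, g1, g2; split; first split.
- exact: up gM gK.
- exact: up g1M g1K.
- exact: up g2M g2K.
- move=> x u.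
  have C'0 : 0 <= C' by exact: le_trans C1.
  apply: (taylor2_bound _ _ dg dg1) => a b.
    by apply: le_trans (g2K a b) _; rewrite ler_wpM2r//; lra.
  apply: le_trans (ler_normB _ _) _.
  rewrite -[2]/(1 + 1) mulrDl mul1r lerD//; exact: le_trans (g2M _) C2.
(* Each of the two averages moves a C-Lipschitz function by at most C d. *)
- move=> x; apply: (@le_trans _ _ (`|g x - g3 x| + `|g3 x - f x|)); first exact: ler_distD.
  rewrite (_ : 2 * C * d = C * d + C * d); last ring.
  apply: lerD; apply: moving_average_near => // t /andP[xt td].
    by apply: le_trans (g3K _ _) _; rewrite ler_wpM2l// ger0_norm; lra.
  by apply: le_trans (fK _ _) _; rewrite ler_wpM2l// ger0_norm; lra.
Qed.

End smoothing.

(** * Independence of the past *)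

Section measurability.
Context d (T : measurableType d) (R : realType).

(** Openness for the sup distance on the first m coordinates, on which alone membership then
    depends. It stands in for a topology on vectors of variable length. *)
Definition box_open (m : nat) (O : set (nat -> R)) : Prop :=
  forall x, O x -> exists2 e : R, 0 < e &
    forall y, (forall j, (j < m)%N -> `|x j - y j| < e) -> O y.

(** [O] is the union of the countably many cubes with rational centre and radius 1 / (N + 1) that it
    contains, and the preimage of a cube is a finite intersection of measurable sets. *)
Lemma measurable_box_open (m : nat) (W : nat -> T -> R) (O : set (nat -> R)) :
  (forall j, (j < m)%N -> measurable_fun setT (W j)) -> box_open m O ->
  measurable [set w | O (fun j => W j w)].
Proof.
move=> mW Oop.
pose box (p : seq rat * nat) : set T :=
  if `[< forall y : nat -> R, (forall j, (j < m)%N ->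
         `|ratr (nth 0 p.1 j) - y j| < p.2.+1%:R^-1) -> O y >]
  then \bigcap_(j in `I_m) [set w | `|ratr (nth 0 p.1 j) - W j w| < p.2.+1%:R^-1]
  else set0.
rewrite (_ : [set w | _] = \bigcup_p box p).
  apply: countable_bigcupT_measurable => [|p]; first exact: countableP.
  rewrite /box; case: ifP => // _.
  apply: fin_bigcap_measurable => // j jm.
  have mV : measurable_fun setT (fun w => `|ratr (nth 0 p.1 j) - W j w|).
    by apply: measurableT_comp => //; apply: measurable_funB => //; exact: mW.
  rewrite (_ : [set w | _] = setT `&` (fun w => `|ratr (nth 0 p.1 j) - W j w|)
      @^-1` `]-oo, p.2.+1%:R^-1[).
    by apply: mV => //; exact: measurable_itv.
  by rewrite setTI; apply/seteqP; split => w /=; rewrite in_itv.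
apply/seteqP; split => w /=; last first.
  move=> [p _]; rewrite /box; case: ifP => // /asboolP h hw; apply: h => j jm.
  exact: (hw j).
move=> /Oop[e e0 he].
(* A cube of radius below e / 2 that contains the point stays within e of it. *)
have [N _ /(_ N)/= hN] : \forall N \near \oo, N.+1%:R^-1 < e / 2.
  have := @cvg_harmonic R; move=> /cvgrPdist_lt/(_ (e/2)).
  rewrite divr_gt0// => /(_ isT); apply: filterS => n /=.
  by rewrite sub0r normrN ger0_norm.
have {}hN : N.+1%:R^-1 < e / 2 := hN (leqnn _).
have /choice[q hq] : forall j, exists q : rat,
    `|ratr q - W j w| < N.+1%:R^-1 :> R.
  move=> j; have [|q] := @rat_in_itvoo R (W j w - N.+1%:R^-1) (W j w + N.+1%:R^-1).
    by rewrite ltrBlDr -addrA ltrDl addr_gt0// invr_gt0.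
  by exists q; rewrite distrC ltr_distlC; move: p; rewrite in_itv.
exists (mkseq q m, N) => //; rewrite /box /=.
case: ifPn => [_ j jm /=|/asboolPn []]; first by rewrite nth_mkseq//.
move=> y hy; apply: he => j jm; have := hy j jm; rewrite nth_mkseq// => h.
have := hq j; have := ler_distD (ratr (q j)) (W j w) (y j).
rewrite (distrC (W j w) (ratr _)) => h1 h2.
move: hN h h1 h2; set a := _^-1; set b := `|_|; set c := `|_|; set f := `|_|. lra.
Qed.

Lemma measurable_fun_box_continuous (m : nat) (W : nat -> T -> R)
    (h : (nat -> R) -> R) :
  (forall j, (j < m)%N -> measurable_fun setT (W j)) ->
  (forall x (e : R), 0 < e -> exists2 r : R, 0 < r &
    forall y, (forall j, (j < m)%N -> `|x j - y j| < r) -> `|h x - h y| < e) ->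
  measurable_fun setT (fun w => h (fun j => W j w)).
Proof.
move=> mW hc; apply: (measurability _ (RGenOInfty.measurableE R)) => //.
move=> _ [_ [a ->] <-]; rewrite setTI.
rewrite (_ : _ @^-1` _ = [set w | h (fun j => W j w) > a]); last first.
  by apply/seteqP; split => w /=; rewrite in_itv/= andbT.
apply: (@measurable_box_open m W [set x | a < h x]) => // x /= ax.
have [|r r0 hr] := hc x (h x - a); first by rewrite subr_gt0.
exists r => // y /hr; have := ler_norm (h x - h y); lra.
Qed.

End measurability.

Section independence.
Context d (T : measurableType d) (R : realType) (P : probability T R).
Local Open Scope ereal_scope.

(** By uniqueness of product measures, the joint law of (p, X) is the product of the law of [p] and
    mu; Tonelli's theorem concludes. The target of [p] is an arbitrary measurable space, so that [p]
    may be the identity from T to T with a coarser sigma-algebra. *)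
Lemma independent_integral d1 (T1 : measurableType d1) d2 (T2 : measurableType d2)
    (p : T -> T1) (X : T -> T2) (mu : probability T2 R) (F : T1 * T2 -> \bar R) :
  measurable_fun setT p -> measurable_fun setT X ->
  (forall A B, measurable A -> measurable B ->
     P (p @^-1` A `&` X @^-1` B) = P (p @^-1` A) * mu B) ->
  measurable_fun setT F -> (forall x, 0 <= F x) ->
  \int[P]_w F (p w, X w) = \int[P]_w \int[mu]_u F (p w, u).
Proof.
move=> mp mX ind mF F0.
pose mp' := isMeasurableFun.Build _ _ _ _ p mp.
pose p' : {mfun T >-> T1} := HB.pack p mp'.
have mpX : measurable_fun setT (fun w => (p w, X w)) by exact: measurable_fun_pair.
pose mpX' := isMeasurableFun.Build _ _ _ _ (fun w => (p w, X w)) mpX.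
pose pX' : {mfun T >-> (T1 * T2)%type} := HB.pack (fun w => (p w, X w)) mpX'.
transitivity (\int[distribution P pX']_z F z).
  by rewrite ge0_integral_pushforward.
transitivity (\int[(distribution P p' \x mu)%E]_z F z).
  apply: eq_measure_integral => A mA _; apply/esym.
  apply: (@product_measure_unique _ _ _ _ _ (distribution P p') mu (distribution P pX')) => //.

rewrite fubini_tonelli1// ge0_integral_pushforward//=.
  exact: measurable_fun_fubini_tonelli_F.
by move=> y _; exact: integral_ge0.
Qed.

Variable X : nat -> T -> R.

(** A pi-system; the sigma-algebra that it generates is the past of X j. Seen as a measurable space
    on the carrier T, this past takes the place of conditional expectations. *)
Definition cylinder (j : nat) : set (set T) := [set E | exists2 A : nat -> set R,
  (forall i, measurable (A i)) & E = \bigcap_(i in `I_j) X i @^-1` A i].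

Definition product_rule (n : nat) : Prop := forall A : nat -> set R,
  (forall i, measurable (A i)) ->
  P (\bigcap_(i in `I_n) X i @^-1` A i) = \prod_(i < n) P (X i @^-1` A i).

Lemma cylinder_setI j : setI_closed (cylinder j).
Proof.
move=> _ _ [A mA ->] [B mB ->]; exists (fun i => A i `&` B i).
  by move=> i; exact: measurableI.
by rewrite -bigcapI; apply: eq_bigcapr => i _; rewrite preimage_setI.
Qed.

Lemma measurable_past i j : (i < j)%N ->
  measurable_fun (setT : set (g_sigma_algebraType (cylinder j))) (X i).
Proof.
move=> ij _ B mB; rewrite setTI; apply: sub_sigma_algebra.
exists (fun k => if k == i then B else setT) => [k|]; first by case: ifP.
apply/seteqP; split => w /=; first by move=> Bw k _ /=; case: eqP => // ->.
by move=> /(_ i ij) /=; rewrite eqxx.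
Qed.

Hypothesis mX : forall i, measurable_fun setT (X i).

Lemma past_measurable j E : <<s cylinder j>> E -> measurable E.
Proof.
have sm : sigma_algebra setT (@measurable _ T).
  split; [exact: measurable0|by move=> A mA; exact: measurableD|].
  by move=> A mA; exact: bigcup_measurable.
apply; split => //= _ [A mA ->]; apply: fin_bigcap_measurable => // i _.
by rewrite -[_ @^-1` _]setTI; exact: mX.
Qed.

Lemma measurable_id_past j :
  measurable_fun setT (idfun : T -> g_sigma_algebraType (cylinder j)).
Proof. by move=> _ B mB; rewrite setTI; exact: (@past_measurable j). Qed.

(** The events E that satisfy the formula form a lambda-system, which contains the pi-system of
    cylinders. *)
Lemma past_independent j n E C : product_rule n -> (j < n)%N ->
  <<s cylinder j>> E -> measurable C ->
  P (E `&` X j @^-1` C) = P E * P (X j @^-1` C).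
Proof.
move=> Xn jn EG mC.
have mXC : measurable (X j @^-1` C) by rewrite -[_ @^-1` _]setTI; exact: mX.
pose H := [set E | measurable E /\ P (E `&` X j @^-1` C) = P E * P (X j @^-1` C)].
suff : <<s cylinder j>> `<=` H by move=> /(_ _ EG)[].
apply: (lambda_system_subset (@cylinder_setI j)).
- split => //.
  + by split => //; rewrite setTI probability_setT mul1e.
  + move=> A B BA [mA PA] [mB PB]; split; first exact: measurableD.
    have fin D : measurable D -> P D < +oo.
      by move=> mD; apply: le_lt_trans (probability_le1 P mD) (ltry _).
    set D := X j @^-1` C in PA PB mXC *.
    rewrite (_ : (A `\` B) `&` D = (A `&` D) `\` (B `&` D)); last first.
      by apply/seteqP; split => w /=; tauto.
    have mAD : measurable (A `&` D) by exact: measurableI.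
    have mBD : measurable (B `&` D) by exact: measurableI.
    rewrite (measureD mAD mBD (fin _ mAD)) (measureD mA mB (fin _ mA)).
    rewrite (setIidr BA) (setIidr (setSI (C:=D) BA)) muleBl//.
      by congr (_ - _).
      exact: fin_num_measure.
    by apply: fin_num_adde_defr; exact: fin_num_measure.
  + move=> F ndF HF; have mF i : measurable (F i) by have [] := HF i.
    have mUF : measurable (\bigcup_i F i) by exact: bigcup_measurable.
    split => //.
    have h1 : P (F i) * P (X j @^-1` C) @[i --> \oo] -->
        P (\bigcup_i F i) * P (X j @^-1` C).
      apply: cvgeZr; first exact: fin_num_measure.
      exact: nondecreasing_cvg_mu.
    have h2 : P (F i `&` X j @^-1` C) @[i --> \oo] -->
        P (\bigcup_i (F i `&` X j @^-1` C)).
      apply: nondecreasing_cvg_mu => //.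
      - by move=> i; exact: measurableI.
      - by apply: bigcup_measurable => i _; exact: measurableI.
      - move=> a b ab; apply/subsetPset; apply: setSI; exact/subsetPset/ndF.
    rewrite setI_bigcupl; apply: cvg_unique h2 _ => //.
    rewrite (_ : (fun i => P (F i `&` _)) = fun i => P (F i) * P (X j @^-1` C)) //.
    by apply/funext => i; have [] := HF i.
- move=> _ [A mA ->]; split.
    apply: fin_bigcap_measurable => // i _.
    by rewrite -[_ @^-1` _]setTI; exact: mX.
  (* Both events become cylinders of length n: the coordinates from j on are padded with the full
     set, except that [A2] has C at j. *)
  pose A1 i := if (i < j)%N then A i else setT.
  pose A2 i := if (i < j)%N then A i else if i == j then C else setT.
  have mA1 i : measurable (A1 i) by rewrite /A1; case: ifP.
  have mA2 i : measurable (A2 i) by rewrite /A2; case: ifP => // _; case: ifP.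
  rewrite (_ : \bigcap_(i in `I_j) X i @^-1` A i `&` X j @^-1` C =
     \bigcap_(i in `I_n) X i @^-1` A2 i); last first.
    apply/seteqP; split => w /=.
      move=> [h1 h2] i /= ii; rewrite /A2; case: ifP => [/h1//|_].
      by case: eqP => // ->.
    move=> h; split => [i /= ij|].
      by have := h i (ltn_trans ij jn); rewrite /A2 /= ij.
    by have := h j jn; rewrite /A2 /= ltnn eqxx.
  rewrite (_ : \bigcap_(i in `I_j) X i @^-1` A i =
     \bigcap_(i in `I_n) X i @^-1` A1 i); last first.
    apply/seteqP; split => w /=.
      by move=> h1 i /= ii; rewrite /A1; case: ifP => [/h1//|_].
    move=> h i /= ij.
    by have := h i (ltn_trans ij jn); rewrite /A1 /= ij.
  rewrite !Xn// (bigD1 (Ordinal jn))//= [in RHS](bigD1 (Ordinal jn))//=.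
  rewrite {1}/A2 ltnn eqxx {1}/A1 ltnn preimage_setT probability_setT mul1e muleC.
  congr (_ * _); apply: eq_bigr => i; rewrite -val_eqE /A1 /A2 /=.
  by move=> /negbTE ->; case: ifP.
- by move=> Y _.
Qed.

(** X j is integrated out against its law while the past is frozen. All the estimates on walks use
    independence in this form. *)
Lemma past_integral j n (mu : probability (measurableTypeR R) R)
    (F : g_sigma_algebraType (cylinder j) * measurableTypeR R -> \bar R) :
  product_rule n -> (j < n)%N ->
  (forall A, measurable A -> P (X j @^-1` A) = mu A) ->
  measurable_fun setT F -> (forall x, 0 <= F x) ->
  \int[P]_w F (w, X j w) = \int[P]_w \int[mu]_u F (w, u).
Proof.
move=> Xn jn Xmu mF F0.
apply: (@independent_integral _ (g_sigma_algebraType (cylinder j)) _ _ idfun) => //.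
- exact: measurable_id_past.
- exact: mX.
by move=> A B mA mB; rewrite (@past_independent j n)// Xmu.
Qed.

End independence.

Section probability_integral.
Context d (T : measurableType d) (R : realType) (P : probability T R).
Implicit Types f g : T -> R.

Lemma integrable_bounded f (C : R) : measurable_fun setT f ->
  (forall w, `|f w| <= C) -> P.-integrable setT (EFin \o f).
Proof.
move=> mf fC; apply: measurable_bounded_integrable => //.
  by rewrite (le_lt_trans (probability_le1 P _))// ltry.
exists C; split; first exact: num_real.
by move=> M CM x _; apply: le_trans (fC x) (ltW CM).
Qed.

Lemma integrable_rB f g : P.-integrable setT (EFin \o f) ->
  P.-integrable setT (EFin \o g) -> P.-integrable setT (EFin \o (fun w => f w - g w)).
Proof. by move=> fi gi; have := integrableB measurableT fi gi. Qed.

Lemma integrable_rD f g : P.-integrable setT (EFin \o f) ->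
  P.-integrable setT (EFin \o g) -> P.-integrable setT (EFin \o (fun w => f w + g w)).
Proof. by move=> fi gi; have := integrableD measurableT fi gi. Qed.

Lemma integrable_rZ f (r : R) : P.-integrable setT (EFin \o f) ->
  P.-integrable setT (EFin \o (fun w => r * f w)).
Proof. by move=> fi; have := integrableZl measurableT r fi. Qed.

Lemma Rintegral_prob_cst (r : R) : \int[P]_w r = r.
Proof.
rewrite Rintegral_cst//.
have /(congr1 fine) /= h := probability_setT P.
by rewrite [X in _ * X]h mulr1.
Qed.

Lemma integral_prob_cst (r : R) : (\int[P]_w r%:E = r%:E)%E.
Proof.
have h := probability_setT P.
by rewrite integral_cst// [X in (_ * X)%E]h mule1.
Qed.

Lemma Rintegral_near f (c C : R) : P.-integrable setT (EFin \o f) ->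
  (forall w, `|f w - c| <= C) -> `|\int[P]_w f w - c| <= C.
Proof.
move=> fi fC.
have ic r : P.-integrable setT (EFin \o (fun _ : T => r)).
  by apply: (@integrable_bounded _ `|r|) => //; exact: measurable_cst.
have Ec r : \int[P]_w r = r.
  exact: Rintegral_prob_cst.
have i1 : P.-integrable setT (EFin \o (fun w => f w - c)) by exact: integrable_rB.
rewrite -[X in _ - X]Ec -RintegralB//.
apply: le_trans (le_normr_Rintegral _ i1) _ => //.
rewrite -[leRHS]Ec; apply: le_Rintegral => //; exact: (integrable_norm i1).
Qed.

End probability_integral.

(** * Lindeberg replacement *)

Section convolution.
Context {R : realType}.
Local Notation prob := (probability (measurableTypeR R) R).
Implicit Types (mu nu : prob) (f g : R -> R).

Definition conv mu f (x : R) : R := \int[mu]_u f (x + u).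

Lemma integrable_lipschitz mu (C : R) f (x : R) : lipschitz_bounded C f ->
  mu.-integrable setT (EFin \o (fun u => f (x + u))).
Proof.
move=> [fM fK]; apply: (@integrable_bounded _ _ _ _ _ C) => //.
apply: continuous_measurable_fun; apply: (@lipschitz_continuous _ C) => a b.
by apply: le_trans (fK _ _) _; rewrite opprD addrACA subrr add0r.
Qed.

Lemma conv_lipschitz mu (C : R) f :
  lipschitz_bounded C f -> lipschitz_bounded C (conv mu f).
Proof.
move=> fC; have [fM fK] := fC; split => [x|x y].
  rewrite -[conv _ _ _]subr0; apply: Rintegral_near; first exact: integrable_lipschitz fC.
  by move=> u; rewrite subr0.
rewrite /conv -RintegralB//; [|exact: integrable_lipschitz fC..].
rewrite -[X in `|X|]subr0; apply: Rintegral_near.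
  by apply: integrable_rB => //; exact: integrable_lipschitz fC.
by move=> u; rewrite subr0; apply: le_trans (fK _ _) _; rewrite opprD addrACA subrr addr0.
Qed.

Lemma conv_near mu (C e : R) f g : lipschitz_bounded C f -> lipschitz_bounded C g ->
  (forall x, `|f x - g x| <= e) -> forall x, `|conv mu f x - conv mu g x| <= e.
Proof.
move=> fC gC fg x.
rewrite /conv -RintegralB//; [|exact: integrable_lipschitz fC|exact: integrable_lipschitz gC].
rewrite -[X in `|X|]subr0; apply: Rintegral_near; last by move=> u; rewrite subr0.
by apply: integrable_rB => //; [exact: integrable_lipschitz fC|exact: integrable_lipschitz gC].
Qed.

Lemma conv_smooth_triple mu (C L : R) g (g1 g2 : R -> R) : smooth_triple C L g g1 g2 ->
  smooth_triple C L (conv mu g) (conv mu g1) (conv mu g2).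
Proof.
move=> [h0 h1 h2 ht]; split; try exact: conv_lipschitz.
move=> x u.
have i0 y := integrable_lipschitz mu y h0.
have i1 y := integrable_lipschitz mu y h1.
have i2 y := integrable_lipschitz mu y h2.
have iZ (r : R) (f : R -> R) : mu.-integrable setT (EFin \o f) ->
    mu.-integrable setT (EFin \o (fun v => f v * r)).
  by move=> fi; under eq_fun do rewrite /= mulrC; exact: integrable_rZ.
have j1 := iZ u _ (i1 x); have j2 := iZ (u ^+ 2 / 2) _ (i2 x).
have jB : mu.-integrable setT (EFin \o (fun v => g (x + u + v) - g (x + v))).
  exact: integrable_rB.
have jB1 : mu.-integrable setT (EFin \o (fun v => g (x + u + v) - g (x + v) - g1 (x + v) * u)).
  exact: integrable_rB.
have E : conv mu g (x + u) - conv mu g x - conv mu g1 x * u - conv mu g2 x * (u ^+ 2 / 2) =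
    \int[mu]_v (g (x + v + u) - g (x + v) - g1 (x + v) * u - g2 (x + v) * (u ^+ 2 / 2)).
  under [RHS]eq_Rintegral do rewrite (addrAC x _ u).
  by rewrite RintegralB// RintegralB// RintegralB// !RintegralZr.
have jE : mu.-integrable setT (EFin \o (fun v =>
    g (x + v + u) - g (x + v) - g1 (x + v) * u - g2 (x + v) * (u ^+ 2 / 2))).
  under eq_fun do rewrite /= (addrAC x _ u); exact: integrable_rB.
by split; rewrite E -[X in `|X|]subr0; apply: Rintegral_near => // v; rewrite subr0;
  have [? ?] := ht (x + v) u.
Qed.

(** The last clause is an inequality, so that two laws of equal variance can share one [rho]. For a
    row of n steps, the Lindeberg condition is that n rho tends to 0. *)
Record centered (mu : prob) (v rho : R) : Prop := {
  ct_int : mu.-integrable setT (EFin \o (fun u : R => u ^+ 2)) ;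
  ct_mean : \int[mu]_u u = 0 ;
  ct_var : \int[mu]_u (u ^+ 2) = v ;
  ct_psi : \int[mu]_u psi u <= rho }.

Lemma centered_int mu v rho : centered mu v rho -> mu.-integrable setT (EFin \o (id : R -> R)).
Proof.
move=> ct; have ic : mu.-integrable setT (EFin \o (fun u : R => 1 + u ^+ 2)).
  apply: integrable_rD => //; last exact: ct_int ct.
  by apply: (@integrable_bounded _ _ _ _ _ 1) => // w; rewrite normr1.
apply: (le_integrable measurableT _ _ ic).
  by apply/measurable_EFinP; exact: measurable_id.
move=> x _ /=; rewrite lee_fin [leRHS]ger0_norm.
  rewrite -[x ^+ 2]real_normK ?num_real//.
  have := sqr_ge0 (`|x| - 1); rewrite sqrrB1; have := normr_ge0 x; nra.
by rewrite addr_ge0// sqr_ge0.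
Qed.

Lemma measurable_psi : measurable_fun setT (@psi R).
Proof.
apply: measurable_funM; first exact: exprn_measurable.
apply: continuous_measurable_fun => x; apply: cvgV.
  by rewrite gt_eqF// ltr_wpDr// sqr_ge0.
by apply: cvgD; [exact: cvg_cst|exact: exprn_continuous].
Qed.

Lemma centered_psi_int mu v rho : centered mu v rho -> mu.-integrable setT (EFin \o @psi R).
Proof.
move=> ct; apply: (le_integrable measurableT _ _ (ct_int ct)).
  by apply/measurable_EFinP; exact: measurable_psi.
move=> x _ /=; rewrite lee_fin !ger0_norm ?psi_ge0 ?sqr_ge0//; exact: psi_le2.
Qed.

(** Split at |u| = e: below, |u|^3 <= e u^2; above, e^2 (1 + u^2) <= 2 u^2 bounds u^2 by a multiple
    of psi u. *)
Lemma cube_le_psi (e u : R) : 0 < e -> e <= 1 ->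
  Num.min (`|u| ^+ 3) (`|u| ^+ 2) <= e * u ^+ 2 + 2 / e ^+ 2 * psi u.
Proof.
move=> e0 e1; rewrite ge_min; have [ue|eu] := leP `|u| e.
  apply/orP; left; rewrite exprS real_normK ?num_real//.
  apply: (@le_trans _ _ (e * u ^+ 2)); first by rewrite ler_wpM2r// sqr_ge0.
  by rewrite lerDl mulr_ge0 ?psi_ge0// divr_ge0// exprn_ge0// ltW.
apply/orP; right; rewrite real_normK ?num_real//.
apply: (@le_trans _ _ (2 / e ^+ 2 * psi u)); last first.
  by rewrite lerDr mulr_ge0 ?sqr_ge0// ltW.
have u2 : e ^+ 2 < u ^+ 2 by rewrite -[u ^+ 2]real_normK ?num_real// ltr_pXn2r// nnegrE ltW.
have e20 : 0 < e ^+ 2 by rewrite exprn_gt0.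
have e21 : e ^+ 2 <= 1 by rewrite exprn_ile1// ltW.
have v0 : 0 < 1 + u ^+ 2 by rewrite ltr_wpDr// sqr_ge0.
rewrite (_ : 2 / e ^+ 2 * psi u = 2 * u ^+ 4 / (e ^+ 2 * (1 + u ^+ 2))); last first.
  by rewrite /psi; field; rewrite !gt_eqF.
rewrite ler_pdivlMr ?mulr_gt0// -[4%N]/((2 + 2)%N) exprD.
set a := u ^+ 2 in u2 *; set b := e ^+ 2 in u2 e20 e21 *; nra.
Qed.

(** The mean kills the linear term, so the main part depends on the law only through v, and two laws
    of equal variance agree up to the remainder. *)
Lemma one_step mu (v rho C L e : R) g (g1 g2 : R -> R) :
  centered mu v rho -> smooth_triple C L g g1 g2 -> 0 < e -> e <= 1 -> 0 <= L ->
  forall x, `|conv mu g x - (g x + g2 x * (v / 2))| <= L * (e * v + 2 / e ^+ 2 * rho).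
Proof.
move=> ct st e0 e1 L0 x.
have i0 := integrable_lipschitz mu x (st0 st).
have ii := centered_int ct; have i2 := ct_int ct; have ip := centered_psi_int ct.
have ic r : mu.-integrable setT (EFin \o (fun _ : R => r)).
  by apply: (@integrable_bounded _ _ _ _ _ `|r|).
have Ec r : \int[mu]_u r = r by exact: Rintegral_prob_cst.
have iZ (r : R) (f : R -> R) : mu.-integrable setT (EFin \o f) ->
    mu.-integrable setT (EFin \o (fun v => r * f v)).
  exact: integrable_rZ.
have j1 : mu.-integrable setT (EFin \o (fun u => g (x + u) - g x)) by exact: integrable_rB.
have j2 : mu.-integrable setT (EFin \o (fun u => g (x + u) - g x - g1 x * u)).
  by apply: integrable_rB => //; exact: iZ.
have j3 : mu.-integrable setT (EFin \o (fun u => g2 x / 2 * u ^+ 2)) by exact: iZ.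
have E : conv mu g x - (g x + g2 x * (v / 2)) =
    \int[mu]_u (g (x + u) - g x - g1 x * u - g2 x / 2 * u ^+ 2).
  rewrite (RintegralB measurableT j2 j3) (RintegralB measurableT j1 (iZ _ _ ii)).
  rewrite (RintegralB measurableT i0 (ic _)) Ec.
  rewrite (RintegralZl _ measurableT ii) (RintegralZl _ measurableT i2).
  by rewrite (ct_var ct) (ct_mean ct) /conv; ring.
have j4 : mu.-integrable setT (EFin \o (fun u =>
    g (x + u) - g x - g1 x * u - g2 x / 2 * u ^+ 2)) by exact: integrable_rB.
have j5 : mu.-integrable setT (EFin \o (fun u : R =>
    L * (e * u ^+ 2 + 2 / e ^+ 2 * psi u))).
  by apply: (iZ); apply: integrable_rD => //; exact: iZ.
rewrite E; apply: le_trans (le_normr_Rintegral _ j4) _ => //.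
apply: (@le_trans _ _ (\int[mu]_u (L * (e * u ^+ 2 + 2 / e ^+ 2 * psi u)))).
  apply: le_Rintegral => //; first exact: (integrable_norm j4).
  move=> u _; have [] := st_taylor st x u; set r := `|_| => r1 r2.
  rewrite (_ : `|_| = r); last by rewrite /r; congr `|_ - _|; field.
  apply: (@le_trans _ _ (L * Num.min (`|u| ^+ 3) (`|u| ^+ 2))).
    by rewrite minr_pMr// le_min r1 r2.
  by rewrite ler_wpM2l// cube_le_psi.
have j6 := iZ e _ i2; have j7 := iZ (2 / e ^+ 2) _ ip.
rewrite RintegralZl//; last exact: integrable_rD.
rewrite RintegralD// !RintegralZl// (ct_var ct).
rewrite ler_wpM2l// lerD2l ler_wpM2l//; last exact: ct_psi ct.
by rewrite divr_ge0// exprn_ge0// ltW.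
Qed.

(** Twice the error of [one_step], once for each law. *)
Definition step_error (L e v rho : R) : R := 2 * L * (e * v + 2 / e ^+ 2 * rho).

(** One step is exchanged at a time. It acts on an iterate of [conv nu], which satisfies the Taylor
    bounds with the same constants, and the outer [conv mu] does not increase the sup distance. *)
Lemma iter_conv_smooth mu nu (v rho C L e : R) g (g1 g2 : R -> R) l :
  centered mu v rho -> centered nu v rho -> smooth_triple C L g g1 g2 ->
  0 < e -> e <= 1 -> 0 <= L ->
  forall x, `|iter l (conv mu) g x - iter l (conv nu) g x| <= l%:R * step_error L e v rho.
Proof.
move=> cmu cnu st e0 e1 L0.
have stn k : smooth_triple C L (iter k (conv nu) g) (iter k (conv nu) g1) (iter k (conv nu) g2).
  by elim: k => //= k; exact: conv_smooth_triple.
have lm k : lipschitz_bounded C (iter k (conv mu) g).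
  by elim: k => [|k]; [exact: st0 st|exact: conv_lipschitz].
elim: l => [|l IH] x; first by rewrite subrr normr0 mul0r.
rewrite !iterS.
apply: (le_trans (ler_distD (conv mu (iter l (conv nu) g) x) _ _)).
rewrite -natr1 mulrDl mul1r; apply: lerD.
  exact: (conv_near mu (lm l) (st0 (stn l)) IH).
have h1 := one_step cmu (stn l) e0 e1 L0 x.
have h2 := one_step cnu (stn l) e0 e1 L0 x.
apply: (le_trans (ler_distD (iter l (conv nu) g x + iter l (conv nu) g2 x * (v / 2)) _ _)).
rewrite [X in _ + X]distrC /step_error -mulrA [2 * _]mulr_natl mulr2n.
exact: lerD.
Qed.

Lemma iter_conv_lipschitz mu (C : R) f l :
  lipschitz_bounded C f -> lipschitz_bounded C (iter l (conv mu) f).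
Proof. by move=> fC; elim: l => //= l; exact: conv_lipschitz. Qed.

Lemma iter_conv_near mu (C e : R) f g l :
  lipschitz_bounded C f -> lipschitz_bounded C g ->
  (forall x, `|f x - g x| <= e) ->
  forall x, `|iter l (conv mu) f x - iter l (conv mu) g x| <= e.
Proof.
move=> fC gC fg; elim: l => //= l IH.
apply: (@conv_near mu C e) => //; exact: iter_conv_lipschitz.
Qed.

Lemma lipschitz_boundedW (C C' : R) f : C <= C' ->
  lipschitz_bounded C f -> lipschitz_bounded C' f.
Proof.
move=> CC [fM fK]; split => [x|x y]; first exact: le_trans CC.
by apply: le_trans (fK x y) _; rewrite ler_wpM2r.
Qed.

(** The smoothing error is paid once per law and not once per step, because convolutions contract
    the sup distance. The constant [L] is fixed before the laws and f. *)
Lemma iter_conv_lindeberg (C eps : R) : 0 < eps -> exists2 L : R, 0 <= L &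
  forall mu nu (v rho e : R) f l, lipschitz_bounded C f ->
  centered mu v rho -> centered nu v rho -> 0 < e -> e <= 1 ->
  forall x, `|iter l (conv mu) f x - iter l (conv nu) f x| <=
            eps + l%:R * step_error L e v rho.
Proof.
move=> eps0.
have C0 : 0 < 4 * `|C| + 1 by rewrite ltr_wpDl// mulr_ge0.
(* With this window d the smoothing error 2 C d is at most eps / 2; the added 1 covers C = 0. *)
have [C' [L HL]] := @smoothing R C (eps / (4 * `|C| + 1)) (divr_gt0 eps0 C0).
exists `|L| => // mu nu v rho e f l fC cmu cnu e0 e1 x.
have [g [g1 [g2 [st gf]]]] := HL _ fC.
have L0 : 0 <= L.
  have [h _] := st_taylor st 0 1; apply: le_trans (normr_ge0 _) _.
  by apply: le_trans h _; rewrite normr1 expr1n mulr1.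
rewrite (ger0_norm L0).
have fC' := lipschitz_boundedW (_ : C <= Num.max C C') fC.
have gC' := lipschitz_boundedW (_ : C' <= Num.max C C') (st0 st).
have {}fC' := fC' ltac:(by rewrite le_max lexx).
have {}gC' := gC' ltac:(by rewrite le_max lexx orbT).
have gf' y : `|f y - g y| <= eps / 2.
  rewrite distrC; apply: le_trans (gf y) _.
  have := ler_norm C; have := normr_ge0 C => c1 c2.
  rewrite mulrA ler_pdivrMr//; nra.
have h1 := iter_conv_near mu l fC' gC' gf' x.
have h2 := iter_conv_near nu l fC' gC' gf' x.
have h3 := iter_conv_smooth l cmu cnu st e0 e1 L0 x.
move: h1 h2 h3; rewrite !ler_distl.
set a := iter _ _ _ _; set b := iter _ _ _ _; set c := iter _ _ _ _; set d := iter _ _ _ _.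
move=> /andP[? ?] /andP[? ?] /andP[? ?]; apply/andP; split; lra.
Qed.

End convolution.

(** * Convolution in several coordinates *)

Section block_convolution.
Context {R : realType}.
Local Notation prob := (probability (measurableTypeR R) R).
Implicit Types (mu nu : prob) (h : (nat -> R) -> R) (x y : nat -> R).

Definition shift_coord x (j : nat) (t : R) : nat -> R :=
  fun i => x i + (if i == j then t else 0).

Definition conv_coord mu (j : nat) h x : R := \int[mu]_u h (shift_coord x j u).

(** Sequences stand for vectors of m coordinates: the second clause makes h insensitive to the
    others. *)
Definition lipschitz_bounded_seq (m : nat) (C : R) h : Prop :=
  (forall x, `|h x| <= C) /\
  (forall x y, `|h x - h y| <= C * \sum_(j < m) `|x j - y j|).

Lemma shift_coordD x j (s t : R) :
  shift_coord (shift_coord x j s) j t = shift_coord x j (s + t).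
Proof.
by apply/funext => i; rewrite /shift_coord -addrA; case: eqP => //; rewrite addr0.
Qed.

Lemma shift_coord0 x j : shift_coord x j 0 = x.
Proof. by apply/funext => i; rewrite /shift_coord; case: eqP; rewrite addr0. Qed.

Lemma slice_lipschitz m (C : R) h x j : (j < m)%N -> lipschitz_bounded_seq m C h ->
  lipschitz_bounded C (fun t => h (shift_coord x j t)).
Proof.
move=> jm [hM hK]; split => // s t; apply: le_trans (hK _ _) _.
rewrite (bigD1 (Ordinal jm))//= big1; last first.
  move=> i; rewrite -val_eqE/= => /negbTE ij.
  by rewrite /shift_coord ij !addr0 subrr normr0.
by rewrite /shift_coord eqxx addr0 opprD addrACA subrr add0r.
Qed.

Lemma conv_coord_lipschitz mu m (C : R) h j : (j < m)%N ->
  lipschitz_bounded_seq m C h -> lipschitz_bounded_seq m C (conv_coord mu j h).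
Proof.
move=> jm hC; have [hM hK] := hC.
have ih x : mu.-integrable setT (EFin \o (fun u => h (shift_coord x j u))).
  have := integrable_lipschitz mu 0 (slice_lipschitz x jm hC).
  by under eq_fun do rewrite /= add0r.
split => [x|x y].
  by rewrite -[conv_coord _ _ _ _]subr0; apply: Rintegral_near => // u; rewrite subr0.
rewrite /conv_coord -RintegralB// -[X in `|X|]subr0; apply: Rintegral_near.
  exact: integrable_rB.
move=> u; rewrite subr0; apply: le_trans (hK _ _) _.
rewrite le_eqVlt; apply/orP; left; apply/eqP; congr (_ * _).
by apply: eq_bigr => i _; rewrite /shift_coord opprD addrACA subrr addr0.
Qed.

Lemma iter_conv_coordE mu j h x (t : R) l :
  iter l (conv_coord mu j) h (shift_coord x j t) =
  iter l (conv mu) (fun s => h (shift_coord x j s)) t.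
Proof.
elim: l t => // l IH t; rewrite !iterS /conv_coord /conv.
by apply: eq_Rintegral => u _; rewrite shift_coordD IH.
Qed.

Lemma iter_conv_coord_lipschitz mu m (C : R) h j l : (j < m)%N ->
  lipschitz_bounded_seq m C h -> lipschitz_bounded_seq m C (iter l (conv_coord mu j) h).
Proof. by move=> jm hC; elim: l => //= l; exact: conv_coord_lipschitz. Qed.

(** Evaluated at 0, this is the expectation of h at the vector of k independent sums, the j-th of l
    j steps of law mu. *)
Fixpoint block_conv mu (l : nat -> nat) (k : nat) h : (nat -> R) -> R :=
  if k is k'.+1 then block_conv mu l k' (iter (l k') (conv_coord mu k') h) else h.

Lemma block_conv_near mu m (C e : R) l k h1 h2 : (k <= m)%N ->
  lipschitz_bounded_seq m C h1 -> lipschitz_bounded_seq m C h2 ->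
  (forall x, `|h1 x - h2 x| <= e) ->
  forall x, `|block_conv mu l k h1 x - block_conv mu l k h2 x| <= e.
Proof.
elim: k h1 h2 => // k IH h1 h2 km h1C h2C h12.
apply: IH => //; [exact: ltnW|exact: iter_conv_coord_lipschitz..|].
move=> x; rewrite -(shift_coord0 x k) !iter_conv_coordE.
by apply: (iter_conv_near _ _ (slice_lipschitz x km h1C) (slice_lipschitz x km h2C)).
Qed.

(** Blocks are exchanged one at a time. Along its own coordinate, each is a one-dimensional
    convolution acting on a Lipschitz slice of h, to which [iter_conv_lindeberg] applies. *)
Lemma block_conv_lindeberg (C eps : R) : 0 < eps -> exists2 L : R, 0 <= L &
  forall mu nu (v rho e : R) m h l k, (k <= m)%N -> lipschitz_bounded_seq m C h ->
  centered mu v rho -> centered nu v rho -> 0 < e -> e <= 1 ->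
  forall x, `|block_conv mu l k h x - block_conv nu l k h x| <=
            k%:R * eps + (\sum_(j < k) l j)%:R * step_error L e v rho.
Proof.
move=> eps0; have [L L0 HL] := @iter_conv_lindeberg R C eps eps0.
exists L => // mu nu v rho e m h l k + + cmu cnu e0 e1.
elim: k h => [|k IH] h km hC x; first by rewrite subrr normr0 big_ord0 !mul0r addr0.
rewrite /=; set hm := iter _ (conv_coord mu k) h; set hn := iter _ (conv_coord nu k) h.
have hmC : lipschitz_bounded_seq m C hm by exact: iter_conv_coord_lipschitz.
have hnC : lipschitz_bounded_seq m C hn by exact: iter_conv_coord_lipschitz.
apply: (le_trans (ler_distD (block_conv mu l k hn x) _ _)).
rewrite -natr1 big_ord_recr/= natrD !mulrDl mul1r addrACA [leRHS]addrC.
apply: lerD; last exact: IH _ (ltnW km) hnC x.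
apply: (@block_conv_near mu m C _ l k hm hn (ltnW km) hmC hnC) => {}x.
rewrite /hm /hn -(shift_coord0 x k) !iter_conv_coordE.
by apply: HL => //; exact: slice_lipschitz hC.
Qed.

End block_convolution.

Lemma measurable_sum_seq d (T : measurableType d) (R : realType) (s : seq nat)
    (f : nat -> T -> R) : (forall i, i \in s -> measurable_fun setT (f i)) ->
  measurable_fun setT (fun w => \sum_(i <- s) f i w).
Proof.
elim: s => [|i s IH] mf.
  rewrite [X in measurable_fun _ X](_ : _ = cst 0); first exact: measurable_cst.
  by apply/funext => w; rewrite big_nil.
rewrite [X in measurable_fun _ X](_ : _ = fun w => f i w + \sum_(i <- s) f i w).
  apply: measurable_funD; first by apply: mf; rewrite mem_head.
  by apply: IH => j js; apply: mf; rewrite inE js orbT.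
by apply/funext => w; rewrite big_cons.
Qed.

(** * Expectations of block sums *)

Section block_sums.
Context d (T : measurableType d) (R : realType) (P : probability T R).
Variables (X : nat -> T -> R) (n : nat) (mu : probability (measurableTypeR R) R).
Hypothesis mX : forall i, measurable_fun setT (X i).
Hypothesis indX : product_rule P X n.
Hypothesis lawX : forall i, (i < n)%N ->
  forall A, measurable A -> P (X i @^-1` A) = mu A.

Lemma measurable_lipschitz_seq d' (T' : measurableType d') m (C : R)
    (W : nat -> T' -> R) h :
  (forall j, (j < m)%N -> measurable_fun setT (W j)) -> lipschitz_bounded_seq m C h ->
  measurable_fun setT (fun w => h (fun j => W j w)).
Proof.
move=> mW [hM hK]; apply: (measurable_fun_box_continuous mW) => x e e0.
have C0 : 0 <= C by exact: le_trans (normr_ge0 _) (hM (fun=> 0)).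
have D0 : 0 < C * m%:R + 1 by rewrite ltr_wpDl// mulr_ge0.
exists (e / (C * m%:R + 1)) => [|y xy]; first exact: divr_gt0.
apply: le_lt_trans (hK _ _) _.
apply: (@le_lt_trans _ _ (C * \sum_(j < m) (e / (C * m%:R + 1)))).
  by rewrite ler_wpM2l//; apply: ler_sum => j _; apply/ltW/xy.
rewrite sumr_const card_ord -[X in C * X]mulr_natr.
rewrite (_ : C * _ = e * (C * m%:R) / (C * m%:R + 1)); last first.
  by set D := (C * _ + 1)^-1; ring.
by rewrite ltr_pdivrMr// ltr_pM2l// ltrDl.
Qed.

(** X i is independent of the vector V, which the first i variables determine, so it can be
    integrated out first. *)
Lemma past_conv m (C : R) h i j (V : nat -> T -> R) :
  lipschitz_bounded_seq m C h -> (i < n)%N -> (j < m)%N ->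
  (forall k, (k < m)%N ->
     measurable_fun (setT : set (g_sigma_algebraType (cylinder X i))) (V k)) ->
  \int[P]_w h (shift_coord (fun k => V k w) j (X i w)) =
  \int[P]_w conv_coord mu j h (fun k => V k w).
Proof.
move=> hC ni jm mV; have [hM hK] := hC.
pose F (z : g_sigma_algebraType (cylinder X i) * measurableTypeR R) : R :=
  h (shift_coord (fun k => V k z.1) j z.2).
have mF : measurable_fun setT F.
  apply: (@measurable_lipschitz_seq _
    (g_sigma_algebraType (cylinder X i) * measurableTypeR R)%type m C
    (fun k z => V k z.1 + (if k == j then z.2 else 0)) h _ hC) => k km.
  apply: measurable_funD.
    by apply: measurableT_comp measurable_fst; exact: mV.
  by case: eqP => _; [exact: measurable_snd|exact: measurable_cst].
have mV' k : (k < m)%N -> measurable_fun setT (V k : T -> R).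
  by move=> km _ B mB; apply: (past_measurable mX (j := i)); exact: mV.
have mG : measurable_fun setT (fun w => h (shift_coord (fun k => V k w) j (X i w))).
  apply: (@measurable_lipschitz_seq _ T m C
    (fun k w => V k w + (if k == j then X i w else 0)) h _ hC) => k km.
  apply: measurable_funD; first exact: mV'.
  by case: eqP => _; [exact: mX|exact: measurable_cst].
have hC' := conv_coord_lipschitz mu jm hC.
have mH : measurable_fun setT (fun w => conv_coord mu j h (fun k => V k w)).
  exact: measurable_lipschitz_seq mV' hC'.
have iG := integrable_bounded P mG (fun=> hM _).
have iH := integrable_bounded P mH (fun=> hC'.1 _).
have ih x : mu.-integrable setT (EFin \o (fun u => h (shift_coord x j u))).
  have := integrable_lipschitz mu 0 (slice_lipschitz x jm hC).
  by under eq_fun do rewrite /= add0r.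
have ic d0 (T0 : measurableType d0) (Q : probability T0 R) :
    Q.-integrable setT (EFin \o (fun _ => C)).
  by apply: (@integrable_bounded _ _ _ _ _ `|C|); first exact: measurable_cst.
have Ec d0 (T0 : measurableType d0) (Q : probability T0 R) : \int[Q]_w C = C.
  exact: Rintegral_prob_cst.
(* [past_integral] is stated for nonnegative functions; adding the bound C makes F nonnegative, and
   C is cancelled at the end. *)
have := past_integral mX indX ni (lawX ni) (F := fun z => (F z + C)%:E).
have mFC : measurable_fun setT (fun z => (F z + C)%:E).
  by apply/measurable_EFinP; apply: measurable_funD.
have FC0 z : (0 <= (F z + C)%:E)%E.
  by rewrite lee_fin; have := hM (shift_coord (fun k => V k z.1) j z.2);
    rewrite ler_norml /F => /andP[? _]; lra.
move=> /(_ mFC FC0) /(congr1 fine).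
rewrite [LHS](_ : _ = \int[P]_w (h (shift_coord (fun k => V k w) j (X i w)) + C))//.
rewrite (RintegralD measurableT iG (ic _ _ _)) Ec.
rewrite [RHS](_ : _ = \int[P]_w (conv_coord mu j h (fun k => V k w) + C)); last first.
  congr fine; apply: eq_integral => w _.
  rewrite -[LHS]fineK; last first.
    by apply: (integrable_fin_num measurableT); exact: (integrable_rD (ih (fun k => V k w)) (ic _ _ _)).
  rewrite -[fine _]/(\int[mu]_u (h (shift_coord (fun k => V k w) j u) + C)).
  by rewrite (RintegralD measurableT (ih (fun k => V k w)) (ic _ _ _)) Ec.
by rewrite (RintegralD measurableT iH (ic _ _ _)) Ec => /addIr.
Qed.

Variable b : nat -> nat.
Hypothesis b_le : forall j, (b j <= b j.+1)%N.

(** The entries from k on are 0: the vector is filled block by block in the induction of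
    [block_sum_conv]. *)
Definition block_sum (k j : nat) (w : T) : R :=
  if (j < k)%N then \sum_(b j <= i < b j.+1) X i w else 0.

Lemma block_sum_conv m (C : R) h k : lipschitz_bounded_seq m C h ->
  (k <= m)%N -> (b k <= n)%N ->
  \int[P]_w h (fun j => block_sum k j w) =
  block_conv mu (fun j => b j.+1 - b j)%N k h (fun=> 0).
Proof.
elim: k h => [|k IH] h hC km bkn.
  rewrite /= (_ : (fun w => _) = fun w => h (fun=> 0)).
    exact: Rintegral_prob_cst.
  by apply/funext => w; congr h; apply/funext => j.
have bmono i j : (i <= j)%N -> (b i <= b j)%N.
  elim: j => [|j IHj]; first by rewrite leqn0 => /eqP ->.
  by rewrite leq_eqVlt => /predU1P[->//|ij]; apply: leq_trans (b_le j); exact: IHj.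
(* Inner induction: block k holds its first p steps only, and the last of them is integrated out. *)
have inner p h' : lipschitz_bounded_seq m C h' -> (b k + p <= b k.+1)%N ->
  \int[P]_w h' (shift_coord (fun j => block_sum k j w) k
                  (\sum_(b k <= i < b k + p) X i w)) =
  \int[P]_w iter p (conv_coord mu k) h' (fun j => block_sum k j w).
  elim: p h' => [|p IHp] h' h'C bp.
    by apply: eq_Rintegral => w _; rewrite addn0 big_geq// shift_coord0.
  rewrite iterSr -IHp; [|exact: conv_coord_lipschitz|by rewrite (leq_trans _ bp)// addnS].
  rewrite -(@past_conv m C h' (b k + p)%N k (fun j w =>
    shift_coord (fun j => block_sum k j w) k (\sum_(b k <= i < b k + p) X i w) j)) //.
  - apply: eq_Rintegral => w _; rewrite shift_coordD addnS big_nat_recr//=.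
    exact: leq_addr.
  - by rewrite (leq_trans _ bkn)// (leq_trans _ bp)// addnS.
  - have ms a c : (c <= b k + p)%N -> measurable_fun
        (setT : set (g_sigma_algebraType (cylinder X (b k + p)%N)))
        (fun w => \sum_(a <= i < c) X i w).
      move=> cb; apply: measurable_sum_seq => i; rewrite mem_index_iota => /andP[_ ic].
      by apply: measurable_past; exact: leq_trans cb.
    move=> j jm; rewrite /shift_coord; apply: measurable_funD.
      rewrite /block_sum; case jk : (j < k)%N; last exact: measurable_cst.
      apply: ms; apply: leq_trans (leq_addr _ _); exact: bmono.
    by case: eqP => _; [exact: ms|exact: measurable_cst].
rewrite /= -IH; [|exact: iter_conv_coord_lipschitz|exact: ltnW|exact: leq_trans bkn].
rewrite -inner//; last by rewrite subnKC.
apply: eq_Rintegral => w _; congr h; apply/funext => j.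
rewrite subnKC// /shift_coord /block_sum ltnS.
by have [jk|kj|->] := ltngtP j k; rewrite ?addr0 ?add0r.
Qed.

End block_sums.

(** * Maximal inequality and invariance principle *)

Section maximal_inequality.
Context d (T : measurableType d) (R : realType) (P : probability T R).
Variables (X : nat -> T -> R) (n : nat) (mu : probability (measurableTypeR R) R).
Hypothesis mX : forall i, measurable_fun setT (X i).
Hypothesis indX : product_rule P X n.
Hypothesis lawX : forall i, (i < n)%N ->
  forall A, measurable A -> P (X i @^-1` A) = mu A.
Variables v rho : R.
Hypothesis ct : centered mu v rho.

Local Notation past j := (g_sigma_algebraType (cylinder X j)).

Lemma centered_var_ge0 : 0 <= v.
Proof. by rewrite -(ct_var ct); apply: Rintegral_ge0 => x _; exact: sqr_ge0. Qed.

Lemma centered_psi_ge0 : 0 <= rho.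
Proof. by apply: le_trans (ct_psi ct); apply: Rintegral_ge0 => x _; exact: psi_ge0. Qed.

Variable p : nat.

Definition window (i : nat) (w : T) : R := \sum_(p <= j < p + i) X j w.

Lemma windowS i w : window i.+1 w = window i w + X (p + i)%N w.
Proof. by rewrite /window addnS big_nat_recr//= leq_addr. Qed.

Lemma measurable_window i j : (p + i <= j)%N ->
  measurable_fun (setT : set (past j)) (window i).
Proof.
move=> ij; apply: measurable_sum_seq => k; rewrite mem_index_iota => /andP[_ ki].
by apply: measurable_past; exact: leq_trans ij.
Qed.

Lemma measurable_past_fun d' (T' : measurableType d') j (f : T -> T') :
  measurable_fun (setT : set (past j)) f -> measurable_fun setT f.
Proof. by move=> mf _ B mB; apply: (past_measurable mX (j := j)); exact: mf. Qed.

(** Orthogonality of the increments: integrating out the last step kills the cross term. *)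
Lemma window_sqr i : (p + i <= n)%N ->
  (\int[P]_w (window i w ^+ 2)%:E = (i%:R * v)%:E)%E.
Proof.
elim: i => [|i IH] pin.
  rewrite mul0r; under eq_integral do rewrite /window addn0 big_geq// expr0n/=.
  by rewrite integral0.
have pin' : (p + i < n)%N by rewrite -addnS.
pose F (z : past (p + i)%N * measurableTypeR R) : \bar R := ((window i z.1 + z.2) ^+ 2)%:E.
have mF : measurable_fun setT F.
  apply/measurable_EFinP/measurable_funX/measurable_funD; last exact: measurable_snd.
  by apply: measurableT_comp measurable_fst; exact: measurable_window.
have F0 z : (0 <= F z)%E by rewrite lee_fin sqr_ge0.
have := past_integral mX indX pin' (lawX pin') mF F0.
rewrite /F/=; under eq_integral do rewrite -windowS.
move=> ->; rewrite (_ : (\int[P]_w _)%E = (\int[P]_w ((window i w ^+ 2)%:E + v%:E))%E).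
  rewrite (@ge0_integralD _ _ _ P setT measurableT (fun w => (window i w ^+ 2)%:E)
    (fun _ => v%:E)).
  - rewrite IH 1?ltnW// integral_prob_cst.
    by rewrite -EFinD -natr1 mulrDl mul1r.
  - by move=> w _; rewrite lee_fin sqr_ge0.
  - apply/measurable_EFinP/measurable_funX; apply: (@measurable_past_fun _ _ n).
    by apply: measurable_window; exact: ltnW.
  - by move=> w _; rewrite lee_fin centered_var_ge0.
  - exact: measurable_cst.
apply: eq_integral => w _.
set s := window i w.
have ii := centered_int ct; have i2 := ct_int ct.
have ic r : mu.-integrable setT (EFin \o (fun _ : R => r)).
  by apply: (@integrable_bounded _ _ _ _ _ `|r|).
have j1 := integrable_rZ (2 * s) ii.
have j2 := integrable_rD (ic (s ^+ 2)) j1.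
rewrite (_ : (\int[mu]_u _)%E = (\int[mu]_u (s ^+ 2 + 2 * s * u + u ^+ 2)%:E)%E); last first.
  by apply: eq_integral => u _; congr EFin; rewrite sqrrD; ring.
rewrite -[LHS]fineK; last first.
  by apply: (integrable_fin_num measurableT); exact: (integrable_rD j2 i2).
rewrite -[fine _]/(\int[mu]_u (s ^+ 2 + 2 * s * u + u ^+ 2)).
rewrite (RintegralD measurableT j2 i2) (RintegralD measurableT (ic _) j1).
by rewrite (RintegralZl _ measurableT ii) (ct_mean ct) (ct_var ct) Rintegral_prob_cst mulr0 addr0 EFinD.
Qed.

Variable c : R.
Hypothesis c0 : 0 < c.
Hypothesis c1 : c <= 1.

Definition inside (i : nat) : set T := [set w | forall j, (j <= i)%N -> `|window j w| < c].

Lemma measurable_inside i j : (p + i <= j)%N ->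
  measurable (inside i : set (past j)).
Proof.
move=> ij; rewrite (_ : inside i = \bigcap_(k in `I_i.+1)
    (fun w => `|window k w|) @^-1` [set x | x < c]); last first.
  by apply/seteqP; split.
apply: fin_bigcap_measurable => // k /= ki.
have mk : measurable_fun (setT : set (past j)) (fun w => `|window k w|).
  apply: measurableT_comp => //; apply: measurable_window.
  by apply: leq_trans ij; rewrite leq_add2l.
rewrite -[_ @^-1` _]setTI; apply: mk => //.
by rewrite -set_itvNyo.
Qed.

(* psi of the walk, frozen at the value 1/2 after the exit of ]-c, c[: its mean
   grows by at most the drift of psi, and it dominates half the exit probability. *)
Definition stopped (i : nat) (w : T) : R :=
  if `[< inside i w >] then psi (window i w / c) else 1 / 2.

Lemma psi_scale (u : R) : psi (u / c) <= psi u / c ^+ 4.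
Proof.
have c2 : 0 < c ^+ 2 by rewrite exprn_gt0.
have c21 : c ^+ 2 <= 1 by rewrite exprn_ile1// ltW.
have u2 : 0 <= u ^+ 2 by exact: sqr_ge0.
rewrite /psi !expr_div_n [leRHS]mulrAC ler_wpM2l//.
  by rewrite divr_ge0// exprn_even_ge0.
have h1 : 0 < 1 + u ^+ 2 by rewrite ltr_wpDr.
have h2 : 0 < 1 + u ^+ 2 / c ^+ 2 by rewrite ltr_wpDr// divr_ge0// ltW.
by rewrite lef_pV2 ?posrE// lerD2l ler_pdivlMr// ler_piMr.
Qed.

(** [psi_taylor] at s / c, integrated: the step has mean zero, so the linear term disappears. The
    remainder psi (u / c) is rescaled by [psi_scale], where [c <= 1] enters. *)
Lemma psi_drift (s : R) :
  (\int[mu]_u (psi ((s + u) / c))%:E <=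
   (psi (s / c) + 8 * (s ^+ 2 * v + rho) / c ^+ 4)%:E)%E.
Proof.
have ii := centered_int ct; have i2 := ct_int ct; have ip := centered_psi_int ct.
have ic r : mu.-integrable setT (EFin \o (fun _ : R => r)).
  by apply: (@integrable_bounded _ _ _ _ _ `|r|).
have c4 : 0 < c ^+ 4 by rewrite exprn_gt0.
pose a := dpsi (s / c) / c; pose b := 8 * s ^+ 2 / c ^+ 4.
have j1 := integrable_rD (ic (psi (s / c))) (integrable_rZ a ii).
have j2 := integrable_rD j1 (integrable_rZ b i2).
have j3 := integrable_rD j2 (integrable_rZ (8 / c ^+ 4) ip).
have key u : psi ((s + u) / c) <= psi (s / c) + a * u + b * u ^+ 2 + 8 / c ^+ 4 * psi u.
  rewrite mulrDl; apply: le_trans (psi_taylor _ _) _.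
  have e1 : dpsi (s / c) * (u / c) = a * u by rewrite /a mulrAC mulrA.
  have e2 : 8 * ((s / c) ^+ 2 * (u / c) ^+ 2) = b * u ^+ 2.
    by rewrite /b; field; rewrite gt_eqF.
  have e3 := psi_scale u.
  rewrite -[8 / _ * _]mulrA [_^-1 * _]mulrC e1 mulrDr e2; lra.
apply: (@le_trans _ _ (\int[mu]_u (psi (s / c) + a * u + b * u ^+ 2 + 8 / c ^+ 4 * psi u)%:E)%E).
  apply: ge0_le_integral => //.
  - by move=> u _; rewrite lee_fin psi_ge0.
  - apply/measurable_EFinP; apply: measurableT_comp; first exact: measurable_psi.
    by apply: measurable_funM => //; exact: measurable_funD.
  - by have /integrableP[] := j3.
  - by move=> u _; rewrite lee_fin key.
rewrite -[leLHS]fineK; last by apply: (integrable_fin_num measurableT); exact: j3.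
rewrite lee_fin -[fine _]/(\int[mu]_u (psi (s / c) + a * u + b * u ^+ 2 + 8 / c ^+ 4 * psi u)).
rewrite (RintegralD measurableT j2 (integrable_rZ _ ip)).
rewrite (RintegralD measurableT j1 (integrable_rZ _ i2)).
rewrite (RintegralD measurableT (ic _) (integrable_rZ _ ii)).
rewrite (RintegralZl _ measurableT ii) (RintegralZl _ measurableT i2) (RintegralZl _ measurableT ip).
rewrite (ct_mean ct) (ct_var ct) Rintegral_prob_cst mulr0 addr0 -addrA lerD2l.
rewrite mulrDr mulrDl; apply: lerD; first by rewrite /b; lra.
rewrite mulrAC ler_wpM2r ?ler_wpM2l ?invr_ge0 ?(ltW c4)//; exact: ct_psi ct.
Qed.

Lemma insideS i w : inside i.+1 w <-> inside i w /\ `|window i.+1 w| < c.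
Proof.
split=> [h|[h hi] j]; first by split => [j ji|]; apply: h; rewrite // (leq_trans ji).
by rewrite leq_eqVlt => /predU1P[-> //|]; exact: h.
Qed.

Lemma stopped_ge0 i w : 0 <= stopped i w.
Proof. by rewrite /stopped; case: ifP => _; [exact: psi_ge0|lra]. Qed.

Lemma measurable_if_inside d' (T' : measurableType d') j i (q : T' -> past j)
    (f g : T' -> R) : (p + i <= j)%N -> measurable_fun setT q ->
  measurable_fun setT f -> measurable_fun setT g ->
  measurable_fun setT (fun z => if `[< inside i (q z) >] then f z else g z).
Proof.
move=> ij mq mf mg; apply: measurable_fun_ifT => //.
apply: (measurable_fun_bool true).
rewrite (_ : _ @^-1` _ = q @^-1` (inside i)).
  by have := mq measurableT _ (measurable_inside ij); rewrite setTI.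
by apply/seteqP; split => z /=; [move/asboolP|move=> h; apply/asboolP].
Qed.

Lemma measurable_stopped i j : (p + i <= j)%N ->
  measurable_fun (setT : set (past j)) (stopped i).
Proof.
move=> ij; apply: (@measurable_if_inside _ (past j) j i idfun
  (fun w => psi (window i w / c)) (fun=> 1 / 2)) => //; first exact: measurable_id.
apply: measurableT_comp; first exact: measurable_psi.
by apply: measurable_funM => //; exact: measurable_window.
Qed.

Lemma stopped_drift i : (p + i < n)%N ->
  (\int[P]_w (stopped i.+1 w)%:E <=
   \int[P]_w (stopped i w)%:E + (8 * (i%:R * v ^+ 2 + rho) / c ^+ 4)%:E)%E.
Proof.
move=> pin; set J := (p + i)%N.
pose F (z : past J * measurableTypeR R) : R :=
  if `[< inside i z.1 >] then psi ((window i z.1 + z.2) / c) else 1 / 2.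
have mF : measurable_fun setT F.
  apply: (@measurable_if_inside _ (past J * measurableTypeR R)%type J i fst
    (fun z => psi ((window i z.1 + z.2) / c)) (fun=> 1 / 2)) => //.
  apply: measurableT_comp; first exact: measurable_psi.
  apply: measurable_funM => //; apply: measurable_funD; last exact: measurable_snd.
  by apply: measurableT_comp measurable_fst; exact: measurable_window.
have F0 z : 0 <= F z by rewrite /F; case: ifP => _; [exact: psi_ge0|lra].
have mS k : (p + k <= n)%N -> measurable_fun setT (EFin \o stopped k : T -> \bar R).
  by move=> kn; apply/measurable_EFinP; apply: (@measurable_past_fun _ _ n); exact: measurable_stopped.
have mw : measurable_fun setT (window i).
  by apply: (@measurable_past_fun _ _ n); apply: measurable_window; exact: ltnW.
have v0 := centered_var_ge0; have rho0 := centered_psi_ge0.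
have c4 : 0 < c ^+ 4 by rewrite exprn_gt0.
have mFX : measurable_fun setT (fun w => (F (w, X J w))%:E).
  apply/measurable_EFinP.
  have mpair : measurable_fun (setT : set T)
      (fun w => ((w : past J), (X J w : measurableTypeR R))).
    by apply: measurable_fun_pair; [exact: measurable_id_past|exact: mX].
  exact: (measurableT_comp mF mpair).
(* Freezing at the exit only decreases the value: there |window| >= c, so psi is at least 1/2. *)
apply: (@le_trans _ _ (\int[P]_w (F (w, X J w))%:E)%E).
  apply: ge0_le_integral => //.
  - by move=> w _; rewrite lee_fin stopped_ge0.
  - by apply: mS; rewrite addnS.
  - move=> w _; rewrite lee_fin /stopped /F /= -windowS.
    case: asboolP => [/insideS[h _]|h]; first by rewrite asboolT.
    case: asboolP => [h'|_]; last by [].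
    apply: psi_ge_half; rewrite normrM normfV (gtr0_norm c0) ler_pdivlMr// mul1r.
    by rewrite leNgt; apply/negP => hc; apply: h; apply/insideS.
have mFE : measurable_fun setT (EFin \o F) by exact/measurable_EFinP.
rewrite (past_integral mX indX pin (lawX pin) mFE) => [|z]; last by rewrite lee_fin.
pose Q w := 8 * (window i w ^+ 2 * v + rho) / c ^+ 4.
have Q0 w : 0 <= Q w.
  by rewrite /Q divr_ge0 ?(ltW c4)// mulr_ge0// addr_ge0// mulr_ge0// sqr_ge0.
have mQ : measurable_fun setT Q.
  apply: measurable_funM => //; apply: measurable_funM => //.
  by apply: measurable_funD => //; apply: measurable_funM => //; exact: measurable_funX.
have mQE : measurable_fun setT (EFin \o Q) by exact/measurable_EFinP.
(* The nonnegative drift is also added after the exit, where [stopped] is constant, so that its mean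
   is that of the unstopped walk and follows from [window_sqr]. *)
apply: (@le_trans _ _ (\int[P]_w ((stopped i w)%:E + (Q w)%:E))%E).
  apply: ge0_le_integral => //.
  - by move=> w _; apply: integral_ge0 => u _; rewrite lee_fin.
  - have := measurable_fun_fubini_tonelli_F (m2 := mu) (EFin \o F) mFE (fun z => _ : (0 <= (EFin \o F) z)%E).
    move=> /(_ (fun z => F0 z)) mG.
    exact: (measurable_past_fun mG).
  - by apply: emeasurable_funD => //; apply: mS; exact: ltnW.
  - move=> w _; rewrite /F /= /stopped; case: asboolP => _.
      exact: psi_drift.
    by rewrite integral_prob_cst -EFinD lee_fin lerDl.
rewrite (@ge0_integralD _ _ _ P setT measurableT (EFin \o stopped i) (EFin \o Q)).
- rewrite leeD2l//.
  rewrite (_ : (\int[P]_w (EFin \o Q) w)%E =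
    (\int[P]_w ((8 * v / c ^+ 4)%:E * (window i w ^+ 2)%:E + (8 * rho / c ^+ 4)%:E))%E).
    rewrite ge0_integralD//.
    - rewrite ge0_integralZl//.
      + rewrite window_sqr ?(ltnW pin)// integral_prob_cst -EFinM -EFinD lee_fin.
        by rewrite le_eqVlt; apply/orP; left; apply/eqP; ring.
      + by apply/measurable_EFinP; exact: measurable_funX.
      + by move=> w _; rewrite lee_fin sqr_ge0.
      + by rewrite lee_fin divr_ge0 ?(ltW c4)// mulr_ge0.
    - by move=> w _; rewrite -EFinM lee_fin mulr_ge0 ?sqr_ge0// divr_ge0 ?(ltW c4)// mulr_ge0.
    - apply/measurable_EFinP; apply: measurable_funM => //; exact: measurable_funX.
    - by move=> w _; rewrite lee_fin divr_ge0 ?(ltW c4)// mulr_ge0.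
  by apply: eq_integral => w _; rewrite /= -EFinM -EFinD; congr EFin; rewrite /Q; ring.
- by move=> w _; rewrite lee_fin stopped_ge0.
- by apply: mS; exact: ltnW.
- by move=> w _; rewrite lee_fin.
- by [].
Qed.

(** The drifts add up, and the sum of j v^2 over j < i is at most i^2 v^2. This square makes the
    bound useful for short blocks. *)
Lemma stopped_integral i : (p + i <= n)%N ->
  (\int[P]_w (stopped i w)%:E <= (8 * (i%:R ^+ 2 * v ^+ 2 + i%:R * rho) / c ^+ 4)%:E)%E.
Proof.
have c4 : 0 < c ^+ 4 by rewrite exprn_gt0.
have v0 := centered_var_ge0; have rho0 := centered_psi_ge0.
elim: i => [|i IH] pin.
  rewrite expr0n/= !mul0r addr0 mulr0 mul0r integral0_eq// => w _.
  rewrite /stopped /window addn0 big_geq// asboolT; first by rewrite mul0r /psi expr0n/= mul0r.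
  by move=> j; rewrite leqn0 => /eqP ->; rewrite /window addn0 big_geq// normr0.
have pin' : (p + i < n)%N by rewrite -addnS.
apply: le_trans (stopped_drift pin') _.
apply: le_trans (leeD2r _ (IH (ltnW pin'))) _.
rewrite -EFinD lee_fin -mulrDl ler_wpM2r ?invr_ge0 ?(ltW c4)// -mulrDr ler_wpM2l//.
rewrite -natr1 sqrrD1 !mulrDl mul1r.
have : 0 <= i%:R * v ^+ 2 :> R by rewrite mulr_ge0// sqr_ge0.
have := sqr_ge0 v; rewrite mulr_natl; nra.
Qed.

(** On the exit event [stopped] is frozen at 1/2, hence the constant 16 = 2 * 8. *)
Lemma maximal_inequality k : (p + k <= n)%N ->
  measurable [set w | exists2 i, (i <= k)%N & c <= `|window i w|] /\
  (P [set w | exists2 i, (i <= k)%N & (c <= `|window i w|)%R] <=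
   (16 / c ^+ 4 * (k%:R ^+ 2 * v ^+ 2 + k%:R * rho))%:E)%E.
Proof.
move=> pkn; set B := [set w | _].
have BE : B = ~` inside k.
  apply/seteqP; split => w /=.
    by move=> [i ik cw] /(_ i ik); rewrite ltNge cw.
  move=> h; apply: contrapT => hn; apply: h => i ik; rewrite ltNge; apply/negP => cw.
  by apply: hn; exists i.
have mB : measurable B.
  rewrite BE; apply: measurableC; apply: (past_measurable mX (j := n)).
  exact: measurable_inside.
split => //.
have h : ((1 / 2)%:E * P B <= \int[P]_w (stopped k w)%:E)%E.
  rewrite -integral_cst// integral_mkcond.
  apply: ge0_le_integral => //.
  - by move=> w _; rewrite patchE; case: ifP => // _; rewrite lee_fin; lra.
  - apply/(measurable_restrictT _ _).1 => //; exact: measurable_cst.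
  - apply/measurable_EFinP; apply: (@measurable_past_fun _ _ n).
    exact: measurable_stopped.
  - move=> w _; rewrite patchE; case: ifPn => [|_]; last by rewrite lee_fin stopped_ge0.
    rewrite inE BE /stopped => hw.
    by case: asboolP.
have := le_trans h (stopped_integral pkn).
rewrite -(@fineK _ (P B)) ?fin_num_measure// -EFinM !lee_fin; lra.
Qed.

End maximal_inequality.

(** * Discretization by blocks *)

Section block_discretization.
Context d (T : measurableType d) (R : realType) (P : probability T R).
Variables (X : nat -> T -> R) (n : nat) (mu : probability (measurableTypeR R) R).
Hypothesis mX : forall i, measurable_fun setT (X i).
Hypothesis indX : product_rule P X n.
Hypothesis lawX : forall i, (i < n)%N ->
  forall A, measurable A -> P (X i @^-1` A) = mu A.
Variables v rho : R.
Hypothesis ct : centered mu v rho.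

Definition partial_sum (i : nat) (w : T) : R := \sum_(0 <= j < i) X j w.

Definition sup_lipschitz (C : R) (F : (nat -> R) -> R) : Prop :=
  (forall x, `|F x| <= C) /\ (forall x y e, 0 <= e ->
    (forall i, (i <= n)%N -> `|x i - y i| <= e) -> `|F x - F y| <= C * e).

Variables (m : nat) (C : R) (F : (nat -> R) -> R).
Hypothesis m0 : (0 < m)%N.
Hypothesis mn : (m <= n)%N.
Hypothesis FC : sup_lipschitz C F.

(** The successor makes the total length of m blocks exceed n, so that every index up to n falls in
    one of them; the last blocks may be shorter or empty. *)
Definition block_size : nat := (n %/ m).+1.

Definition block_bound (j : nat) : nat := minn (j * block_size) n.

(** Here x holds block sums: the path is frozen on each block at its value at the left end of the
    block. *)
Definition blocked (x : nat -> R) : R :=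
  F (fun i => \sum_(j < m | (j < i %/ block_size)%N) x j).

Lemma block_bound_le j : (block_bound j <= block_bound j.+1)%N.
Proof. by rewrite /block_bound leq_min geq_minr andbT geq_min leq_mul2r leqnSn orbT. Qed.

Lemma block_index_lt i : (i <= n)%N -> (i %/ block_size < m)%N.
Proof.
move=> ip; rewrite ltn_divLR//; apply: leq_ltn_trans ip _.
by rewrite mulnC; exact: ltn_ceil.
Qed.

Lemma block_size_le : block_size%:R <= 2 * n%:R / m%:R :> R.
Proof.
rewrite ler_pdivlMr ?ltr0n// -!natrM ler_nat /block_size mulSn.
by rewrite mul2n -addnn leq_add// leq_trunc_div.
Qed.

Lemma sup_lipschitz_ge0 : 0 <= C.
Proof. by have [h _] := FC; exact: le_trans (normr_ge0 _) (h (fun=> 0)). Qed.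

Lemma blocked_lipschitz : lipschitz_bounded_seq m C blocked.
Proof.
have [FM FK] := FC; split => [x|x y]; first exact: FM.
apply: FK => [|i ip]; first by apply: sumr_ge0.
rewrite -sumrB; apply: le_trans (ler_norm_sum _ _ _) _.
by rewrite [leRHS](bigID (fun j : 'I_m => (j < i %/ block_size)%N))/= lerDl sumr_ge0.
Qed.

Lemma measurable_partial_sum i : measurable_fun setT (partial_sum i).
Proof. by apply: measurable_sum_seq => j _; exact: mX. Qed.

Lemma measurable_sup_lipschitz d' (T' : measurableType d') (W : nat -> T' -> R) :
  (forall i, (i <= n)%N -> measurable_fun setT (W i)) ->
  measurable_fun setT (fun w => F (fun i => W i w)).
Proof.
move=> mW; have [FM FK] := FC; have C0 := sup_lipschitz_ge0.
apply: (measurable_fun_box_continuous (m := n.+1) mW) => x e e0.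
have C1 : 0 < C + 1 by rewrite ltr_wpDl.
exists (e / (C + 1)) => [|y xy]; first exact: divr_gt0.
apply: le_lt_trans (FK _ _ (e / (C + 1)) _ _) _ => [|i ip|].
- by rewrite ltW// divr_gt0.
- exact/ltW/xy.
- rewrite mulrA ltr_pdivrMr//; nra.
Qed.

Lemma blocked_sumE w i : (i <= n)%N ->
  \sum_(j < m | (j < i %/ block_size)%N) block_sum X block_bound m j w =
  partial_sum (block_bound (i %/ block_size)) w.
Proof.
move=> ip; have im := block_index_lt ip; set q := (i %/ _)%N in im *.
rewrite -(big_mkord (fun j => (j < q)%N) (fun j => block_sum X block_bound m j w)).
rewrite -[X in \sum_(0 <= _ < X | _) _](subnKC (ltnW im)) /index_iota subn0 iotaD big_cat/=.
rewrite [X in _ + X]big_seq_cond [X in _ + X]big1 ?addr0; last first.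
  by move=> j /andP[]; rewrite mem_iota add0n => /andP[qj _]; rewrite ltnNge qj.
rewrite big_seq_cond.
rewrite (eq_bigl (fun j => j \in iota 0 q)); last first.
  by move=> j; rewrite mem_iota add0n/=; case: (j < q)%N.
rewrite -big_seq.
have -> : \sum_(j <- iota 0 q) block_sum X block_bound m j w =
    \sum_(0 <= j < q) block_sum X block_bound m j w by rewrite /index_iota subn0.
elim: q im => [|q IH] qm.
  by rewrite big_geq// /partial_sum /block_bound mul0n min0n big_geq.
rewrite big_nat_recr//= IH ?(ltnW qm)// /partial_sum /block_sum (ltn_trans _ qm)//.
by rewrite -big_cat_nat//=; exact: block_bound_le.
Qed.

Lemma partial_sum_window w q i :
  partial_sum (q + i) w - partial_sum q w = window X q i w.
Proof. by rewrite /partial_sum /window (big_cat_nat (n := q))//= ?leq_addr// addrAC subrr add0r. Qed.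

(** If no block moves by eps or more from its left end, the two paths stay within eps of each other;
    otherwise the error is at most 2 C. Boole's inequality sums the m exit probabilities, and block
    lengths of at most 2 n / m produce the factors 4 / m and 2. *)
Lemma blocked_near (eps : R) : 0 < eps -> eps <= 1 ->
  `|\int[P]_w F (fun i => partial_sum i w) -
    \int[P]_w blocked (fun j => block_sum X block_bound m j w)| <=
  C * eps + 2 * C * (16 / eps ^+ 4 * (4 * (n%:R * v) ^+ 2 / m%:R + 2 * (n%:R * rho))).
Proof.
move=> eps0 eps1; have [FM FK] := FC; have C0 := sup_lipschitz_ge0.
have v0 := centered_var_ge0 ct; have rho0 := centered_psi_ge0 ct.
pose l j := (block_bound j.+1 - block_bound j)%N.
pose B j := [set w | exists2 i, (i <= l j)%N & eps <= `|window X (block_bound j) i w|].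
have lE j : (block_bound j + l j <= n)%N.
  by rewrite /l subnKC ?block_bound_le// geq_minr.
have hB j := maximal_inequality mX indX lawX ct eps0 eps1 (lE j).
have mB j : measurable (B j) by have [] := hB j.
have lk j : (l j <= block_size)%N.
  rewrite /l leq_subLR /block_bound mulSn.
  by rewrite geq_min; have [h|h] := leqP (j * block_size) n;
    [rewrite addnC leqnn|rewrite leq_addr orbT].
pose G w := F (fun i => partial_sum i w).
pose H w := blocked (fun j => block_sum X block_bound m j w).
have mG : measurable_fun setT G.
  by apply: measurable_sup_lipschitz => i _; exact: measurable_partial_sum.
have mH : measurable_fun setT H.
  apply: (measurable_lipschitz_seq (m := m) _ blocked_lipschitz) => j jm.
  rewrite /block_sum jm; apply: measurable_sum_seq => i _; exact: mX.
have iG : P.-integrable setT (EFin \o G) by apply: (integrable_bounded P mG) => w; exact: FM.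
have iH : P.-integrable setT (EFin \o H) by apply: (integrable_bounded P mH) => w; exact: FM.
pose U := \big[setU/set0]_(j < m) B j.
have mU : measurable U by apply: bigsetU_measurable => j _; exact: mB.
have PU : (P U <= (16 / eps ^+ 4 * (4 * (n%:R * v) ^+ 2 / m%:R + 2 * (n%:R * rho)))%:E)%E.
  apply: le_trans (Boole_inequality P (fun j _ => mB j)) _.
  apply: (@le_trans _ _ (\sum_(j < m) (16 / eps ^+ 4 *
      (block_size%:R ^+ 2 * v ^+ 2 + block_size%:R * rho))%:E)%E).
    apply: lee_sum => j _; apply: le_trans (hB j).2 _; rewrite lee_fin.
    have e4 : 0 <= 16 / eps ^+ 4 by rewrite divr_ge0// exprn_ge0// ltW.
    rewrite ler_wpM2l//; apply: lerD.
      by rewrite ler_wpM2r ?sqr_ge0// lerXn2r ?nnegrE// ler_nat.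
    by rewrite ler_wpM2r// ler_nat.
  rewrite sumEFin lee_fin sumr_const card_ord -[leLHS]mulr_natl mulrCA.
  have e4 : 0 <= 16 / eps ^+ 4 by rewrite divr_ge0// exprn_ge0// ltW.
  rewrite ler_wpM2l// mulrDr.
  have m0' : 0 < m%:R :> R by rewrite ltr0n.
  have bs := block_size_le; rewrite ler_pdivlMr// in bs.
  apply: lerD.
    rewrite ler_pdivlMr// (_ : _ * m%:R = (block_size%:R * m%:R) ^+ 2 * v ^+ 2); last by ring.
    rewrite (_ : 4 * _ = (2 * n%:R) ^+ 2 * v ^+ 2); last by ring.
    by rewrite ler_wpM2r ?sqr_ge0// lerXn2r ?nnegrE// mulr_ge0.
  rewrite (_ : m%:R * _ = block_size%:R * m%:R * rho); last by ring.
  by rewrite [leRHS]mulrA ler_wpM2r.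
have key w : `|G w - H w| <= C * eps + 2 * C * \1_U w.
  have [wU|wU] := pselect (U w).
    rewrite indicE mem_set// mulr1; apply: le_trans (ler_normB _ _) _.
    have := FM (fun i => partial_sum i w).
    have := FM (fun i => \sum_(j < m | (j < i %/ block_size)%N) block_sum X block_bound m j w).
    have : 0 <= C * eps by rewrite mulr_ge0// ltW.
    rewrite -/(G w) -[F _]/(H w); lra.
  rewrite indicE memNset// mulr0 addr0; apply: FK => [|i ip]; first exact: ltW.
  rewrite blocked_sumE//; set q := (i %/ block_size)%N.
  have qi : (block_bound q <= i)%N.
    by rewrite /block_bound geq_min /q leq_trunc_div.
  rewrite -[X in partial_sum X](subnKC qi) partial_sum_window.
  rewrite leNgt; apply/negP => ci; apply: wU; rewrite /U -bigcup_mkord.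
  exists q; first exact: block_index_lt.
  exists (i - block_bound q)%N; last exact: ltW.
  rewrite /l leq_sub2r// /block_bound leq_min ip andbT.
  by rewrite ltnW// ltn_ceil.
rewrite -(RintegralB measurableT iG iH).
have iGH := integrable_rB iG iH.
have iU : P.-integrable setT (EFin \o (\1_U : T -> R)).
  by apply: (@integrable_bounded _ _ _ _ _ 1) => // w; rewrite indicE; case: (_ \in _); rewrite ?normr1 ?normr0.
have ic r : P.-integrable setT (EFin \o (fun _ : T => r)).
  by apply: (@integrable_bounded _ _ _ _ _ `|r|) => //; exact: measurable_cst.
apply: le_trans (le_normr_Rintegral measurableT iGH) _.
apply: (@le_trans _ _ (\int[P]_w (C * eps + 2 * C * \1_U w))).
  apply: le_Rintegral => //.
  - exact: (integrable_norm iGH).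
  - exact: (integrable_rD (ic _) (integrable_rZ _ iU)).
rewrite (RintegralD measurableT (ic _) (integrable_rZ _ iU)) Rintegral_prob_cst.
rewrite (RintegralZl _ measurableT iU) lerD2l ler_wpM2l ?mulr_ge0//.
rewrite /Rintegral integral_indic// setIT.
by rewrite -lee_fin fineK// fin_num_measure.
Qed.

End block_discretization.

(** * Comparison of two walks *)

Section invariance.
Context {R : realType}.

Definition iid_row d (T : measurableType d) (P : probability T R)
    (X : nat -> T -> R) (n : nat) (mu : probability (measurableTypeR R) R) : Prop :=
  [/\ forall i, measurable_fun setT (X i), product_rule P X n &
      forall i, (i < n)%N -> forall A, measurable A -> P (X i @^-1` A) = mu A].

(** Both walks are discretized, hence the factor 2, and their block sums are then compared. The
    block lengths add up to n, hence n times the step error. *)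
Lemma invariance_bound (C eps eps' : R) : 0 < eps -> eps <= 1 -> 0 < eps' ->
  exists2 L : R, 0 <= L &
  forall d (T : measurableType d) (P : probability T R) (X : nat -> T -> R)
    d' (T' : measurableType d') (P' : probability T' R) (X' : nat -> T' -> R)
    (mu nu : probability (measurableTypeR R) R) (n m : nat) (v rho e : R) F,
  (0 < m <= n)%N -> iid_row P X n mu -> iid_row P' X' n nu ->
  centered mu v rho -> centered nu v rho -> sup_lipschitz n C F ->
  0 < e -> e <= 1 ->
  `|\int[P]_w F (fun i => partial_sum X i w) -
    \int[P']_w F (fun i => partial_sum X' i w)| <=
  2 * (C * eps + 2 * C * (16 / eps ^+ 4 * (4 * (n%:R * v) ^+ 2 / m%:R + 2 * (n%:R * rho))))
  + m%:R * eps' + n%:R * step_error L e v rho.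
Proof.
move=> eps0 eps1 eps'0; have [L L0 HL] := @block_conv_lindeberg R C eps' eps'0.
exists L => // d T P X d' T' P' X' mu nu n m v rho e F /andP[m0 mn].
move=> [mX indX lawX] [mX' indX' lawX'] cmu cnu FC e0 e1.
have h1 := blocked_near mX indX lawX cmu m0 mn FC eps0 eps1.
have h2 := blocked_near mX' indX' lawX' cnu m0 mn FC eps0 eps1.
have hC := blocked_lipschitz m FC.
have bn : (block_bound n m m <= n)%N by exact: geq_minr.
have h3 := HL mu nu v rho e m (blocked n m F)
  (fun j => block_bound n m j.+1 - block_bound n m j)%N m (leqnn m) hC cmu cnu e0 e1 (fun=> 0).
rewrite -(block_sum_conv mX indX lawX (@block_bound_le n m) hC (leqnn m) bn) in h3.
rewrite -(block_sum_conv mX' indX' lawX' (@block_bound_le n m) hC (leqnn m) bn) in h3.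
have sumE : (\sum_(j < m) (block_bound n m j.+1 - block_bound n m j))%N = n.
  rewrite -(big_mkord xpredT (fun j => block_bound n m j.+1 - block_bound n m j)%N).
  rewrite telescope_sumn; last first.
    by move=> i j ij; rewrite /block_bound leq_min geq_minr andbT geq_min leq_mul2r ij orbT.
  rewrite /block_bound mul0n min0n subn0; apply/minn_idPr.
  by rewrite ltnW// mulnC ltn_ceil.
rewrite sumE in h3.
move: h1 h2 h3; rewrite !ler_distl => /andP[? ?] /andP[? ?] /andP[? ?].
apply/andP; split; lra.
Qed.

(** The choices are made in the order [eps], m, [eps'] with [L], [e], [r]. The terms governed by
    [eps], m, [eps'] and [e] cost at most eta / 8 each, and those in n rho at most eta / 4. *)
Lemma invariance (C V eta : R) : 0 <= V -> 0 < eta -> exists N : nat, exists2 r : R, 0 < r &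
  forall d (T : measurableType d) (P : probability T R) (X : nat -> T -> R)
    d' (T' : measurableType d') (P' : probability T' R) (X' : nat -> T' -> R)
    (mu nu : probability (measurableTypeR R) R) (n : nat) (v rho : R) F,
  (N <= n)%N -> iid_row P X n mu -> iid_row P' X' n nu ->
  centered mu v rho -> centered nu v rho -> n%:R * v = V -> n%:R * rho <= r ->
  sup_lipschitz n C F ->
  `|\int[P]_w F (fun i => partial_sum X i w) -
    \int[P']_w F (fun i => partial_sum X' i w)| <= eta.
Proof.
move=> V0 eta0.
pose C1 := `|C| + 1; have C10 : 0 < C1 by rewrite ltr_wpDl.
have CC1 : C <= C1 by apply: le_trans (ler_norm C) _; rewrite lerDl.
pose eps := Num.min 1 (eta / (16 * C1)).
have eps0 : 0 < eps by rewrite lt_min ltr01 divr_gt0// mulr_gt0.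
have eps1 : eps <= 1 by rewrite ge_min lexx.
have epsC : 16 * (C1 * eps) <= eta.
  rewrite mulrA mulrC -ler_pdivlMr ?mulr_gt0//.
  by rewrite ge_min lexx orbT.
pose K := 2 * C1 * (16 / eps ^+ 4).
have K0 : 0 < K by rewrite !mulr_gt0// invr_gt0 exprn_gt0.
pose M := K * (4 * V ^+ 2) / (eta / 16).
pose m := (Num.truncn M).+1.
have m0 : (0 < m)%N by [].
have mR : 0 < m%:R :> R by rewrite ltr0n.
have mM : K * (4 * V ^+ 2) / m%:R <= eta / 16.
  rewrite ler_pdivrMr// -ler_pdivrMl ?divr_gt0// mulrC -/M ltW//.
  exact: truncnS_gt.
pose eps' := eta / (8 * m%:R).
have eps'0 : 0 < eps' by rewrite divr_gt0// mulr_gt0.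
have [L L0 HL] := @invariance_bound C eps eps' eps0 eps1 eps'0.
have D0 : 0 < 16 * L * V + 1 by rewrite ltr_wpDl// !mulr_ge0.
pose e := Num.min 1 (eta / (16 * L * V + 1)).
have e0 : 0 < e by rewrite lt_min ltr01 divr_gt0.
have e1 : e <= 1 by rewrite ge_min lexx.
have eL : 2 * L * (e * V) <= eta / 8.
  have h : e * (16 * L * V + 1) <= eta by rewrite -ler_pdivlMr// ge_min lexx orbT.
  have : 0 <= L * V by rewrite mulr_ge0.
  nra.
pose Q := 4 * K + 2 * L * (2 / e ^+ 2).
have Q0 : 0 < Q.
  apply: ltr_pwDl; first exact: mulr_gt0.
  by apply: mulr_ge0; [exact: mulr_ge0|rewrite divr_ge0// exprn_ge0// ltW].
(* It is enough that n be at least m: the rest of the asymptotics is carried by n rho <= r. *)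
exists m; exists (eta / (4 * Q)) => [|]; first by rewrite divr_gt0// mulr_gt0.
move=> d T P X d' T' P' X' mu nu n v rho F mn rX rX' cmu cnu nv nrho FC.
have C0 : 0 <= C := sup_lipschitz_ge0 FC.
have rho0 : 0 <= n%:R * rho by rewrite mulr_ge0// (centered_psi_ge0 cmu).
have := HL _ _ P X _ _ P' X' mu nu n m v rho e F _ rX rX' cmu cnu FC e0 e1.
rewrite m0 mn => /(_ isT) h; apply: le_trans h _.
rewrite nv.
have -> : n%:R * step_error L e v rho =
    2 * L * (e * V) + 2 * L * (2 / e ^+ 2) * (n%:R * rho).
  by rewrite /step_error -nv; ring.
have -> : m%:R * eps' = eta / 8.
  by rewrite /eps'; field; rewrite gt_eqF.
have h1 : C * eps <= C1 * eps by rewrite ler_wpM2r// ltW.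
have h2 : 2 * C * (16 / eps ^+ 4 * (4 * V ^+ 2 / m%:R + 2 * (n%:R * rho))) <=
    K * (4 * V ^+ 2) / m%:R + 2 * K * (n%:R * rho).
  have -> : K * (4 * V ^+ 2) / m%:R + 2 * K * (n%:R * rho) =
    2 * C1 * (16 / eps ^+ 4 * (4 * V ^+ 2 / m%:R + 2 * (n%:R * rho))).
    by rewrite /K; ring.
  rewrite ler_wpM2r//; last by rewrite ler_wpM2l.
  apply: mulr_ge0; first by rewrite divr_ge0// exprn_ge0// ltW.
  apply: addr_ge0; last exact: mulr_ge0.
  by rewrite divr_ge0// mulr_ge0// sqr_ge0.
have h3 : Q * (n%:R * rho) <= eta / 4.
  have -> : eta / 4 = Q * (eta / (4 * Q)) by field; rewrite gt_eqF.
  by rewrite ler_pM2l.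
rewrite /Q mulrDl in h3; lra.
Qed.

End invariance.

(** * Moments of the normal law *)

Section normal_moments.
Context {R : realType}.
Variable s : R.
Hypothesis s0 : 0 < s.

Local Notation mu := (@lebesgue_measure R).
Local Notation N := (normal_prob 0 s).
Local Notation pdf := (normal_pdf 0 s).

(** The density equals the Radon-Nikodym derivative almost everywhere, both having the same integral
    over every measurable set. *)
Lemma ge0_integral_normal (f : R -> \bar R) : measurable_fun setT f ->
  (forall x, 0 <= f x)%E ->
  (\int[N]_x f x = \int[mu]_x (f x * (pdf x)%:E))%E.
Proof.
move=> mf f0; have dom := normal_prob_dominates (0 : R) s.
rewrite -(Radon_Nikodym_SigmaFinite.change_of_variables dom)//.
have fi := Radon_Nikodym_SigmaFinite.f_integrable dom.
have mp : measurable_fun setT (EFin \o pdf).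
  by apply/measurable_EFinP; exact: measurable_normal_pdf.
apply: ae_eq_integral => //.
- by apply: emeasurable_funM => //; exact: measurable_int fi.
- exact: emeasurable_funM.
- apply: ae_eqe_mul2l; apply: integral_ae_eq => // E _ mE.
  by rewrite -(Radon_Nikodym_SigmaFinite.f_integral dom).
Qed.

Lemma normal_pdf_val x : pdf x = normal_peak s * expR (- (x ^+ 2 / (2 * s ^+ 2))).
Proof.
rewrite normal_pdfE ?gt_eqF// /normal_fun subr0 mulNr.
by rewrite -[s ^+ 2 *+ 2]mulr_natl.
Qed.

Lemma is_derive_normal_pdf (x : R) : is_derive x 1 pdf (- (x / s ^+ 2) * pdf x).
Proof.
have -> : pdf = fun y => normal_peak s * expR (- (y ^+ 2 / (2 * s ^+ 2))).
  by apply/funext => y; exact: normal_pdf_val.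
have h1 : is_derive x 1 (fun y : R => - (y ^+ 2 / (2 * s ^+ 2))) (- (x / s ^+ 2)).
  rewrite (_ : (fun y => _) = fun y : R => (- (2 * s ^+ 2)^-1) *: y ^+ 2); last first.
    by apply/funext => y; rewrite /GRing.scale/= mulNr mulrC.
  apply: is_derive_eq; rewrite /GRing.scale/=; field; rewrite gt_eqF//.
have h2 : is_derive x 1 (fun y : R => expR (- (y ^+ 2 / (2 * s ^+ 2))))
    (expR (- (x ^+ 2 / (2 * s ^+ 2))) * (- (x / s ^+ 2))).
  exact: (@is_derive1_comp R expR _ x _ _ (is_derive_expR _) h1).
apply: is_derive_eq; rewrite /GRing.scale/=; ring.
Qed.

(** From exp y >= 1 + y; it makes the boundary terms of the integration by parts vanish. *)
Lemma normal_pdf_decay (x : R) : 0 < x -> x * pdf x <= normal_peak s * (2 * s ^+ 2) / x.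
Proof.
move=> x0; rewrite normal_pdf_val ler_pdivlMr//.
set y := x ^+ 2 / (2 * s ^+ 2).
have s2 : 0 < 2 * s ^+ 2 by rewrite mulr_gt0// exprn_gt0.
have -> : x * (normal_peak s * expR (- y)) * x = normal_peak s * (x ^+ 2 * expR (- y)) by ring.
rewrite ler_wpM2l ?normal_peak_ge0// expRN ler_pdivrMr ?expR_gt0//.
have := expR_ge1Dx y; have -> : x ^+ 2 = 2 * s ^+ 2 * y by rewrite /y mulrC divfK// gt_eqF.
move=> h; rewrite ler_pM2l//; lra.
Qed.

Let itvk k : set R := `[- (k.+1%:R : R), k.+1%:R]%classic.

Let cvg_itvk (f : R -> R) : measurable_fun setT f -> (forall x, 0 <= f x) ->
  (\int[mu]_(x in itvk k) (f x)%:E @[k --> \oo] --> \int[mu]_x (f x)%:E)%E.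
Proof.
move=> mf f0; have -> : setT = \bigcup_k itvk k.
  apply/esym/seteqP; split => // x _; exists (Num.truncn `|x|) => //=.
  by rewrite /itvk /= in_itv/= -ler_norml ltW// truncnS_gt.
apply: ge0_nondecreasing_set_cvg_integral => //.
- move=> a b ab; apply/subsetPset => x; rewrite /itvk/= !in_itv/= -!ler_norml => xa.
  by apply: le_trans xa _; rewrite ler_nat.
- by move=> k; exact: measurable_itv.
- by move=> k; apply: measurable_funTS; exact/measurable_EFinP.
- by move=> k x _; rewrite lee_fin.
Qed.

(** Integration by parts on growing intervals: - s^2 x pdf x is a primitive of (x^2 - s^2) pdf x. *)
Lemma normal_sqr : (\int[N]_x (x ^+ 2)%:E = (s ^+ 2)%:E)%E.
Proof.
have mpdf := measurable_normal_pdf (0 : R) s.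
have cpdf : continuous pdf by apply: continuous_normal_pdf; rewrite gt_eqF.
have c2 : continuous (fun x : R => x ^+ 2 * pdf x : R).
  by move=> x; apply: cvgM; [exact: exprn_continuous|exact: cpdf].
rewrite ge0_integral_normal//; last 2 first.
- by apply/measurable_EFinP; exact: exprn_measurable.
- by move=> x; rewrite lee_fin sqr_ge0.
have h1 := cvg_itvk (f := fun x => x ^+ 2 * pdf x)
  (continuous_measurable_fun c2) (fun x => mulr_ge0 (sqr_ge0 x) (normal_pdf_ge0 _ _ _)).
have h2 := cvg_itvk mpdf (normal_pdf_ge0 _ _).
rewrite integral_normal_pdf in h2.
have key k : (\int[mu]_(x in itvk k) (x ^+ 2 * pdf x)%:E =
    (s ^+ 2)%:E * \int[mu]_(x in itvk k) (pdf x)%:E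
    + (- (2 * s ^+ 2 * (k.+1%:R * pdf k.+1%:R)))%:E)%E.
  pose F (x : R) : R := - s ^+ 2 * (x * pdf x).
  have dF (x : R) : is_derive x 1 F (x ^+ 2 * pdf x - s ^+ 2 * pdf x).
    have h := is_derive_normal_pdf x.
    rewrite /F; apply: is_derive_eq; rewrite /GRing.scale/=; field; rewrite gt_eqF//.
  have cF : continuous F.
    by move=> x; apply: differentiable_continuous; apply/derivable1_diffP; exact: ex_derive.
  have c3 : continuous (fun x : R => x ^+ 2 * pdf x - s ^+ 2 * pdf x).
    move=> x; apply: cvgB; first exact: c2.
    by apply: cvgM; [exact: cvg_cst|exact: cpdf].
  have kk : - (k.+1%:R) < k.+1%:R :> R by rewrite -subr_gt0 opprK addr_gt0.
  have := @continuous_FTC2 R _ F _ _ kk (continuous_subspaceT c3).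
  have dLR : derivable_oo_LRcontinuous F (- k.+1%:R) k.+1%:R.
    split; first by move=> x _; exact: ex_derive.
      exact: cvg_at_right_filter (cF _).
    exact: cvg_at_left_filter (cF _).
  have F' : {in `](- k.+1%:R), k.+1%:R[, (F^`())%classic =1 (fun x => x ^+ 2 * pdf x - s ^+ 2 * pdf x)}.
    by move=> x _; rewrite derive1E; exact: derive_val.
  move=> /(_ dLR F').
  have i1 := integrable_continuous (- k.+1%:R) k.+1%:R c2.
  have i2 := integrable_continuous (- k.+1%:R) k.+1%:R cpdf.
  have c4 : continuous (fun x : R => s ^+ 2 * pdf x).
    by move=> x; apply: cvgM; [exact: cvg_cst|exact: cpdf].
  have i3 := integrable_continuous (- k.+1%:R) k.+1%:R c4.
  have mI : measurable (`[- k.+1%:R, k.+1%:R]%classic : set (measurableTypeR R)).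
    exact: measurable_itv.
  move=> /(congr1 fine); rewrite -[LHS]/(\int[mu]_(x in `[- k.+1%:R, k.+1%:R])
    (x ^+ 2 * pdf x - s ^+ 2 * pdf x)).
  rewrite (RintegralB mI i1 i3) (RintegralZl _ mI i2) -EFinB /=.
  have fin2 := integrable_fin_num mI i2.
  have fin1 := integrable_fin_num mI i1.
  rewrite -/(itvk k) in fin1 fin2 *.
  rewrite -(fineK fin1) -(fineK fin2) -!EFinM -EFinD => h.
  congr EFin; move: h; rewrite /F /Rintegral.
  have -> : pdf (- k.+1%:R) = pdf k.+1%:R by rewrite !normal_pdf_val sqrrN.
  set a := fine _; set b := fine _; lra.
have hpk : (k.+1%:R * pdf k.+1%:R @[k --> \oo] --> (0 : R)).
  apply: (@squeeze_cvgr _ _ _ _ (fun=> 0) (fun k => normal_peak s * (2 * s ^+ 2) * k.+1%:R^-1)).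
  - by near=> k; rewrite mulr_ge0 ?normal_pdf_ge0//=; apply: normal_pdf_decay.
  - exact: cvg_cst.
  - have := cvgM (cvg_cst (normal_peak s * (2 * s ^+ 2))) (@cvg_harmonic R).
    by rewrite mulr0; apply.
have h3 : ((- (2 * s ^+ 2 * (k.+1%:R * pdf k.+1%:R)))%:E @[k --> \oo] --> 0%E).
  apply: cvg_EFin; first by near=> k.
  have := cvgN (cvgM (cvg_cst (2 * s ^+ 2)) hpk).
  by rewrite mulr0 oppr0; apply.
have h4 : ((s ^+ 2)%:E * \int[mu]_(x in itvk k) (pdf x)%:E
    + (- (2 * s ^+ 2 * (k.+1%:R * pdf k.+1%:R)))%:E)%E @[k --> \oo] --> ((s ^+ 2)%:E * 1 + 0)%E.
  apply: cvgeD => //.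
  by apply: cvgeZl => //; exact: h2.
rewrite mule1 adde0 in h4.
under eq_integral do rewrite -EFinM.
by rewrite /= (funext key) in h1; exact: cvg_unique h1 h4.
Unshelve. all: by end_near. Qed.

(** Only the order s^4 matters. With y = x^2 / (8 s^2), x^4 times the density of scale s is 64 s^4
    times 2 y^2 exp (- 3 y) times the density of scale 2 s, and 2 y^2 <= exp (3 y). *)
Lemma normal_fourth : (\int[N]_x (x ^+ 4)%:E <= (64 * s ^+ 4)%:E)%E.
Proof.
pose t := 2 * s; have t0 : 0 < t by rewrite mulr_gt0.
rewrite ge0_integral_normal//; last 2 first.
- by apply/measurable_EFinP; exact: exprn_measurable.
- by move=> x; rewrite lee_fin exprn_even_ge0.
have mpt := measurable_normal_pdf (0 : R) t.
apply: (@le_trans _ _ (\int[mu]_x ((64 * s ^+ 4)%:E * (normal_pdf 0 t x)%:E))%E).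
  apply: ge0_le_integral => //.
  - by move=> x _; rewrite -EFinM lee_fin mulr_ge0 ?normal_pdf_ge0// exprn_even_ge0.
  - apply: emeasurable_funM; first by apply/measurable_EFinP; exact: exprn_measurable.
    by apply/measurable_EFinP; exact: measurable_normal_pdf.
  - by apply: emeasurable_funM => //; exact/measurable_EFinP.
  - move=> x _; rewrite -!EFinM lee_fin normal_pdf_val normal_pdfE ?gt_eqF//.
    rewrite /normal_fun subr0 mulNr -[t ^+ 2 *+ 2]mulr_natl.
    set y := x ^+ 2 / (2 * t ^+ 2).
    have -> : x ^+ 2 / (2 * s ^+ 2) = y + 3 * y by rewrite /y /t; field; rewrite gt_eqF.
    have tE : normal_peak s = 2 * normal_peak t.
      rewrite /normal_peak (_ : t ^+ 2 * pi *+ 2 = 2 ^+ 2 * (s ^+ 2 * pi *+ 2)); last first.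
        by rewrite /t exprMn -mulrA mulrnAr.
      rewrite [in RHS]sqrtrM ?sqr_ge0// sqrtr_sqr (ger0_norm (ler0n _ 2)) invfM.
      by rewrite mulVKf.
    rewrite opprD expRD tE.
    have y0 : 0 <= y by rewrite divr_ge0 ?sqr_ge0// mulr_ge0// sqr_ge0.
    have e3 := expR_ge1Dxn 1 (mulr_ge0 (ler0n R 3) y0).
    have -> : x ^+ 4 = 64 * s ^+ 4 * y ^+ 2 by rewrite /y /t; field; rewrite gt_eqF.
    move: (normal_peak t) (normal_peak_ge0 t) => pk pk0.
    rewrite (_ : 64 * s ^+ 4 * y ^+ 2 * _ =
      64 * s ^+ 4 * (pk * expR (- y)) * (2 * y ^+ 2 * expR (- (3 * y)))); last by ring.
    have S0 : 0 <= 64 * s ^+ 4 by rewrite mulr_ge0// exprn_even_ge0.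
    have S1 : 0 <= 64 * s ^+ 4 * (pk * expR (- y)) by rewrite mulr_ge0// mulr_ge0// expR_ge0.
    rewrite -[leRHS]mulr1; apply: ler_wpM2l => //.
    rewrite expRN ler_pdivrMr ?expR_gt0// mul1r; apply: le_trans e3.
    have -> : (3 * y) ^+ 2 / 2`!%:R = 9 / 2 * y ^+ 2.
      by rewrite (_ : 2`!%:R = 2 :> R)//; field.
    have := sqr_ge0 y; set z := y ^+ 2; lra.
rewrite ge0_integralZl//.
- by rewrite integral_normal_pdf mule1.
- exact/measurable_EFinP.
- by move=> x _; rewrite lee_fin normal_pdf_ge0.
- by rewrite lee_fin mulr_ge0// exprn_even_ge0.
Qed.

Lemma normal_symmetric (A : set R) : measurable A -> N ((fun x => - x) @^-1` A) = N A.
Proof.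
move=> mA; rewrite /normal_prob.
pose opp := (-%R : measurableTypeR R -> measurableTypeR R).
have mopp : measurable_fun setT opp by exact: oppr_measurable.
have mp : measurable_fun setT (EFin \o pdf).
  by apply/measurable_EFinP; exact: measurable_normal_pdf.
transitivity (\int[pushforward mu opp]_(x in A) (pdf x)%:E)%E; last first.
  by apply: eq_measure_integral => B mB _; exact: lebesgue_measureN.
rewrite ge0_integral_pushforward//.
- by apply: eq_integral => x _ /=; rewrite /opp !normal_pdf_val sqrrN.
- exact: measurable_funTS.
- by move=> x _; rewrite lee_fin normal_pdf_ge0.
Qed.

(** The law is taken as an image of the normal law and not as a normal law of scale sigma s, so that
    sigma is an arbitrary real. [psi_le4] and the fourth moment bound the last parameter. *)
Lemma scaled_normal_centered (sigma : R) :
  exists nu : probability (measurableTypeR R) R,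
    (forall A, measurable A -> nu A = N ((fun x => sigma * x) @^-1` A)) /\
    centered nu (sigma ^+ 2 * s ^+ 2) (64 * sigma ^+ 4 * s ^+ 4).
Proof.
have msc : measurable_fun setT (fun x : measurableTypeR R => (sigma * x : measurableTypeR R)).
  by apply: measurable_funM => //; exact: measurable_cst.
pose msc' := isMeasurableFun.Build _ _ _ _ _ msc.
pose X : {mfun (measurableTypeR R) >-> (measurableTypeR R)} :=
  HB.pack (fun x : measurableTypeR R => (sigma * x : measurableTypeR R)) msc'.
exists (distribution N X); split => //.
have ge0_int (f : R -> R) : measurable_fun setT f -> (forall x, 0 <= f x) ->
    (\int[distribution N X]_x (f x)%:E = \int[N]_x (f (sigma * x))%:E)%E.
  move=> mf f0; rewrite ge0_integral_pushforward//.
    exact/measurable_EFinP.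
  by move=> x _; rewrite lee_fin.
have msqr : measurable_fun setT (fun x : R => x ^+ 2) by exact: exprn_measurable.
have sqrE : (\int[distribution N X]_x (x ^+ 2)%:E = (sigma ^+ 2 * s ^+ 2)%:E)%E.
  rewrite (ge0_int (fun x => x ^+ 2)) => [||x]; [|exact: msqr|exact: sqr_ge0].
  under eq_integral do rewrite exprMn EFinM.
  rewrite ge0_integralZl//.
  - by rewrite normal_sqr.
  - exact/measurable_EFinP.
  - by move=> x _; rewrite lee_fin sqr_ge0.
  - by rewrite lee_fin sqr_ge0.
have isqr : (distribution N X).-integrable setT (EFin \o (fun x : R => x ^+ 2)).
  apply/integrableP; split; first exact/measurable_EFinP.
  under eq_integral do rewrite /= ger0_norm ?sqr_ge0//.
  by rewrite sqrE ltry.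
have iid : (distribution N X).-integrable setT (EFin \o (id : R -> R)).
  have i1 : (distribution N X).-integrable setT (EFin \o (fun x : R => 1 + x ^+ 2)).
    apply: integrable_rD => //.
    by apply: (@integrable_bounded _ _ _ _ _ 1) => // w; rewrite normr1.
  apply: (le_integrable measurableT _ _ i1).
    by apply/measurable_EFinP; exact: measurable_id.
  move=> x _ /=; rewrite lee_fin [leRHS]ger0_norm.
    rewrite -[x ^+ 2]real_normK ?num_real//.
    have := sqr_ge0 (`|x| - 1); rewrite sqrrB1; have := normr_ge0 x; nra.
  by rewrite addr_ge0// sqr_ge0.
split => //.
(* The law is invariant under x |-> - x, so its mean equals its opposite. *)
- pose opp := (-%R : measurableTypeR R -> measurableTypeR R).
  have mopp : measurable_fun setT opp by exact: oppr_measurable.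
  have symm (A : set R) : measurable A ->
      pushforward (distribution N X) opp A = distribution N X A.
    move=> mA; rewrite /pushforward /distribution /pushforward /=.
    have mXA : measurable (X @^-1` A) by have := msc measurableT _ mA; rewrite setTI.
    rewrite -[RHS](normal_symmetric mXA); congr (normal_prob _ _ _).
    by apply/seteqP; split => x /=; rewrite /opp mulrN.
  have : (\int[distribution N X]_x x%:E = \int[distribution N X]_x (- x)%:E)%E.
    transitivity (\int[pushforward (distribution N X) opp]_x x%:E)%E.
      by apply: eq_measure_integral => A mA _; exact: (esym (symm A mA)).
    rewrite integral_pushforward//.
    have := integrable_rZ (-1) iid; apply: eq_integrable => // x _.
    by rewrite /= mulN1r.
  move=> /(congr1 fine); rewrite -[LHS]/(\int[distribution N X]_x x) => h.
  have : \int[distribution N X]_x x = - \int[distribution N X]_x x.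
    rewrite [LHS]h -[LHS]/(\int[distribution N X]_x (- x)).
    under eq_Rintegral do rewrite -mulN1r.
    by rewrite (RintegralZl _ measurableT iid) mulN1r.
  by move=> /eqP; rewrite -subr_eq0 opprK -mulr2n mulrn_eq0 => /eqP.
- by rewrite /Rintegral sqrE.
- have s4 : 0 <= 64 * sigma ^+ 4 * s ^+ 4.
    by apply: mulr_ge0; [apply: mulr_ge0|]; rewrite ?exprn_even_ge0.
  rewrite /Rintegral -lee_fin fineK; last first.
    rewrite ge0_fin_numE; last by apply: integral_ge0 => x _; rewrite lee_fin psi_ge0.
    rewrite (le_lt_trans _ (ltry (sigma ^+ 2 * s ^+ 2)))// -sqrE.
    apply: ge0_le_integral => //.
    - by move=> x _; rewrite lee_fin psi_ge0.
    - by apply/measurable_EFinP; exact: measurable_psi.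
    - exact/measurable_EFinP.
    - by move=> x _; rewrite lee_fin psi_le2.
  rewrite (ge0_int (@psi R)) => [||x]; [|exact: measurable_psi|exact: psi_ge0].
  apply: (@le_trans _ _ (\int[N]_x ((sigma ^+ 4)%:E * (x ^+ 4)%:E))%E).
    apply: ge0_le_integral => //.
    - by move=> x _; rewrite lee_fin psi_ge0.
    - by apply/measurable_EFinP; apply: measurableT_comp => //; exact: measurable_psi.
    - by apply: emeasurable_funM => //; apply/measurable_EFinP; exact: exprn_measurable.
    - by move=> x _; rewrite -EFinM lee_fin -exprMn psi_le4.
  rewrite ge0_integralZl//.
  - apply: le_trans (lee_wpmul2l _ normal_fourth) _.
      by rewrite lee_fin exprn_even_ge0.
    by rewrite -EFinM lee_fin mulrA [_ * 64]mulrC.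
  - by apply/measurable_EFinP; exact: exprn_measurable.
  - by move=> x _; rewrite lee_fin exprn_even_ge0.
  - by rewrite lee_fin exprn_even_ge0.
Qed.

End normal_moments.

(** * Paths in the Skorokhod space *)

Section skorokhod_paths.
Context {R : realType}.
Local Notation D := (skorokhod R).

Lemma skorokhod_dist_uniform (x y : D) (e : R) :
  (forall t : R, t \in `[0, 1] -> `|x t - y t| <= e) -> mdist x y <= e.
Proof.
move=> xy; apply: skorokhod_dist_le; exists id => [|t t01].
  exact: time_change_id.
have e0 : 0 <= e by apply: le_trans (normr_ge0 _) (xy t t01).
by rewrite subrr normr0; split => //; exact: xy.
Qed.

(** One shape covers all the step paths: the logarithmic path has c = 1 and the centering as e,
    while the process of the theorem has the exponential normalization as c and e = 0. *)
Definition affine_fun (n : nat) (c e : R -> R) (v : nat -> R) (t : R) : R :=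
  if t \in `[0, 1] then v (Num.truncn (n%:R * t)) * c t + e t else 0.

Lemma cadlag_affine n (c e : R -> R) v : continuous c -> continuous e ->
  cadlag (affine_fun n c e v).
Proof.
move=> cc ce.
have cvg k t (F : set_system R) : Filter F -> F --> t ->
    v k * c s + e s @[s --> F] --> v k * c t + e t.
  move=> FF Ft; apply: cvgD; last exact: (cvg_comp _ _ Ft (ce t)).
  by apply: cvgM; [exact: cvg_cst|exact: (cvg_comp _ _ Ft (cc t))].
split=> t; rewrite in_itv/= => /andP[t0 t1].
- have t01 : t \in `[0, 1] by rewrite in_itv/= t0 ltW.
  rewrite {2}/affine_fun t01; set k := Num.truncn _.
  have nt0 : 0 <= n%:R * t by rewrite mulr_ge0.
  have /andP[kt tk] := truncn_itv nt0; rewrite -/k in kt tk.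
  apply: (cvg_trans _ (cvg k t t^'+ _ (cvg_within _))); apply: near_eq_cvg.
  have near_lt : \forall s \near t^'+, n%:R * s < k.+1%:R.
    apply: (@cvgr_lt _ _ _ _ _ (n%:R * t)) => //.
    by apply: cvgM; [exact: cvg_cst|exact: cvg_within].
  near=> s.
  have ts : t < s by near: s; exact: nbhs_right_gt.
  have s1 : s <= 1 by apply/ltW; near: s; exact: nbhs_right_lt.
  rewrite /affine_fun in_itv/= s1 (le_trans t0 (ltW ts))/=.
  rewrite (truncn_def (n := k))//; apply/andP; split; last by near: s.
  by apply: le_trans kt _; rewrite ler_wpM2l// ltW.
- have [k hk] : exists k : nat, \forall s \near t^'-, Num.truncn (n%:R * s) = k.
    have [n0|n0] := posnP n.
      by exists 0%N; near=> s; rewrite n0 mul0r truncn0.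
    pose z := n%:R * t.
    have z0 : 0 < z by rewrite mulr_gt0// ltr0n.
    (* The index is constant just to the left of t. When n t is an integer this index is n t - 1,
       hence the strict inequality on the left and the large one on the right. *)
    have [k kz zk] : exists2 k : nat, k%:R < z & z <= k.+1%:R.
      have /andP[h1 h2] := truncn_itv (ltW z0).
      move: h1; rewrite le_eqVlt => /predU1P[h1|h1].
        case E : (Num.truncn z) => [|k]; first by move: z0; rewrite -h1 E ltxx.
        by exists k; rewrite -h1 E// ltr_nat.
      by exists (Num.truncn z) => //; exact: ltW.
    exists k.
    have near_gt : \forall s \near t^'-, k%:R < n%:R * s.
      apply: (@cvgr_gt _ _ _ _ _ (n%:R * t)) => //.
      by apply: cvgM; [exact: cvg_cst|exact: cvg_within].
    have near_lt : \forall s \near t^'-, s < t by exact: nbhs_left_lt.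
    apply: filterS2 near_gt near_lt => s ks st; apply: truncn_def.
    by rewrite (ltW ks)/=; apply: lt_le_trans zk; rewrite /z ltr_pM2l ?ltr0n.
  apply/cvg_ex; exists (v k * c t + e t).
  apply: (cvg_trans _ (cvg k t t^'- _ (cvg_within _))); apply: near_eq_cvg; near=> s.
  have st : s < t by near: s; exact: nbhs_left_lt.
  have s0 : 0 <= s by apply/ltW; near: s; exact: nbhs_left_gt.
  rewrite /affine_fun in_itv/= s0 (le_trans (ltW st) t1)/=.
  by congr (v _ * _ + _); apply/esym; near: s.
Unshelve. all: by end_near. Qed.

Lemma affine_out n c e v (t : R) : t \notin `[0, 1] -> affine_fun n c e v t = 0.
Proof. by rewrite /affine_fun => /negbTE ->. Qed.

Definition affine_path n (c e : R -> R) (cc : continuous c) (ce : continuous e)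
    (v : nat -> R) : D :=
  Skorokhod (cadlag_affine n v cc ce) (@affine_out n c e v).

Lemma truncn_le_index n (t : R) : t \in `[0, 1] -> (Num.truncn (n%:R * t) <= n)%N.
Proof.
rewrite in_itv/= => /andP[t0 t1]; rewrite -[leqRHS](natrK (R := R)).
by apply: le_truncn; rewrite ler_piMr.
Qed.

Lemma affine_path_dist n (c e : R -> R) (cc : continuous c) (ce : continuous e)
    (v v' : nat -> R) (K r : R) :
  (forall t, t \in `[0, 1] -> `|c t| <= K) -> 0 <= r ->
  (forall i, (i <= n)%N -> `|v i - v' i| <= r) ->
  mdist (affine_path n cc ce v) (affine_path n cc ce v') <= r * K.
Proof.
move=> cK r0 vr; apply: skorokhod_dist_uniform => t t01 /=.
rewrite /affine_fun t01 opprD addrACA subrr addr0 -mulrBl normrM ler_pM//.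
  by apply: vr; exact: truncn_le_index.
exact: cK.
Qed.

Section measurability.
Context d (T : measurableType d).

Lemma measurable_borel (S : ptopologicalType) (X : T -> borel S) :
  (forall U : set S, open U -> measurable (X @^-1` U)) -> measurable_fun setT X.
Proof.
move=> oX; apply: (@measurability _ _ T (borel S) setT X (@open S)) => //.
by move=> _ [U oU <-]; rewrite setTI; exact: oX.
Qed.

Lemma open_skorokhodP (U : set D) x : open U -> U x ->
  exists2 e : R, 0 < e & forall y, mdist x y < e -> U y.
Proof.
move=> oU Ux; have /nbhs_ballP[e /= e0 he] : nbhs x U by exact: open_nbhs_nbhs.
by exists e => // y xy; apply: he; rewrite ballEmdist.
Qed.

(** The path depends continuously on n + 1 real variables, so the preimage of an open set is
    [box_open]; no description of the Borel sets of D by coordinates is required. *)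
Lemma measurable_affine_path n (c e : R -> R) (cc : continuous c) (ce : continuous e)
    (V : nat -> T -> R) (K : R) :
  (forall t, t \in `[0, 1] -> `|c t| <= K) ->
  (forall i, measurable_fun setT (V i)) ->
  measurable_fun setT (fun w => affine_path n cc ce (fun i => V i w) : borel D).
Proof.
move=> cK mV; apply: measurable_borel => U oU.
apply: (@measurable_box_open _ _ _ n.+1 V
  [set v | U (affine_path n cc ce v)]) => [j _|v /= Uv]; first exact: mV.
have [r r0 hr] := open_skorokhodP oU Uv.
have K0 : 0 <= K.
  by apply: le_trans (normr_ge0 _) (cK 0 _); rewrite in_itv/= lexx ler01.
have K1 : 0 < K + 1 by rewrite ltr_wpDl.
exists (r / (K + 1)) => [|v' vv']; first exact: divr_gt0.
apply: hr; apply: (@le_lt_trans _ _ (r / (K + 1) * K)).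
  apply: affine_path_dist cK _ _; first by rewrite divr_ge0 ?ltW.
  by move=> i ip; apply/ltW/vv'.
by rewrite mulrAC ltr_pdivrMr//; nra.
Qed.

(** The limit lies in the open set U exactly when, for some k, the X n eventually lie in the closed
    set [F k] of points whose ball of radius 1 / (k + 1) is contained in U. *)
Lemma measurable_skorokhod_limit (X : nat -> T -> borel D) (Y : T -> borel D) :
  (forall n, measurable_fun setT (X n)) ->
  (forall w, mdist (X n w : D) (Y w) @[n --> \oo] --> (0 : R)) ->
  measurable_fun setT Y.
Proof.
move=> mX XY; apply: measurable_borel => U oU.
pose F k : set D := [set x | forall y, mdist x y < k.+1%:R^-1 -> U y].
have mF k : measurable (F k : set (borel D)).
  rewrite -[F k]setCK; apply: measurableC; apply: sub_sigma_algebra.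
  rewrite openE => x /existsNP[y /not_implyP[xy Uy]].
  apply/nbhs_ballP; exists (k.+1%:R^-1 - mdist x y) => /=; first by rewrite subr_gt0.
  move=> z; rewrite ballEmdist/= => xz; apply/existsNP; exists y; apply/not_implyP; split => //.
  apply: (le_lt_trans (metric_triangle _ x _)); rewrite [X in X + _]metric_sym.
  by rewrite -ltrBrDr.
rewrite (_ : Y @^-1` U = \bigcup_k \bigcup_N \bigcap_(n in [set n | (N <= n)%N]) (X n @^-1` F k)).
  apply: bigcup_measurable => k _; apply: bigcup_measurable => N _.
  apply: bigcap_measurable => [|n _]; first by exists N => /=.
  by rewrite -[_ @^-1` _]setTI; exact: mX.
have near w (e : R) : 0 < e -> exists N, forall n, (N <= n)%N -> mdist (X n w : D) (Y w) < e.
  move=> e0; have /cvgrPdist_lt/(_ e e0)[N _ hN] := XY w.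
  exists N => n /hN /=; rewrite sub0r normrN ger0_norm//; exact: mdist_ge0.
apply/seteqP; split => w /=.
  move=> UY; have [e e0 he] := open_skorokhodP oU UY.
  have [k _ /(_ k (leqnn k)) /= hk] : \forall k \near \oo, k.+1%:R^-1 < e / 2 :> R.
    have := @cvg_harmonic R; move=> /cvgrPdist_lt/(_ (e/2)).
    rewrite divr_gt0// => /(_ isT); apply: filterS => n /=.
    by rewrite sub0r normrN ger0_norm.
  have [N hN] := near w (e / 2) ltac:(by rewrite divr_gt0).
  exists k => //; exists N => // n /= /hN XYn y Xy; apply: he.
  apply: (le_lt_trans (metric_triangle _ (X n w : D) _)).
  rewrite [X in X + _]metric_sym (splitr e) ltrD//; exact: lt_trans hk.
move=> [k _ [N _ hN]].
have [N' hN'] := near w k.+1%:R^-1 ltac:(by rewrite invr_gt0).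
exact: (hN (maxn N N') (leq_maxl _ _) _ (hN' _ (leq_maxr _ _))).
Qed.

End measurability.

Lemma continuous_skorokhodP (f : D -> R) : continuous f ->
  forall x e, 0 < e -> exists2 r : R, 0 < r & forall y, mdist x y < r -> `|f x - f y| < e.
Proof.
move=> cf x e e0; have /cvgrPdist_lt/(_ e e0)/nbhs_ballP[r /= r0 hr] := cf x.
by exists r => // y xy; apply: hr; rewrite ballEmdist.
Qed.

Lemma lipschitz_skorokhod_continuous (f : D -> R) (C : R) :
  (forall x y, `|f x - f y| <= C * mdist x y) -> continuous f.
Proof.
move=> fC x; apply/(@cvgrPdist_lt R R^o D (nbhs x) (nbhs_filter x) f) => e e0.
have C1 : 0 < `|C| + 1 by rewrite ltr_wpDl.
apply/nbhs_ballP; exists (e / (`|C| + 1)) => [|y]; first exact: divr_gt0.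
rewrite ballEmdist/= => xy; apply: le_lt_trans (fC x y) _.
have d0 : 0 <= mdist x y by exact: mdist_ge0.
move: xy; rewrite ltr_pdivlMr// => xy.
have := ler_norm C; nra.
Qed.

Lemma measurable_continuous_borel (f : D -> R) : continuous f ->
  measurable_fun (setT : set (borel D)) (f : borel D -> R).
Proof.
move=> cf; apply: (measurability _ (RGenOInfty.measurableE R)) => //.
move=> _ [_ [a ->] <-]; rewrite setTI; apply: sub_sigma_algebra.
by apply: open_comp => [x _|]; [exact: cf|exact: rray_open].
Qed.

Lemma expR_lip (M a b : R) : a <= M -> b <= M -> `|expR a - expR b| <= expR M * `|a - b|.
Proof.
wlog : a b / a <= b => [wl aM bM|ab _ bM].
  have [ab|ba] := leP a b; first exact: wl.
  by rewrite distrC [`|a - b|]distrC; exact: wl (ltW ba) bM aM.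
rewrite distrC [`|a - b|]distrC !ger0_norm ?subr_ge0 ?ler_expR//.
apply: (@le_trans _ _ (expR b * (b - a))); last by rewrite ler_wpM2r ?subr_ge0// ler_expR.
have := expR_ge1Dx (a - b).
rewrite expRD expRN ler_pdivlMr ?expR_gt0//; lra.
Qed.

Definition exp_fun (x : R -> R) (t : R) : R := if t \in `[0, 1] then expR (x t) else 0.

Lemma cadlag_exp (x : D) : cadlag (exp_fun x).
Proof.
have [xr xl] := sk_cadlag x; split=> t t01; move: (t01); rewrite in_itv/= => /andP[t0 t1].
- have t01' : t \in `[0, 1] by rewrite in_itv/= t0 ltW.
  rewrite {2}/exp_fun t01'.
  apply: (cvg_trans _ (cvg_comp _ _ (xr t t01) (@continuous_expR R (x t)))).
  apply: near_eq_cvg; near=> s.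
  have ts : t < s by near: s; exact: nbhs_right_gt.
  have s1 : s <= 1 by apply/ltW; near: s; exact: nbhs_right_lt.
  by rewrite /exp_fun in_itv/= s1 (le_trans t0 (ltW ts)).
- have /cvg_ex[l hl] := xl t t01.
  apply/cvg_ex; exists (expR l).
  apply: (cvg_trans _ (cvg_comp _ _ hl (@continuous_expR R l))).
  apply: near_eq_cvg; near=> s.
  have st : s < t by near: s; exact: nbhs_left_lt.
  have s0 : 0 <= s by apply/ltW; near: s; exact: nbhs_left_gt.
  by rewrite /exp_fun in_itv/= s0 (le_trans (ltW st) t1).
Unshelve. all: by end_near. Qed.

Lemma exp_out (x : D) (t : R) : t \notin `[0, 1] -> exp_fun x t = 0.
Proof. by rewrite /exp_fun => /negbTE ->. Qed.

Definition exp_path (x : D) : D := Skorokhod (cadlag_exp x) (@exp_out x).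

(** The exponential acts on values only, so the time change that brings y close to x also serves
    their exponentials. Since r <= 1, the values of y stay below M + 1, where exp is Lipschitz with
    constant exp (M + 1). *)
Lemma exp_path_continuous : continuous exp_path.
Proof.
move=> x U /nbhs_ballP[e /= e0 he].
have [M hM] := cadlag_bounded x.
pose r := Num.min 1 (e / (2 * expR (M + 1))).
have r0 : 0 < r by rewrite lt_min ltr01 divr_gt0// mulr_gt0// expR_gt0.
pose r' := Num.min r (e / 2).
have r'0 : 0 < r' by rewrite lt_min r0 divr_gt0.
apply/nbhs_ballP; exists r' => // y; rewrite ballEmdist/= => xy; apply: he; rewrite ballEmdist/=.
have [e' e'r [lam hlam h]] := skorokhod_dist_within xy.
move: e'r; rewrite !lt_min => /andP[/andP[e'1 e'r] e'2].
have e'0 : 0 <= e'.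
  by apply: (skorokhod_within_ge0 (x := x) (y := y)); exists lam.
apply: (@le_lt_trans _ _ (e / 2)); last by rewrite ltr_pdivrMr// ltr_pMr// ltr1n.
apply: skorokhod_dist_le; exists lam => // t t01.
have [h1 h2] := h t t01.
split; first exact: le_trans h1 (ltW e'2).
rewrite /= /exp_fun t01 time_change_in//.
have xM : x t <= M by apply: le_trans (ler_norm _) (hM t).
apply: le_trans (@expR_lip (M + 1) _ _ _ _) _.
- by apply: le_trans xM _; rewrite lerDl.
- by move: h2; rewrite ler_norml => /andP[h2 _]; lra.
- apply: (@le_trans _ _ (expR (M + 1) * e')); first by rewrite ler_wpM2l// expR_ge0.
  move: e'r; rewrite ltr_pdivlMr ?mulr_gt0 ?expR_gt0// => e'r.
  by rewrite ler_pdivlMr//; move: e'r; set E := expR _; lra.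
Qed.

Lemma cadlag_continuous (b : R -> R) : {within `[0, 1], continuous b} ->
  cadlag (fun t => if t \in `[0, 1] then b t else 0).
Proof.
move=> cb; have := cb; rewrite continuous_within_itvP// => -[c1 c2 c3].
have cr (t : R) : 0 <= t -> t < 1 -> b s @[s --> t^'+] --> b t.
  rewrite le_eqVlt => /predU1P[<- //|t0] t1.
  by apply: cvg_at_right_filter; apply: c1; rewrite in_itv/= t0.
have cl (t : R) : 0 < t -> t <= 1 -> b s @[s --> t^'-] --> b t.
  move=> t0; rewrite le_eqVlt => /predU1P[->//|t1].
  by apply: cvg_at_left_filter; apply: c1; rewrite in_itv/= t0.
split=> t; rewrite in_itv/= => /andP[t0 t1].
- have t01 : t \in `[0, 1] by rewrite in_itv/= t0 ltW.
  rewrite t01; apply: (cvg_trans _ (cr t t0 t1)).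
  apply: near_eq_cvg; near=> s.
  have ts : t < s by near: s; exact: nbhs_right_gt.
  have s1 : s <= 1 by apply/ltW; near: s; exact: nbhs_right_lt.
  by rewrite in_itv/= s1 (le_trans t0 (ltW ts)).
- apply/cvg_ex; exists (b t); apply: (cvg_trans _ (cl t t0 t1)).
  apply: near_eq_cvg; near=> s.
  have st : s < t by near: s; exact: nbhs_left_lt.
  have s0 : 0 <= s by apply/ltW; near: s; exact: nbhs_left_gt.
  by rewrite in_itv/= s0 (le_trans (ltW st) t1).
Unshelve. all: by end_near. Qed.

Definition continuous_path (b : R -> R) (cb : {within `[0, 1], continuous b}) : D :=
  Skorokhod (cadlag_continuous cb) (fun t (h : t \notin `[0, 1]) =>
    ifN _ _ h).

Lemma segment_uniform_continuity (b : R -> R) (eps : R) :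
  {within `[0, 1], continuous b} -> 0 < eps ->
  exists2 r : R, 0 < r & forall s t : R,
    s \in `[0, 1] -> t \in `[0, 1] -> `|s - t| < r -> `|b s - b t| < eps.
Proof.
move=> /subspace_continuousP cb eps0.
have local (x : R) : x \in `[0, 1] -> exists2 e : R, 0 < e &
    forall z : R, z \in `[0, 1] -> `|x - z| < e -> `|b x - b z| < eps / 2.
  move=> x01; have /cvgrPdist_lt/(_ (eps / 2)) := cb x x01.
  rewrite divr_gt0// => /(_ isT); rewrite near_withinE => /nbhs_ballP[e /= e0 he].
  by exists e => // z z01 xz; apply: he.
have /compact_near_coveringP ncov := @segment_compact R 0 1.
pose Q (r x' : R) := x' \in `[0, 1] -> forall y : R, y \in `[0, 1] ->
  `|x' - y| < r -> `|b x' - b y| < eps.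
have : \forall r \near 0^'+, `[0, 1]%classic `<=` Q r.
  apply: (ncov R (0^'+) Q) => x x01.
  have [e e0 he] := local x x01.
  have e20 : 0 < e / 2 by rewrite divr_gt0.
  exists (ball x (e / 2), [set r : R | r < e / 2]) => /=.
    by split; [apply/nbhs_ballP; exists (e / 2)|exact: nbhs_right_lt].
  move=> [x' r] /= [xx' re] x'01 y y01 x'y.
  have h1 : `|b x - b x'| < eps / 2.
    by apply: he => //; apply: lt_trans xx' _; rewrite ltr_pdivrMr// ltr_pMr// ltr1n.
  have h2 : `|b x - b y| < eps / 2.
    apply: he => //; apply: (le_lt_trans (ler_distD x' _ _)).
    by rewrite (splitr e) ltrD//; exact: lt_trans re.
  apply: (le_lt_trans (ler_distD (b x) _ _)).
  by rewrite [X in X + _]distrC (splitr eps) ltrD.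
move=> h.
have [r [r0 hr]] : exists r : R, 0 < r /\ `[0, 1]%classic `<=` Q r.
  near (0 : R)^'+ => r; exists r; split; last by near: r.
  by near: r; exact: nbhs_right_gt.
by exists r => // s t s01 t01 st; apply: (hr s).
Unshelve. all: by end_near. Qed.

Lemma continuous_path_step (b : R -> R) (cb : {within `[0, 1], continuous b})
    (c e : R -> R) (cc : continuous c) (ce : continuous e) :
  (forall t, c t = 1) -> (forall t, e t = 0) ->
  mdist (affine_path n cc ce (fun i => b (i%:R / n%:R))) (continuous_path cb)
    @[n --> \oo] --> (0 : R).
Proof.
move=> c1 e0; apply/cvgrPdist_le => eps eps0.
have [r r0 hr] := segment_uniform_continuity cb eps0.
have [N _ hN] : \forall n \near \oo, n.+1%:R^-1 < r.
  have := @cvg_harmonic R; move=> /cvgrPdist_lt/(_ r r0).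
  by apply: filterS => n /=; rewrite sub0r normrN ger0_norm.
exists N.+1 => // -[//|n] /= Nn; rewrite sub0r normrN ger0_norm; last exact: mdist_ge0.
apply: skorokhod_dist_uniform => t t01 /=.
have n0 : 0 < n.+1%:R :> R by rewrite ltr0n.
rewrite /affine_fun t01 c1 e0 mulr1 addr0; apply/ltW/hr => //.
  rewrite in_itv/= divr_ge0//= ler_pdivrMr// mul1r ler_nat.
  exact: truncn_le_index.
have nt0 : 0 <= n.+1%:R * t by move: t01; rewrite in_itv/= => /andP[t0 _]; rewrite mulr_ge0.
have /andP[h1 h2] := truncn_itv nt0.
apply: le_lt_trans (hN n Nn).
set k := Num.truncn _ in h1 h2 *.
have h3 : k%:R / n.+1%:R <= t by rewrite ler_pdivrMr// [t * _]mulrC.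
have h4 : t <= k.+1%:R / n.+1%:R by rewrite ler_pdivlMr// [t * _]mulrC ltW.
rewrite distrC ger0_norm ?subr_ge0// lerBlDr.
by apply: le_trans h4 _; rewrite -natr1 mulrDl mul1r addrC.
Qed.

(** Inf-convolution: g x is the infimum over y of f y + k d(x, y). Points at distance e or more cost
    at least 2 M, so only the values of f near x count; the last clause gives the convergence of g
    to f as k grows. *)
Lemma lipschitz_approx (f : D -> R) (M : R) (k : nat) : (forall x, `|f x| <= M) ->
  exists g : D -> R, [/\ forall x, `|g x| <= M,
    forall x y, `|g x - g y| <= k%:R * mdist x y,
    forall x, g x <= f x &
    forall x e eta, 0 <= eta -> (forall y, mdist x y < e -> f x - eta <= f y) ->
      2 * M <= k%:R * e -> f x - eta <= g x].
Proof.
move=> fM.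
pose E x := [set r | exists y, r = f y + k%:R * mdist x y].
have E0 x : E x !=set0 by exists (f x + k%:R * mdist x x); exists x.
have kd x y : 0 <= k%:R * mdist x y :> R by rewrite mulr_ge0// mdist_ge0.
have fN y : - M <= f y by move: (fM y); rewrite ler_norml => /andP[].
have fP y : f y <= M by move: (fM y); rewrite ler_norml => /andP[].
have EM x : lbound (E x) (- M).
  by move=> _ [y ->]; apply: le_trans (fN y) _; rewrite lerDl.
have iE x : has_inf (E x) by split => //; exists (- M).
pose g x := inf (E x).
have gle x y : g x <= f y + k%:R * mdist x y.
  by apply: ge_inf; [case: (iE x)|exists y].
have gf x : g x <= f x by have := gle x x; rewrite mdistxx mulr0 addr0.
have gN x : - M <= g x by apply: lb_le_inf.
have g1 x y : g x <= g y + k%:R * mdist x y.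
  rewrite -lerBlDr; apply: lb_le_inf => // _ [z ->].
  rewrite lerBlDr; apply: le_trans (gle x z) _.
  rewrite -addrA lerD2l -mulrDr ler_wpM2l// addrC; exact: metric_triangle.
exists g; split => //.
- by move=> x; rewrite ler_norml gN (le_trans (gf x)).
- move=> x y; have := g1 x y; have := g1 y x; rewrite (metric_sym y x) => h1 h2.
  by rewrite ler_norml; apply/andP; split; lra.
- move=> x e eta e0 he ke; apply: lb_le_inf => // _ [y ->].
  have [xy|xy] := ltP (mdist x y) e.
    by apply: le_trans (he y xy) _; rewrite lerDl.
  have h : k%:R * e <= k%:R * mdist x y by rewrite ler_wpM2l.
  have := fN y; have := fP x; lra.
Qed.

End skorokhod_paths.

(** * From Lipschitz test functions to weak convergence *)

Lemma bounded_convergence d (T : measurableType d) (R : realType) (P : probability T R)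
    (h : nat -> T -> R) (l : T -> R) (M : R) :
  (forall n, measurable_fun setT (h n)) -> measurable_fun setT l ->
  (forall n w, `|h n w| <= M) -> (forall w, h n w @[n --> \oo] --> l w) ->
  \int[P]_w h n w @[n --> \oo] --> \int[P]_w l w.
Proof.
move=> mh ml hM hl.
have lM w : `|l w| <= M.
  apply/ler_addgt0Pr => e e0.
  have /cvgrPdist_le/(_ e e0)[n _ /(_ n (leqnn n)) /= hn] := hl w.
  have := hM n w; have := ler_distD (h n w) (l w) 0; rewrite !subr0; lra.
apply: fine_cvg; rewrite fineK; last first.
  exact: (integrable_fin_num measurableT (integrable_bounded P ml lM)).
apply: (@dominated_cvg _ _ _ P setT measurableT
  (fun k w => (h k w)%:E) (fun w => (l w)%:E) (fun=> M%:E)) => //.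
- by move=> k; exact/measurable_EFinP.
- by move=> w _; apply: cvg_EFin; [near=> k|exact: hl].
- by apply: (@integrable_bounded _ _ _ _ (fun=> M) `|M|) => //; exact: measurable_cst.
- by move=> k w _ /=; rewrite lee_fin.
Unshelve. all: by end_near. Qed.

Section weak_limit.
Context {R : realType} d (T : measurableType d) (P : probability T R)
  d' (T' : measurableType d') (P' : probability T' R).
Local Notation D := (skorokhod R).
Variables (X : nat -> T -> borel D) (Y : T' -> borel D).
Hypothesis mX : forall n, measurable_fun setT (X n).
Hypothesis mY : measurable_fun setT Y.

Lemma measurable_comp_path d0 (T0 : measurableType d0) (Z : T0 -> borel D) (f : D -> R) :
  measurable_fun setT Z -> continuous f -> measurable_fun setT (fun w => f (Z w)).
Proof. by move=> mZ cf; exact: (measurableT_comp (measurable_continuous_borel cf) mZ). Qed.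

Lemma integrable_comp_path d0 (T0 : measurableType d0) (Q : probability T0 R)
    (Z : T0 -> borel D) (f : D -> R) (M : R) :
  measurable_fun setT Z -> continuous f -> (forall x, `|f x| <= M) ->
  Q.-integrable setT (EFin \o (fun w => f (Z w))).
Proof.
by move=> mZ cf fM; apply: (integrable_bounded Q (measurable_comp_path mZ cf)).
Qed.

Hypothesis lipXY : forall (f : D -> R) (C : R), (forall x, `|f x| <= C) ->
  (forall x y, `|f x - f y| <= C * mdist x y) ->
  \int[P]_w f (X n w) @[n --> \oo] --> \int[P']_w f (Y w).

(* The largest k-Lipschitz minorants of f are bounded Lipschitz and increase to f. *)
Lemma weak_limit_lower (f : D -> R) (M e : R) : continuous f -> (forall x, `|f x| <= M) ->
  0 < e -> \forall n \near \oo, \int[P']_w f (Y w) - e <= \int[P]_w f (X n w).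
Proof.
move=> cf fM e0.
have /choice[g hg] := fun k => lipschitz_approx k fM.
have cg k : continuous (g k).
  have [_ h _ _] := hg k; exact: lipschitz_skorokhod_continuous h.
have gf x : g k x @[k --> \oo] --> f x.
  apply/cvgrPdist_le => eps eps0.
  have [r r0 hr] := continuous_skorokhodP cf x eps0.
  (* For k above 2 M / r, points at distance r or more cannot bring the infimum below f x - eps. *)
  exists (Num.truncn (2 * M / r)).+1 => // k /= hk.
  have [h1 h2 h3 h4] := hg k.
  have fxg : 0 <= f x - g k x by rewrite subr_ge0.
  rewrite ger0_norm// lerBlDl -lerBlDr; apply: (h4 _ r); first exact: ltW.
    by move=> y xy; have := hr y xy; have := ler_norm (f x - f y); lra.
  rewrite -ler_pdivrMr//; apply: le_trans (ltW (truncnS_gt _)) _.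
  by rewrite ler_nat.
have limY : \int[P']_w g k (Y w) @[k --> \oo] --> \int[P']_w f (Y w).
  apply: (@bounded_convergence _ _ _ P' _ _ M).
  - by move=> k; exact: (measurable_comp_path mY (cg k)).
  - exact: (measurable_comp_path mY cf).
  - by move=> k w; have [h _ _ _] := hg k.
  - by move=> w; exact: gf.
move/cvgrPdist_le : limY => /(_ (e / 2)); rewrite divr_gt0// => /(_ isT) [k _ /(_ k (leqnn k)) /= hk].
have [gM gL gle _] := hg k.
(* The hypothesis on Lipschitz functions asks for one constant for both the sup bound and the
   Lipschitz bound. *)
have gM' x : `|g k x| <= Num.max M k%:R by rewrite le_max gM.
have gL' x y : `|g k x - g k y| <= Num.max M k%:R * mdist x y.
  by apply: le_trans (gL x y) _; rewrite ler_wpM2r ?mdist_ge0// le_max lexx orbT.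
have /cvgrPdist_le/(_ (e / 2)) := lipXY gM' gL'; rewrite divr_gt0// => /(_ isT).
apply: filterS => n hn.
have igX := integrable_comp_path P (mX n) (cg k) gM.
have ifX := integrable_comp_path P (mX n) cf fM.
have : \int[P]_w g k (X n w) <= \int[P]_w f (X n w).
  by apply: le_Rintegral => // w _; exact: gle.
move: hk hn; rewrite !ler_distl => /andP[? ?] /andP[? ?]; lra.
Unshelve. all: by end_near. Qed.

(** The upper bound is the lower bound for - f. *)
Lemma weak_limit_lipschitz (f : D -> R) (M : R) : continuous f -> (forall x, `|f x| <= M) ->
  \int[P]_w f (X n w) @[n --> \oo] --> \int[P']_w f (Y w).
Proof.
move=> cf fM; apply/cvgrPdist_le => e e0.
have cN : continuous (fun x => - f x) by move=> x; have := cvgN (cf x); apply.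
have fNM x : `|- f x| <= M by rewrite normrN.
have h1 := weak_limit_lower cf fM e0.
have h2 := weak_limit_lower cN fNM e0.
have EN d0 (T0 : measurableType d0) (Q : probability T0 R) (Z : T0 -> borel D) :
    measurable_fun setT Z -> \int[Q]_w (- f (Z w)) = - \int[Q]_w f (Z w).
  move=> mZ; under eq_Rintegral do rewrite -mulN1r.
  rewrite (RintegralZl _ measurableT) ?mulN1r//; exact: integrable_comp_path fM.
apply: filterS2 h1 h2 => n; rewrite !EN// => h1 h2.
by rewrite ler_norml; apply/andP; split; lra.
Qed.

End weak_limit.

(** * The autoregressive recursion *)

Section iid_sequences.
Context d (T : measurableType d) (R : realType) (P : probability T R).

Lemma iid_row_comp (U : nat -> T -> R) (V : T -> R) (n : nat) (k : R -> R) :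
  measurable_fun setT k -> (forall i, measurable_fun setT (U i)) ->
  measurable_fun setT V -> product_rule P U n ->
  (forall i, (i < n)%N -> forall A, measurable A -> P (U i @^-1` A) = P (V @^-1` A)) ->
  exists2 mu : probability (measurableTypeR R) R,
    iid_row P (fun i w => k (U i w)) n mu &
    forall f : R -> R, measurable_fun setT f ->
      P.-integrable setT (EFin \o (fun w => f (k (V w)))) ->
      mu.-integrable setT (EFin \o f) /\ \int[mu]_x f x = \int[P]_w f (k (V w)).
Proof.
move=> mk mU mV Un UV.
have mkV : measurable_fun setT (fun w => (k (V w) : measurableTypeR R)).
  exact: (measurableT_comp mk mV).
pose mkV' := isMeasurableFun.Build _ _ _ _ _ mkV.
pose X : {mfun T >-> (measurableTypeR R)} :=
  HB.pack (fun w => (k (V w) : measurableTypeR R)) mkV'.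
have kA A : measurable A -> measurable (k @^-1` A : set (measurableTypeR R)).
  by move=> mA; have := mk measurableT _ mA; rewrite setTI.
exists (distribution P X); first split.
- by move=> i; exact: (measurableT_comp mk (mU i)).
- by move=> A mA; exact: (Un (fun i => k @^-1` A i) (fun i => kA _ (mA i))).
- by move=> i ip A mA; exact: (UV i ip _ (kA _ mA)).
- move=> f mf fi; have mf' : measurable_fun setT (EFin \o f) by exact/measurable_EFinP.
  by split; [exact: integrable_pushforward|rewrite /Rintegral integral_pushforward].
Qed.

Lemma Rintegral_ae_eq (f g : T -> R) (N : set T) :
  measurable_fun setT f -> measurable_fun setT g -> measurable N -> P N = 0%E ->
  (forall w, ~ N w -> f w = g w) -> \int[P]_w f w = \int[P]_w g w.
Proof.
move=> mf mg mN PN fg; congr fine; apply: ae_eq_integral => //.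
- exact/measurable_EFinP.
- exact/measurable_EFinP.
- exists N; split => // w /= /not_implyP[_ fgw]; apply: contrapT => Nw.
  by apply: fgw; rewrite fg.
Qed.

Variables (Z : nat -> T -> R) (s : nat -> T -> R) (h : R -> R).
Hypothesis mZ : forall i, measurable_fun setT (Z i).
Hypothesis prodZ : forall n, product_rule P Z n.
Hypothesis symZ : forall i A, measurable A ->
  P (Z i.+1 @^-1` A) = P ((fun w => - Z i.+1 w) @^-1` A).
Hypothesis idZ : forall i A, measurable A -> P (Z i.+1 @^-1` A) = P (Z 1%N @^-1` A).
Hypothesis s1 : forall i w, s i w = 1 \/ s i w = -1.
Hypothesis ms : forall i j, (i < j)%N ->
  measurable_fun (setT : set (g_sigma_algebraType (cylinder Z j))) (s i).

(* Conditionally on the past, a symmetric innovation multiplied by a predictable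
   sign has the same law as the innovation itself. *)
Lemma predictable_sign_iid n (A : nat -> set R) : (forall i, measurable (A i)) ->
  P (\bigcap_(i in `I_n) (fun w => Z i.+1 w * s i w) @^-1` A i) =
  (\prod_(i < n) P (Z 1%N @^-1` A i))%E.
Proof.
move=> mA; elim: n => [|n IH].
  by rewrite II0 bigcap_set0 big_ord0 probability_setT.
set E := \bigcap_(i in `I_n) _ in IH.
have -> : \bigcap_(i in `I_n.+1) (fun w => Z i.+1 w * s i w) @^-1` A i =
    E `&` (fun w => Z n.+1 w * s n w) @^-1` A n.
  apply/seteqP; split => w /=.
    by move=> hw; split => [i /= ip|]; apply: hw => //=; exact: ltnW.
  move=> [hw hn] i /=; rewrite ltnS leq_eqVlt => /predU1P[-> //|]; exact: hw.
(* This past is generated by Z 0, ..., Z n: it contains E and determines the sign s n. *)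
pose past := g_sigma_algebraType (cylinder Z n.+1).
have mE : measurable (E : set past).
  apply: fin_bigcap_measurable => // i /= ip.
  have mU : measurable_fun (setT : set past) (fun w => Z i.+1 w * s i w).
    by apply: measurable_funM; [exact: measurable_past|apply: ms; exact: ltnW].
  by rewrite -[_ @^-1` _]setTI; exact: mU.
pose S : set past := [set w | s n w = 1].
have mS : measurable S.
  have -> : S = s n @^-1` [set 1] by [].
  by rewrite -[_ @^-1` _]setTI; apply: (ms (ltnSn n)) => //; exact: measurable_set1.
have mES : measurable (E `&` S : set past) by exact: measurableI.
have mED : measurable (E `\` S : set past) by exact: measurableD.
have ind B C : measurable (B : set past) -> measurable C ->
    (P (B `&` Z n.+1 @^-1` C) = P B * P (Z n.+1 @^-1` C))%E.
  by move=> mB mC; apply: (past_independent mZ (prodZ n.+2)).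
have mAn : measurable ((fun x : R => - x) @^-1` A n).
  rewrite -[_ @^-1` _]setTI; exact: (oppr_measurable measurableT).
have pm B : measurable (B : set past) -> measurable (B : set T).
  exact: (past_measurable mZ).
have mZA C : measurable C -> measurable (Z n.+1 @^-1` C).
  by move=> mC; rewrite -[_ @^-1` _]setTI; exact: mZ.
(* Split according to the sign: off [S] the event concerns - Z n.+1, that is Z n.+1 and the
   reflected set, which has the same probability by symmetry. *)
set F := (_ @^-1` A n).
have -> : E `&` F = (E `&` S `&` Z n.+1 @^-1` A n) `|`
    ((E `\` S) `&` Z n.+1 @^-1` ((fun x : R => - x) @^-1` A n)).
  apply/seteqP; split => w /=; rewrite /F /S /=.
    move=> [Ew]; have [->|sw] := s1 n w; first by rewrite mulr1; left.
    rewrite sw mulrN1 => Aw; right; do 2?split => //.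
    by move=> /esym/eqP; rewrite -subr_eq0 opprK -mulr2n pnatr_eq0.
  case=> -[[Ew Sw] Aw]; split => //; first by rewrite Sw mulr1.
  by have [//|->] := s1 n w; rewrite mulrN1.
rewrite measureU//; last 3 first.
- by apply: measurableI; [exact: pm|exact: mZA].
- by apply: measurableI; [exact: pm|exact: mZA].
- by apply/seteqP; split => w //= -[[[_ Sw] _] [[_ nSw] _]].
have sym : P (Z n.+1 @^-1` ((fun x : R => - x) @^-1` A n)) = P (Z n.+1 @^-1` A n).
  rewrite symZ//; congr (P _).
  by apply/seteqP; split => w /=; rewrite opprK.
have e1 := ind _ _ mES (mA n).
have e2 := ind _ _ mED mAn; rewrite sym in e2.
transitivity (P (E `&` S) * P (Z n.+1 @^-1` A n) + P (E `\` S) * P (Z n.+1 @^-1` A n))%E.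
  by congr (_ + _)%E.
rewrite -ge0_muleDl// big_ord_recr/= -IH; congr (_ * _)%E; last exact: idZ.
have disj : E `&` S `&` (E `\` S) = set0.
  by apply/seteqP; split => w //= -[[_ Sw] [_]].
have := measureU P (pm _ mES) (pm _ mED) disj.
by rewrite setUIDK => ->.
Qed.

Lemma predictable_sign_law i (A : set R) : measurable A ->
  P ((fun w => Z i.+1 w * s i w) @^-1` A) = P (Z 1%N @^-1` A).
Proof.
move=> mA; pose B j : set R := if j == i then A else setT.
have mB j : measurable (B j) by rewrite /B; case: ifP.
have := predictable_sign_iid i.+1 mB.
rewrite (bigD1 (Ordinal (ltnSn i)))//= [X in (_ * X)%E]big1; last first.
  move=> j; rewrite -val_eqE/= /B => /negbTE ->.
  by rewrite preimage_setT probability_setT.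
rewrite mule1 {2}/B eqxx => <-; congr (P _).
apply/seteqP; split => w /=.
  by move=> Aw j _ /=; rewrite /B; case: eqP => // ->.
by move=> /(_ i (ltnSn i)); rewrite /= /B eqxx.
Qed.

Lemma predictable_sign_product_rule n :
  product_rule P (fun i w => Z i.+1 w * s i w) n.
Proof.
move=> A mA; rewrite predictable_sign_iid//.
by apply: eq_bigr => i _; rewrite predictable_sign_law.
Qed.

End iid_sequences.

Section prepend.
Context d (T : measurableType d) (R : realType) (P : probability T R).
Variables (y0 : T -> R) (eta : nat -> T -> R).

(** With [y0] at index 0, the initial value and the innovations form one independent sequence, whose
    first i + 1 terms determine y i. *)
Definition prepend (i : nat) : T -> R := if i is j.+1 then eta j.+1 else y0.

Lemma prepend_product_rule : 
  mutually_independent P (fun t => eta t.+1) ->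
  independent_of_family P y0 (fun t => eta t.+1) ->
  forall n, product_rule P prepend n.
Proof.
move=> ind ind0 [|n] A mA; first by rewrite II0 bigcap_set0 big_ord0 probability_setT.
pose E := \bigcap_(i in `I_n) eta i.+1 @^-1` A i.+1.
have -> : \bigcap_(i in `I_n.+1) prepend i @^-1` A i = y0 @^-1` A 0%N `&` E.
  apply/seteqP; split => w /=.
    by move=> hw; split => [|i /= ip]; [exact: (hw 0%N)|exact: (hw i.+1)].
  by move=> [h0 hE] [|i] //= ip; exact: hE.
rewrite ind0//; last first.
  pose G := \bigcup_i preimage_set_system setT (eta i.+1) measurable.
  suff : measurable (E : set (g_sigma_algebraType G)) by [].
  apply: fin_bigcap_measurable => // i _; apply: sub_sigma_algebra.
  by exists i => //; exists (A i.+1) => //; rewrite setTI.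
rewrite big_ord_recl; congr (_ * _)%E.
have := ind (iota 0 n) (fun i => A i.+1) (iota_uniq _ _) (fun i _ => mA i.+1).
rewrite (_ : [set` iota 0 n] = `I_n); last first.
  by apply/seteqP; split => i /=; rewrite mem_iota add0n.
move=> ->; rewrite -(big_mkord xpredT (fun i => P (prepend (bump 0 i) @^-1` A (bump 0 i)))).
by rewrite /index_iota subn0.
Qed.

End prepend.

Lemma measurable_zero_set d (T : measurableType d) (R : realType) (h : T -> R) :
  measurable_fun setT h -> measurable [set w | h w = 0].
Proof.
move=> mh; rewrite (_ : [set _ | _] = h @^-1` [set 0])//.
by rewrite -[_ @^-1` _]setTI; exact: (mh measurableT _ (measurable_set1 _)).
Qed.

(** * Moments of the logarithm *)

Section log_moments.
Context d (T : measurableType d) (R : realType) (P : probability T R).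
Variable V : T -> R.
Hypothesis mV : measurable_fun setT V.

Let logV (w : T) : \bar R := lne (`|V w|)%:E.

Let logVE w : logV w = if V w == 0 then -oo%E else (ln `|V w|)%:E.
Proof.
rewrite /logV; case: eqP => [->|/eqP V0]; first by rewrite normr0 le0_lneNy.
by rewrite lne_EFin// normr_gt0.
Qed.

Hypothesis var_fin : (evariance P logV < +oo)%E.

(** If the mean were infinite, every squared deviation would be +oo, also where the logarithm is -oo
    because there -oo plus +oo is -oo; the variance would then be infinite. *)
Let emean_fin : emean P logV \is a fin_num.
Proof.
apply: contraT => /negP mfin; exfalso; move: var_fin.
have mE : emean P logV = +oo%E \/ emean P logV = -oo%E.
  by move: mfin; case: (emean P logV) => [r| |] //=; [left|right].
have sqE w : ((logV w - emean P logV) ^+ 2 = +oo)%E.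
  by rewrite logVE; case: mE => ->; case: eqP.
rewrite /evariance; under eq_integral do rewrite sqE.
rewrite integral_cst//= -[P _]/(P setT) (_ : P setT = 1%E) ?mule1//.
exact: probability_setT.
Qed.

Let gamma := fine (emean P logV).

Let msq : measurable_fun setT (fun w => (ln `|V w| - gamma) ^+ 2).
Proof.
apply: measurable_funX; apply: measurable_funB => //.
apply: (measurableT_comp (@measurable_ln R)).
exact: measurableT_comp.
Qed.

Let sqE w : ((logV w - emean P logV) ^+ 2)%E =
  if V w == 0 then +oo%E else ((ln `|V w| - gamma) ^+ 2)%:E.
Proof.
rewrite logVE -(fineK emean_fin) -/gamma; case: eqP => _.
  by [].
by rewrite -EFinB -EFin_expe.
Qed.

Let meq0 : measurable_fun setT (fun w => V w == 0).
Proof. by apply: measurable_fun_eqr. Qed.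

Let mlog : measurable_fun setT (fun w => ln `|V w|).
Proof.
by apply: (measurableT_comp (@measurable_ln R)); exact: measurableT_comp.
Qed.

Let var_int : P.-integrable setT (fun w => (logV w - emean P logV) ^+ 2)%E.
Proof.
apply/integrableP; split.
  under eq_fun do rewrite sqE.
  by apply: measurable_fun_ifT => //; exact/measurable_EFinP.
by under eq_integral do rewrite gee0_abs ?sqre_ge0//.
Qed.

Let zero_set_measurable : measurable [set w | V w = 0].
Proof. exact: measurable_zero_set. Qed.

(** Where V vanishes the squared deviation is +oo, whereas an integrable function is finite almost
    everywhere. *)
Lemma log_zero_negligible : P [set w | V w = 0] = 0%E.
Proof.
have [N [mN PN sub]] := integrable_ae measurableT var_int.
apply/eqP; rewrite eq_le measure_ge0 andbT -PN; apply: le_measure; rewrite ?inE//.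
move=> w /= Vw; apply: sub => h; have := h I.
by rewrite -[X in X \is a fin_num]/((logV w - emean P logV) ^+ 2)%E sqE Vw eqxx.
Qed.

Lemma log_square_integral :
  (\int[P]_w ((ln `|V w| - gamma) ^+ 2)%:E = evariance P logV)%E.
Proof.
apply: ae_eq_integral => //.
- exact/measurable_EFinP.
- by have /integrableP[] := var_int.
- exists [set w | V w = 0]; split => //; first exact: log_zero_negligible.
  move=> w /= /not_implyP[_ h]; apply: contrapT => /eqP Vw; apply: h.
  by have := sqE w; rewrite (negbTE Vw) => h'; exact: (esym h').
Qed.

Lemma log_square_integrable :
  P.-integrable setT (EFin \o (fun w => (ln `|V w| - gamma) ^+ 2)).
Proof.
apply/integrableP; split; first exact/measurable_EFinP.
under eq_integral do rewrite /= ger0_norm ?sqr_ge0//.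
by rewrite log_square_integral.
Qed.

Lemma log_integrable : P.-integrable setT (EFin \o (fun w => ln `|V w| - gamma)).
Proof.
have i2 : P.-integrable setT (EFin \o (fun w => 1 + (ln `|V w| - gamma) ^+ 2)).
  apply: integrable_rD log_square_integrable.
  by apply: (@integrable_bounded _ _ _ _ _ 1) => // w; rewrite normr1.
apply: (le_integrable measurableT _ _ i2).
  by apply/measurable_EFinP; exact: measurable_funB.
move=> w _ /=; rewrite lee_fin [leRHS]ger0_norm; last by rewrite addr_ge0// sqr_ge0.
set x := ln _ - _; rewrite -[x ^+ 2]real_normK ?num_real//.
have := sqr_ge0 (`|x| - 1); rewrite sqrrB1; have := normr_ge0 x; nra.
Qed.

Lemma log_centered : \int[P]_w (ln `|V w| - gamma) = 0.
Proof.
have ic : P.-integrable setT (EFin \o (fun _ : T => gamma)).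
  by apply: (@integrable_bounded _ _ _ _ _ `|gamma|).
have i3 : P.-integrable setT (EFin \o (fun w => ln `|V w|)).
  by have := integrable_rD log_integrable ic; under eq_fun do rewrite /= subrK.
rewrite (RintegralB measurableT i3 ic) Rintegral_prob_cst.
apply/eqP; rewrite subr_eq0; apply/eqP; rewrite /gamma /emean /Rintegral; congr fine.
apply: ae_eq_integral => //.
- exact/measurable_EFinP.
- change (measurable_fun setT logV); rewrite (funext logVE).
  by apply: measurable_fun_ifT => //; exact/measurable_EFinP.
- exists [set w | V w = 0]; split => //; first exact: log_zero_negligible.
  move=> w /= /not_implyP[_ h]; apply: contrapT => /eqP Vw; apply: h.
  by have := logVE w; rewrite (negbTE Vw) => h'; exact: (esym h').
Qed.

End log_moments.

Section moment_limits.
Context {R : realType}.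

Lemma centeredW (mu : probability (measurableTypeR R) R) (v rho rho' : R) :
  rho <= rho' -> centered mu v rho -> centered mu v rho'.
Proof. by move=> rr [h1 h2 h3 h4]; split => //; exact: le_trans rr. Qed.

(** Dominated convergence: n psi (x / sqrt n) is at most x^2 by [psi_le2], and at most x^4 / n by
    [psi_le4]. *)
Lemma psi_scaled_cvg d (T : measurableType d) (P : probability T R) (f : T -> R) :
  measurable_fun setT f -> P.-integrable setT (EFin \o (fun w => f w ^+ 2)) ->
  n%:R * \int[P]_w psi (f w / Num.sqrt n%:R) @[n --> \oo] --> (0 : R).
Proof.
move=> mf if2.
have scaleE n x : n%:R * psi (x / Num.sqrt n%:R) <= x ^+ 2 :> R.
  case: n => [|n]; first by rewrite mul0r sqr_ge0.
  have s0 : 0 < Num.sqrt n.+1%:R :> R by rewrite sqrtr_gt0 ltr0n.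
  rewrite -[X in X * _]sqr_sqrtr ?ler0n//.
  apply: (@le_trans _ _ (Num.sqrt n.+1%:R ^+ 2 * (x / Num.sqrt n.+1%:R) ^+ 2)).
    by rewrite ler_wpM2l ?sqr_ge0// psi_le2.
  by rewrite -exprMn mulrC divfK// gt_eqF.
have mpsi n : measurable_fun setT (fun w => psi (f w / Num.sqrt n%:R)).
  apply: (measurableT_comp measurable_psi); exact: measurable_funM.
have E n : n%:R * \int[P]_w psi (f w / Num.sqrt n%:R) =
    \int[P]_w (n%:R * psi (f w / Num.sqrt n%:R)).
  rewrite RintegralZl//; case: n => [|n].
    apply: (@integrable_bounded _ _ _ _ _ 0) => // w.
    by rewrite sqrtr0 invr0 mulr0 /psi expr0n/= mul0r normr0.
  apply: (le_integrable measurableT _ _ if2); first exact/measurable_EFinP.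
  move=> w _ /=; rewrite lee_fin !ger0_norm ?psi_ge0 ?sqr_ge0//.
  apply: le_trans (scaleE n.+1 (f w)).
  by rewrite ler_peMl ?psi_ge0// ler1n.
rewrite (funext E) -[X in _ --> X](_ : \int[P]_w (0 : R) = 0); last exact: Rintegral_prob_cst.
apply: fine_cvg; rewrite fineK; last by rewrite integral_prob_cst.
apply: (@dominated_cvg _ _ _ P setT measurableT
  (fun n w => (n%:R * psi (f w / Num.sqrt n%:R))%:E) (fun=> 0%:E)
  (fun w => (f w ^+ 2)%:E)) => //.
- by move=> n; apply/measurable_EFinP; exact: measurable_funM.
- move=> w _; apply: cvg_EFin; first by near=> n.
  set x := f w.
  apply: (@squeeze_cvgr _ _ _ _ (fun=> 0) (fun n : nat => x ^+ 4 * (n%:R : R)^-1)).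
  + near=> n.
    have n0 : (0 < n)%N by near: n; exact: nbhs_infty_gt.
    have nR : 0 < n%:R :> R by rewrite ltr0n.
    rewrite mulr_ge0 ?psi_ge0//=.
    apply: (@le_trans _ _ (n%:R * (x / Num.sqrt n%:R) ^+ 4)).
      by rewrite ler_wpM2l// psi_le4.
    rewrite expr_div_n -[4%N]/((2 * 2)%N) !exprM sqr_sqrtr// mulrCA ler_wpM2l ?sqr_ge0//.
    by rewrite expr2 invfM mulVKf// gt_eqF.
  + exact: cvg_cst.
  + rewrite -(mulr0 (x ^+ 4)); apply: cvgM; first exact: cvg_cst.
    have h := @cvg_harmonic R.
    by rewrite -(cvg_shiftS (fun n : nat => (n%:R : R)^-1)).
- move=> n w _ /=; rewrite lee_fin ger0_norm; [exact: scaleE|by rewrite mulr_ge0 ?psi_ge0].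
Unshelve. all: by end_near. Qed.

End moment_limits.

Section ar_recursion.
Context d (T : measurableType d) (R : realType).
Variables (phi0 alpha0 : R) (eta : nat -> T -> R) (y0 : T -> R).
Hypothesis a0 : 0 < alpha0.

Local Notation y := (ar_path phi0 alpha0 eta y0).

(** The value at 0 is 1, so that the sign is always 1 or -1, as the invariance of symmetric laws
    requires. *)
Definition ar_sign (i : nat) (w : T) : R := if 0 <= y i w then 1 else -1.

Definition ar_factor (i : nat) (w : T) : R :=
  phi0 + eta i.+1 w * ar_sign i w * Num.sqrt alpha0.

Lemma ar_sign_cases i w : ar_sign i w = 1 \/ ar_sign i w = -1.
Proof. by rewrite /ar_sign; case: ifP; [left|right]. Qed.

Lemma ar_pathS i w : y i.+1 w = y i w * ar_factor i w.
Proof.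
rewrite /= sqrtrM ?(ltW a0)// sqrtr_sqr /ar_factor /ar_sign.
have [y0'|y0'] := leP 0 (y i w).
  by rewrite ger0_norm//; ring.
by rewrite ltr0_norm//; ring.
Qed.

Lemma ar_path_ln i w : y0 w != 0 -> (forall j, (j < i)%N -> ar_factor j w != 0) ->
  y i w != 0 /\
  ln `|y i w| = ln `|y0 w| + \sum_(0 <= j < i) ln `|ar_factor j w|.
Proof.
move=> y00; elim: i => [|i IH] fi; first by rewrite big_geq// addr0.
have [yi yE] := IH (fun j ji => fi j (ltnW ji)).
have fi' := fi i (ltnSn i).
rewrite ar_pathS mulf_neq0//; split => //.
by rewrite normrM lnM ?posrE ?normr_gt0// yE big_nat_recr//= addrA.
Qed.

Local Notation Z := (prepend y0 eta).
Local Notation past j := (g_sigma_algebraType (cylinder Z j)).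

Lemma measurable_ar_path i j : (i < j)%N -> measurable_fun (setT : set (past j)) (y i).
Proof.
elim: i => [|i IH] ij; first exact: (@measurable_past _ _ _ Z 0%N j ij).
have my := IH (ltnW ij).
have me := @measurable_past _ _ _ Z i.+1 j ij.
apply: measurable_funD; first exact: measurable_funM.
apply: measurable_funM; first exact: me.
have -> : (fun w => Num.sqrt (alpha0 * y i w ^+ 2)) =
    (fun w => Num.sqrt alpha0 * `|y i w|).
  by apply/funext => w; rewrite sqrtrM ?(ltW a0)// sqrtr_sqr.
by apply: measurable_funM => //; exact: measurableT_comp.
Qed.

Lemma measurable_ar_sign i j : (i < j)%N ->
  measurable_fun (setT : set (past j)) (ar_sign i).
Proof.
move=> ij; apply: measurable_fun_ifT => //.
by apply: measurable_fun_ler => //; exact: measurable_ar_path.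
Qed.

End ar_recursion.

(** * The limit theorem *)

Section brownian_rows.
Context d' (T' : measurableType d') (R : realType) (P' : probability T' R).
Variable B : R -> {RV P' >-> R}.
Hypothesis BM : standard_brownian_motion B.

(** The increments over the grid have variance 1 / n, and the fourth moment of the normal law gives
    the last parameter; n times it is of order 1 / n. *)
Lemma brownian_row (sigma : R) (n : nat) : (0 < n)%N ->
  exists2 nu : probability (measurableTypeR R) R,
    iid_row P' (fun i w => sigma * (B (i.+1%:R / n%:R) w - B (i%:R / n%:R) w)) n nu &
    centered nu (sigma ^+ 2 / n%:R) (64 * sigma ^+ 4 / n%:R ^+ 2).
Proof.
move=> n0; have nR : 0 < n%:R :> R by rewrite ltr0n.
pose s : R := Num.sqrt n%:R^-1.
have s0 : 0 < s by rewrite sqrtr_gt0 invr_gt0.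
have s2 : s ^+ 2 = n%:R^-1 by rewrite sqr_sqrtr// invr_ge0 ltW.
have [nu [nuE ctnu]] := scaled_normal_centered s0 sigma.
exists nu; last first.
  have s4 : s ^+ 4 = (n%:R ^+ 2)^-1 by rewrite -[4%N]/((2 * 2)%N) exprM s2 exprVn.
  by rewrite s2 s4 in ctnu.
have minc i : measurable_fun setT (fun w => B (i.+1%:R / n%:R) w - B (i%:R / n%:R) w).
  by apply: measurable_funB; exact: measurable_funP.
have ksc A : measurable A -> measurable ((fun x : R => sigma * x) @^-1` A).
  move=> mA; rewrite -[_ @^-1` _]setTI.
  have msc : measurable_fun setT (fun x : R => sigma * x) by exact: measurable_funM.
  exact: msc.
split.
- by move=> i; apply: measurable_funM.
- move=> A mA; pose A' (i : 'I_n) : set R := (fun x : R => sigma * x) @^-1` A i.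
  have t0 : 0 <= (0%:R / n%:R : R) by rewrite mul0r.
  have tS i : (i < n)%N -> i%:R / n%:R <= i.+1%:R / n%:R :> R.
    by move=> ip; rewrite ler_pM2r ?invr_gt0// ler_nat.
  have t1 : n%:R / n%:R <= 1 :> R by rewrite divff// gt_eqF.
  have := bm_independent_increments BM (k := n) (t := fun i => i%:R / n%:R) t0 tS t1
    (A := A') (enum_uniq 'I_n) (fun i _ => ksc _ (mA i)).
  rewrite big_enum/= => <-; congr (P' _).
  apply/seteqP; split => w /=; first by move=> hw i _; exact: (hw i (ltn_ord i)).
  by move=> hw i ip; apply: (hw (Ordinal ip)); rewrite /= mem_enum.
- move=> i ip A mA; rewrite nuE//.
  have u0 : 0 <= i%:R / n%:R :> R by rewrite divr_ge0.
  have u1 : i%:R / n%:R < i.+1%:R / n%:R :> R.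
    by rewrite ltr_pM2r ?invr_gt0// ltr_nat.
  have u2 : i.+1%:R / n%:R <= 1 :> R by rewrite ler_pdivrMr// mul1r ler_nat.
  have u3 : i.+1%:R / n%:R - i%:R / n%:R = n%:R^-1 :> R.
    by rewrite -mulrBl -natrB// subSnn mul1r.
  have := bm_gaussian_increments BM u0 u1 u2 (ksc _ mA).
  by rewrite u3; exact: etrans.
Qed.

End brownian_rows.

Lemma natV_cvg (R : realType) : (n%:R : R)^-1 @[n --> \oo] --> (0 : R).
Proof.
by rewrite -(cvg_shiftS (fun n : nat => (n%:R : R)^-1)); exact: (@cvg_harmonic R).
Qed.

Lemma sqrt_natV_cvg (R : realType) : (Num.sqrt n%:R : R)^-1 @[n --> \oo] --> (0 : R).
Proof.
have E (n : nat) : (Num.sqrt n%:R : R)^-1 = Num.sqrt (n%:R^-1) by rewrite sqrtrV.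
rewrite (funext E) -[X in _ --> X](sqrtr0 R).
apply: (@continuous_cvg _ _ _ _ _ _ (@Num.sqrt R)); last exact: natV_cvg.
exact: sqrt_continuous.
Qed.

(** * Donsker's theorem in the Skorokhod space *)

Section donsker.
Context d (T : measurableType d) d' (T' : measurableType d') (R : realType)
  (P : probability T R) (P' : probability T' R).
Local Notation D := (skorokhod R).
Variables (l0 : T -> R) (xi : nat -> T -> R) (gamma V : R) (rho : nat -> R)
  (B : R -> {RV P' >-> R}).
Hypothesis ml0 : measurable_fun setT l0.
Hypothesis mxi : forall i, measurable_fun setT (xi i).
Hypothesis V0 : 0 <= V.
Hypothesis rows : forall n, (0 < n)%N -> exists2 mu : probability (measurableTypeR R) R,
  iid_row P (fun i w => (xi i w - gamma) / Num.sqrt n%:R) n mu &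
  centered mu (V / n%:R) (rho n).
Hypothesis rho_cvg : n%:R * rho n @[n --> \oo] --> (0 : R).
Hypothesis BM : standard_brownian_motion B.

Let sigma := Num.sqrt V.

Lemma continuous_drift (r : R) : continuous (fun s : R => - (s * gamma * r)).
Proof.
move=> s; apply: cvgN; apply: cvgM; last exact: cvg_cst.
by apply: cvgM; [exact: cvg_id|exact: cvg_cst].
Qed.

Let one_cont : continuous (fun _ : R => 1 : R) := fun x => cvg_cst _.
Let zero_cont : continuous (fun _ : R => 0 : R) := fun x => cvg_cst _.

(** The centering is continuous in s instead of being sampled at [ns] / n, and the initial value
    [l0] is kept: the exponential of this path is then exactly the process of the theorem, off a
    null set. *)
Definition log_path (n : nat) (w : T) : borel D :=
  affine_path n one_cont (@continuous_drift (Num.sqrt n%:R))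
    (fun i => (l0 w + \sum_(0 <= j < i) xi j w) / Num.sqrt n%:R).

Lemma scaled_continuous w : {within `[0, 1], continuous (fun s => sigma * B s w)}.
Proof.
move=> x; apply: cvgM; first exact: cvg_cst.
exact: (@bm_continuous _ _ _ _ _ BM w x).
Qed.

Definition brownian_path (w : T') : borel D := continuous_path (@scaled_continuous w).

Let one_bound (t : R) : t \in `[0, 1] -> `|1 : R| <= 1.
Proof. by rewrite normr1. Qed.

Lemma measurable_log_path n : measurable_fun setT (log_path n).
Proof.
apply: (measurable_affine_path n one_cont (@continuous_drift (Num.sqrt n%:R))
  (V := fun i w => (l0 w + \sum_(0 <= j < i) xi j w) / Num.sqrt n%:R) one_bound) => i.
apply: measurable_funM => //; apply: measurable_funD => //.
by apply: measurable_sum_seq => j _; exact: mxi.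
Qed.

Let brownian_step n w : D := affine_path n one_cont zero_cont
  (fun i => sigma * B (i%:R / n%:R) w).

Let measurable_brownian_step n : measurable_fun setT (brownian_step n : T' -> borel D).
Proof.
apply: (measurable_affine_path n one_cont zero_cont
  (V := fun i w => sigma * B (i%:R / n%:R) w) one_bound) => i.
by apply: measurable_funM => //; exact: measurable_funP.
Qed.

Let brownian_step_cvg w :
  mdist (brownian_step n w) (brownian_path w : D) @[n --> \oo] --> (0 : R).
Proof.
exact: (continuous_path_step (@scaled_continuous w) one_cont zero_cont).
Qed.

Lemma measurable_brownian_path : measurable_fun setT brownian_path.
Proof. exact: measurable_skorokhod_limit measurable_brownian_step brownian_step_cvg. Qed.

Section lipschitz_functional.
Variables (f : D -> R) (C : R).
Hypothesis fC : forall x, `|f x| <= C.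
Hypothesis fK : forall x y, `|f x - f y| <= C * mdist x y.

Let C0 : 0 <= C.
Proof. exact: le_trans (normr_ge0 _) (fC point). Qed.

Let cf : continuous f := lipschitz_skorokhod_continuous fK.

Let F n (v : nat -> R) : R := f (affine_path n one_cont zero_cont v).

Let F_lipschitz n : sup_lipschitz n C (F n).
Proof.
split=> [v|v v' e e0 vv']; first exact: fC.
apply: le_trans (fK _ _) _; rewrite ler_wpM2l// -[leRHS]mulr1.
exact: affine_path_dist one_bound e0 vv'.
Qed.

Let walk n := partial_sum (fun i (w : T) => (xi i w - gamma) / Num.sqrt n%:R).

Let bwalk n := partial_sum (fun i (w : T') =>
  sigma * (B (i.+1%:R / n%:R) w - B (i%:R / n%:R) w)).

Let walk_measurable n i : measurable_fun setT (walk n i).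
Proof.
apply: measurable_sum_seq => j _; apply: measurable_funM => //.
exact: measurable_funB.
Qed.

(** Against the centered partial sums, only the initial value and the rounding of n t remain; the
    latter is less than 1 and is multiplied by gamma. *)
Let log_path_near n w : (0 < n)%N ->
  mdist (log_path n w : D) (affine_path n one_cont zero_cont (fun i => walk n i w)) <=
  (`|l0 w| + `|gamma|) / Num.sqrt n%:R.
Proof.
move=> n0; have nR : 0 < n%:R :> R by rewrite ltr0n.
have s0 : 0 < Num.sqrt n%:R :> R by rewrite sqrtr_gt0.
apply: skorokhod_dist_uniform => t t01 /=.
rewrite /affine_fun t01 !mulr1 addr0 /walk /partial_sum.
set k := Num.truncn _.
have nt0 : 0 <= n%:R * t by move: t01; rewrite in_itv/= => /andP[t0 _]; rewrite mulr_ge0.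
have /andP[h1 h2] := truncn_itv nt0; rewrite -/k in h1 h2.
have -> : \sum_(0 <= j < k) (xi j w - gamma) / Num.sqrt n%:R =
    (\sum_(0 <= j < k) xi j w - k%:R * gamma) / Num.sqrt n%:R.
  by rewrite -mulr_suml sumrB sumr_const_nat subn0 mulr_natl.
have -> : t * gamma * Num.sqrt n%:R = n%:R * t * gamma / Num.sqrt n%:R.
  by rewrite -[X in X * t](sqr_sqrtr (ltW nR)); field; rewrite gt_eqF.
rewrite (_ : _ - _ = (l0 w + (k%:R - n%:R * t) * gamma) / Num.sqrt n%:R); last by ring.
rewrite normrM [`|_^-1|]ger0_norm ?invr_ge0 ?(ltW s0)//.
rewrite ler_wpM2r ?invr_ge0 ?(ltW s0)//.
apply: le_trans (ler_normD _ _) _; rewrite lerD2l normrM ler_piMl//.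
rewrite distrC ger0_norm ?subr_ge0//.
by rewrite lerBlDr addrC natr1 ltW.
Qed.

(** The distance to the centered walk depends on w through [l0], so it vanishes pointwise only, and
    bounded convergence takes over. *)
Let log_path_limit :
  \int[P]_w f (log_path n w) - \int[P]_w F n (fun i => walk n i w) @[n --> \oo] --> (0 : R).
Proof.
have mF n : measurable_fun setT (fun w => F n (fun i => walk n i w)).
  by apply: (measurable_sup_lipschitz (F_lipschitz n)) => i _; exact: walk_measurable.
have mfl n : measurable_fun setT (fun w => f (log_path n w)).
  exact: (measurable_comp_path (measurable_log_path n) cf).
have E n : \int[P]_w f (log_path n w) - \int[P]_w F n (fun i => walk n i w) =
    \int[P]_w (f (log_path n w) - F n (fun i => walk n i w)).
  rewrite RintegralB//.
    by apply: (integrable_bounded P (mfl n)) => w; exact: fC.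
  by apply: (integrable_bounded P (mF n)) => w; exact: fC.
rewrite (funext E) -[X in _ --> X](Rintegral_prob_cst P).
apply: (@bounded_convergence _ _ _ P _ _ (C + C)) => //.
- by move=> n; exact: measurable_funB.
- by by move=> n w; apply: le_trans (ler_normB _ _) _; exact: lerD (fC _) (fC _).
- move=> w; apply/norm_cvg0P.
  apply: (@squeeze_cvgr _ _ _ _ (fun=> 0)
    (fun n : nat => C * (`|l0 w| + `|gamma|) * (Num.sqrt n%:R)^-1)).
  + near=> n; rewrite normr_ge0/=; apply: le_trans (fK _ _) _.
    rewrite -mulrA ler_wpM2l//; apply: log_path_near.
    by near: n; exact: nbhs_infty_gt.
  + exact: cvg_cst.
  + rewrite -(mulr0 (C * (`|l0 w| + `|gamma|))); apply: cvgM; first exact: cvg_cst.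
    exact: sqrt_natV_cvg.
Unshelve. all: by end_near. Qed.

Let brownian_walk_limit :
  \int[P']_w F n (fun i => bwalk n i w) @[n --> \oo] --> \int[P']_w f (brownian_path w).
Proof.
have lim : \int[P']_w f (brownian_step n w) @[n --> \oo] --> \int[P']_w f (brownian_path w).
  apply: (@bounded_convergence _ _ _ P' _ _ C) => //.
  - by move=> n; exact: (measurable_comp_path (measurable_brownian_step n) cf).
  - exact: (measurable_comp_path measurable_brownian_path cf).
  - move=> w; apply/cvgrPdist_lt => e e0.
    have [r r0 hr] := continuous_skorokhodP cf (brownian_path w : D) e0.
    have /cvgrPdist_lt/(_ r r0) := brownian_step_cvg w.
    apply: filterS => n; rewrite sub0r normrN ger0_norm ?mdist_ge0// metric_sym.
    exact: hr.
apply: cvg_trans lim; apply: near_eq_cvg; near=> n.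
have n0 : (0 < n)%N by near: n; exact: nbhs_infty_gt.
(* B starts at 0 only almost surely, so the telescoped increments equal the sampled path off this
   null set. *)
have mB0 : measurable [set w | B 0 w != 0].
  have m0 : measurable_fun setT (fun w => B 0 w == 0).
    by apply: measurable_fun_eqr => //; exact: measurable_funP.
  have := m0 measurableT _ (I : measurable [set false]); rewrite setTI.
  by congr measurable; apply/seteqP; split => w /=; case: eqP.
apply: (Rintegral_ae_eq (N := [set w | B 0 w != 0])) => //.
- exact: (measurable_comp_path (measurable_brownian_step n) cf).
- apply: (measurable_sup_lipschitz (F_lipschitz n)) => i _.
  apply: measurable_sum_seq => j _; apply: measurable_funM => //.
  by apply: measurable_funB; exact: measurable_funP.
- have -> : [set w | B 0 w != 0] = ~` [set w | B 0 w = 0].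
    by apply/seteqP; split => w /= /eqP.
  rewrite probability_setC ?(bm_start BM) ?subee//.
  have := measurableC mB0; congr measurable.
  by apply/seteqP; split => w /=; [move/negP; rewrite negbK => /eqP|move=> ->; rewrite eqxx].
- move=> w /negP; rewrite negbK => /eqP B0; congr f.
  apply: skorokhod_eq => t t01 /=; rewrite /affine_fun t01 !mulr1 !addr0.
  rewrite /bwalk /partial_sum -mulr_sumr telescope_sumr//.
  by rewrite mul0r B0 subr0.
Unshelve. all: by end_near. Qed.

Lemma log_path_lipschitz_limit :
  \int[P]_w f (log_path n w) @[n --> \oo] --> \int[P']_w f (brownian_path w).
Proof.
have inv : \int[P]_w F n (fun i => walk n i w) - \int[P']_w F n (fun i => bwalk n i w)
    @[n --> \oo] --> (0 : R).
  apply/cvgrPdist_le => eta eta0.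
  have [N [r r0 HN]] := @invariance R C V eta V0 eta0.
  have rho4 : (64 * V ^+ 2 / n%:R : R) @[n --> \oo] --> (0 : R).
    by rewrite -(mulr0 (64 * V ^+ 2)); apply: cvgM; [exact: cvg_cst|exact: natV_cvg].
  near=> n.
  have n0 : (0 < n)%N by near: n; exact: nbhs_infty_gt.
  have nR : 0 < n%:R :> R by rewrite ltr0n.
  have [mu rmu cmu] := rows n0.
  have [nu rnu cnu] := brownian_row BM sigma n0.
  have sV : sigma ^+ 2 = V by rewrite sqr_sqrtr.
  have sV4 : sigma ^+ 4 = V ^+ 2 by rewrite -sV -exprM.
  rewrite sV sV4 in cnu.
  (* [invariance] asks for a common bound for both laws. *)
  pose rho' := Num.max (rho n) (64 * V ^+ 2 / n%:R ^+ 2).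
  have cmu' : centered mu (V / n%:R) rho' by apply: centeredW cmu; rewrite le_max lexx.
  have cnu' : centered nu (V / n%:R) rho' by apply: centeredW cnu; rewrite le_max lexx orbT.
  rewrite sub0r normrN.
  apply: (HN _ _ P _ _ _ P' _ mu nu n (V / n%:R) rho') => //.
  - by near: n; exact: nbhs_infty_ge.
  - by rewrite mulrC divfK// gt_eqF.
  - rewrite /rho' maxr_pMr ?(ltW nR)// ge_max; apply/andP; split.
      apply: le_trans (ler_norm _) _.
      by near: n; move/cvgrPdist_le : rho_cvg => /(_ r r0); apply: filterS => n; rewrite sub0r normrN.
    rewrite (_ : n%:R * _ = 64 * V ^+ 2 / n%:R); last by field; rewrite gt_eqF.
    apply: le_trans (ler_norm _) _.
    by near: n; move/cvgrPdist_le : rho4 => /(_ r r0); apply: filterS => n; rewrite sub0r normrN.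
(* The three limits add up: logarithmic path to centered walk, centered walk to Brownian walk,
   Brownian walk to Brownian path. *)
have lim := cvgD (cvgD log_path_limit inv) brownian_walk_limit.
rewrite addr0 add0r in lim; have {}lim := lim eventually_filter eventually_filter.
apply: (cvg_trans _ lim); apply: near_eq_cvg; near=> n.
by rewrite !fctE; ring.
Unshelve. all: by end_near. Qed.

End lipschitz_functional.

Lemma donsker (f : D -> R) (M : R) : continuous f -> (forall x, `|f x| <= M) ->
  \int[P]_w f (log_path n w) @[n --> \oo] --> \int[P']_w f (brownian_path w).
Proof.
apply: weak_limit_lipschitz.
- exact: measurable_log_path.
- exact: measurable_brownian_path.
- exact: log_path_lipschitz_limit.
Qed.

End donsker.

(** * Application to the autoregressive process *)

Section log_rows.
Context d (T : measurableType d) (R : realType) (P : probability T R).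

(** U will be the sign-corrected innovations and E the first innovation: the moments of the row are
    those of log |phi + E a|, the only ones that the assumptions control. *)
Lemma log_row (U : nat -> T -> R) (E : T -> R) (phi a : R) (n : nat) :
  let logE := fun w => lne (`|phi + E w * a|)%:E in
  let gamma := fine (emean P logE) in
  (forall i, measurable_fun setT (U i)) -> measurable_fun setT E ->
  product_rule P U n ->
  (forall i, (i < n)%N -> forall A, measurable A -> P (U i @^-1` A) = P (E @^-1` A)) ->
  (evariance P logE < +oo)%E -> (0 < n)%N ->
  exists2 mu : probability (measurableTypeR R) R,
    iid_row P (fun i w => (ln `|phi + U i w * a| - gamma) / Num.sqrt n%:R) n mu &
    centered mu (fine (evariance P logE) / n%:R)
      (\int[P]_w psi ((ln `|phi + E w * a| - gamma) / Num.sqrt n%:R)).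
Proof.
move=> logE gamma mU mE Un UE var n0; have nR : 0 < n%:R :> R by rewrite ltr0n.
pose k (x : R) : R := (ln `|phi + x * a| - gamma) / Num.sqrt n%:R.
have mk : measurable_fun setT k.
  apply: measurable_funM => //; apply: measurable_funB => //.
  apply: (measurableT_comp (@measurable_ln R)); apply: measurableT_comp => //.
  by apply: measurable_funD => //; exact: measurable_funM.
have mV : measurable_fun setT (fun w => phi + E w * a).
  by apply: measurable_funD => //; exact: measurable_funM.
have [mu rmu muE] := iid_row_comp mk mU mE Un UE.
exists mu => //.
have i1 : P.-integrable setT (EFin \o (fun w => k (E w))).
  have := integrable_rZ (Num.sqrt n%:R)^-1 (log_integrable mV var).
  by congr integrable; apply/funext => w /=; rewrite /k mulrC.
have sqE w : k (E w) ^+ 2 = n%:R^-1 * (ln `|phi + E w * a| - gamma) ^+ 2.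
  by rewrite /k expr_div_n sqr_sqrtr ?(ltW nR)// mulrC.
have i2 : P.-integrable setT (EFin \o (fun w => k (E w) ^+ 2)).
  have := integrable_rZ n%:R^-1 (log_square_integrable mV var).
  by congr integrable; apply/funext => w /=; rewrite sqE.
have mkE : measurable_fun setT (fun w => k (E w)) by exact: measurableT_comp mk mE.
have ip : P.-integrable setT (EFin \o (fun w => psi (k (E w)))).
  apply: (le_integrable measurableT _ _ i2).
    by apply/measurable_EFinP; exact: measurableT_comp measurable_psi mkE.
  by move=> w _ /=; rewrite lee_fin !ger0_norm ?psi_ge0 ?sqr_ge0// psi_le2.
have msq : measurable_fun setT (fun x : R => x ^+ 2) by exact: measurable_funX.
have [_ m1] := muE id (@measurable_id _ _ _) i1.
have [s1 s2] := muE _ msq i2.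
have [_ p2] := muE _ measurable_psi ip.
split => //.
- rewrite m1 /k; under eq_Rintegral do rewrite mulrC.
  rewrite RintegralZl//; last exact: (log_integrable mV var).
  by rewrite (log_centered mV var) mulr0.
- rewrite s2; under eq_Rintegral do rewrite sqE.
  rewrite RintegralZl//; last exact: (log_square_integrable mV var).
  by rewrite /Rintegral (log_square_integral mV var) mulrC.
- by rewrite p2.
Qed.

End log_rows.

Lemma expectation_Rintegral d (T : measurableType d) (R : realType)
    (P : probability T R) (h : T -> R) :
  P.-integrable setT (EFin \o h) -> ('E_P[h] = (\int[P]_w h w)%:E)%E.
Proof. by move=> hi; rewrite unlock /Rintegral fineK// integrable_fin_num. Qed.

Section ar_limit.
Context d (T : measurableType d) d' (T' : measurableType d') (R : realType)
  (P : probability T R) (P' : probability T' R).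
Variables (phi0 alpha0 : R) (eta : nat -> {RV P >-> R}) (y0 : {RV P >-> R})
  (B : R -> {RV P' >-> R}).
Local Notation D := (skorokhod R).
Local Notation etaf := (fun t => eta t : T -> R).
Local Notation y := (ar_path phi0 alpha0 etaf y0).
Local Notation factor := (ar_factor phi0 alpha0 etaf y0).
Local Notation logZ := (fun w : T => lne (`|phi0 + eta 1%N w * Num.sqrt alpha0|)%:E).
Hypothesis a0 : 0 < alpha0.
Hypothesis ind : mutually_independent P (fun t => eta t.+1 : T -> R).
Hypothesis ide : forall t, (1 <= t)%N -> identically_distributed P (eta t) (eta 1%N).
Hypothesis sym : forall t, (1 <= t)%N -> symmetric_rv P (eta t).
Hypothesis var_fin : (evariance P logZ < +oo)%E.
Hypothesis y0_neq0 : P [set w | y0 w = 0] = 0%E.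
Hypothesis ind0 : independent_of_family P y0 (fun t => eta t.+1 : T -> R).
Hypothesis BM : standard_brownian_motion B.

Let Z := prepend y0 etaf.
Let gamma0 := fine (emean P logZ).
Let V := fine (evariance P logZ).

Let mZ i : measurable_fun setT (Z i).
Proof. by case: i => [|i]; exact: measurable_funP. Qed.

Let prodZ n : product_rule P Z n.
Proof. exact: prepend_product_rule. Qed.

Let symZ i A : measurable A -> P (Z i.+1 @^-1` A) = P ((fun w => - Z i.+1 w) @^-1` A).
Proof. exact: (sym (ltn0Sn i)). Qed.

Let idZ i A : measurable A -> P (Z i.+1 @^-1` A) = P (Z 1%N @^-1` A).
Proof. exact: (ide (ltn0Sn i)). Qed.

Let s := ar_sign phi0 alpha0 etaf y0.

Let ms i j : (i < j)%N ->
  measurable_fun (setT : set (g_sigma_algebraType (cylinder Z j))) (s i).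
Proof. exact: measurable_ar_sign. Qed.

Let U i w := Z i.+1 w * s i w.

Let measurable_from_past (h : T -> R) j :
  measurable_fun (setT : set (g_sigma_algebraType (cylinder Z j))) h ->
  measurable_fun setT h.
Proof. by move=> mh _ A mA; exact: (past_measurable mZ (mh measurableT A mA)). Qed.

Let my i : measurable_fun setT (y i).
Proof. exact: (measurable_from_past (measurable_ar_path (eta := etaf) (y0 := y0) phi0 a0 (ltnSn i))). Qed.

Let mU i : measurable_fun setT (U i).
Proof.
apply: measurable_funM; first exact: mZ.
exact: (measurable_from_past (ms (ltnSn i))).
Qed.

Let s1 i w : s i w = 1 \/ s i w = -1.
Proof. exact: ar_sign_cases. Qed.

Let lawU i A : measurable A -> P (U i @^-1` A) = P (eta 1%N @^-1` A).
Proof. exact: (predictable_sign_law mZ prodZ symZ idZ s1 ms). Qed.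

Let prodU n : product_rule P U n.
Proof. exact: (predictable_sign_product_rule mZ prodZ symZ idZ s1 ms). Qed.

Let mfactor i : measurable_fun setT (factor i).
Proof.
have -> : factor i = (fun w => phi0 + U i w * Num.sqrt alpha0) by [].
by apply: measurable_funD => //; apply: measurable_funM => //; exact: mU.
Qed.

Let mV : measurable_fun setT (fun w => phi0 + eta 1%N w * Num.sqrt alpha0).
Proof. by apply: measurable_funD => //; apply: measurable_funM => //; exact: measurable_funP. Qed.

(** Each factor has the law of phi0 + eta_1 sqrt alpha0, which does not vanish almost surely because
    its logarithm has finite variance. *)
Let factor_negligible i : P [set w | factor i w = 0] = 0%E.
Proof.
have mroot : measurable [set x : R | phi0 + x * Num.sqrt alpha0 = 0].
  by apply: measurable_zero_set; apply: measurable_funD => //; exact: measurable_funM.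
by rewrite [LHS](lawU i mroot); exact: (log_zero_negligible mV var_fin).
Qed.

Let rho n := \int[P]_w psi ((ln `|phi0 + eta 1%N w * Num.sqrt alpha0| - gamma0) / Num.sqrt n%:R).

Let rows n : (0 < n)%N -> exists2 mu : probability (measurableTypeR R) R,
  iid_row P (fun i w => (ln `|factor i w| - gamma0) / Num.sqrt n%:R) n mu &
  centered mu (V / n%:R) (rho n).
Proof.
move=> n0; apply: (log_row (U := U)) => //.
by move=> i _ A mA; exact: lawU.
Qed.

Let rho_cvg : n%:R * rho n @[n --> \oo] --> (0 : R).
Proof.
apply: psi_scaled_cvg (log_square_integrable mV var_fin).
apply: measurable_funB => //; apply: (measurableT_comp (@measurable_ln R)).
exact: measurableT_comp.
Qed.

Let V0 : 0 <= V.
Proof. by apply: fine_ge0; apply: integral_ge0 => w _; exact: sqre_ge0. Qed.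

Let l0 w := ln `|y0 w|.
Let xi i w := ln `|factor i w|.

Let ml0 : measurable_fun setT l0.
Proof.
by apply: (measurableT_comp (@measurable_ln R)); apply: measurableT_comp => //; exact: measurable_funP.
Qed.

Let mxi i : measurable_fun setT (xi i).
Proof. by apply: (measurableT_comp (@measurable_ln R)); exact: measurableT_comp. Qed.

Let scale n (t : R) : R := expR (- (t * gamma0 * Num.sqrt n%:R)).

Let scale_cont n : continuous (scale n).
Proof.
move=> t; apply: (@continuous_cvg _ _ _ _ _ _ (@expR R)); first exact: continuous_expR.
exact: continuous_drift.
Qed.

Let scale_bound n (t : R) : t \in `[0, 1] -> `|scale n t| <= expR (`|gamma0| * Num.sqrt n%:R).
Proof.
rewrite in_itv/= => /andP[t0 t1]; rewrite ger0_norm ?expR_ge0// ler_expR.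
apply: le_trans (ler_norm _) _; rewrite normrN normrM [`|Num.sqrt _|]ger0_norm ?sqrtr_ge0//.
by rewrite ler_wpM2r ?sqrtr_ge0// normrM ger0_norm// ler_piMl.
Qed.

Let zero_cont : continuous (fun _ : R => 0 : R) := fun x => cvg_cst _.

Definition ar_process (n : nat) (w : T) : borel D :=
  affine_path n (@scale_cont n) zero_cont (fun i => `|y i w| `^ (Num.sqrt n%:R)^-1).

Lemma measurable_ar_process n : measurable_fun setT (ar_process n).
Proof.
apply: (measurable_affine_path n (@scale_cont n) zero_cont
  (V := fun i w => `|y i w| `^ (Num.sqrt n%:R)^-1) (@scale_bound n)) => i.
apply: (measurableT_comp (measurable_powR _)); exact: measurableT_comp.
Qed.

Definition brownian_exp_path (w : T') : borel D := exp_path (brownian_path V BM w).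

Lemma measurable_brownian_exp_path : measurable_fun setT brownian_exp_path.
Proof.
apply: measurable_borel => O oO; rewrite -[_ @^-1` _]setTI.
apply: (measurable_brownian_path V BM measurableT (Y := exp_path @^-1` O)).
apply: sub_sigma_algebra.
by move/continuousP : (@exp_path_continuous R); exact.
Qed.

Let log_process := log_path l0 xi gamma0.

(** Off this set no y i vanishes, and log |y i| is the sum of the logarithms of |y0| and of the
    factors. *)
Let null_set : set T :=
  [set w | y0 w = 0] `|` \bigcup_j [set w | factor j w = 0].

Let null_measurable : measurable null_set.
Proof.
apply: measurableU; first exact/measurable_zero_set/measurable_funP.
by apply: bigcup_measurable => j _; exact: measurable_zero_set.
Qed.

Let null_set0 : P null_set = 0%E.
Proof.
apply: null_set_setU => //.
- exact/measurable_zero_set/measurable_funP.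
- by apply: bigcup_measurable => j _; exact: measurable_zero_set.
- apply/negligibleP; first by apply: bigcup_measurable => j _; exact: measurable_zero_set.
  apply: negligible_bigcup => j; apply/negligibleP; last exact: factor_negligible.
  exact: measurable_zero_set.
Qed.

Let ar_process_log n w : ~ null_set w ->
  ar_process n w = exp_path (log_process n w).
Proof.
move=> Nw; have y00 : y0 w != 0 by apply/eqP => e; apply: Nw; left.
have fj j : factor j w != 0 by apply/eqP => e; apply: Nw; right; exists j.
apply: skorokhod_eq => t t01 /=; rewrite /affine_fun /exp_fun !t01 addr0 mulr1.
have [yk lnyk] := @ar_path_ln _ _ _ phi0 alpha0 etaf y0 a0 (Num.truncn (n%:R * t)) w y00
  (fun j _ => fj j).
by rewrite /powR normr_eq0 (negbTE yk) -expRD mulrC lnyk.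
Qed.

(** [donsker] is applied to f composed with [exp_path], which is again bounded and continuous. *)
Lemma ar_process_cvg (f : D -> R) (M : R) : continuous f -> (forall x, `|f x| <= M) ->
  \int[P]_w f (ar_process n w) @[n --> \oo] --> \int[P']_w f (brownian_exp_path w).
Proof.
move=> cf fM; have cfe : continuous (f \o exp_path).
  by move=> x; apply: continuous_comp; [exact: exp_path_continuous|exact: cf].
have lim := donsker ml0 mxi V0 rows rho_cvg (BM := BM) cfe (fun x => fM (exp_path x)).
have E n : \int[P]_w f (ar_process n w) = \int[P]_w (f \o exp_path) (log_process n w).
  apply: (Rintegral_ae_eq (N := null_set)) => //.
  - exact: measurable_comp_path (measurable_ar_process n) cf.
  - exact: measurable_comp_path (measurable_log_path gamma0 ml0 mxi n) cfe.
  - by move=> w Nw; rewrite /= ar_process_log.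
by rewrite (funext E).
Qed.

End ar_limit.

Theorem theorem2p1 (R : realType)
    (d : measure_display) (T : measurableType d) (P : probability T R)
    (d' : measure_display) (T' : measurableType d') (P' : probability T' R)
    (phi0 alpha0 : R) (eta : nat -> {RV P >-> R}) (y0 : {RV P >-> R})
    (B : R -> {RV P' >-> R}) :
  let logZ := fun w : T =>
    lne (`|phi0 + eta 1%N w * Num.sqrt alpha0|)%:E in
  let gamma0 := fine (emean P logZ) in
  let sigma0 := Num.sqrt (fine (evariance P logZ)) in
  let y := ar_path phi0 alpha0 (fun t => eta t : T -> R) y0 in
  0 < alpha0 ->
  mutually_independent P (fun t => eta t.+1 : T -> R) ->
  (forall t, (1 <= t)%N -> identically_distributed P (eta t) (eta 1%N)) ->
  (forall t, (1 <= t)%N -> symmetric_rv P (eta t)) ->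
  (0 < evariance P logZ < +oo)%E ->
  symmetric_rv P y0 ->
  P [set w | y0 w = 0] = 0%E ->
  independent_of_family P y0 (fun t => eta t.+1 : T -> R) ->
  standard_brownian_motion B ->
  weakly_converges_D01 P P'
    (fun n s w => `|y (Num.truncn (n%:R * s)) w| `^ (Num.sqrt n%:R)^-1
                  / expR (s * gamma0 * Num.sqrt n%:R))
    (fun s w => expR (sigma0 * B s w)).
Proof.
move=> logZ gamma0 sigma0 y a0 ind ide sym /andP[_ var_fin] _ y0_neq0 ind0 BM.
have mX := measurable_ar_process phi0 eta y0 a0.
have mY := measurable_brownian_exp_path phi0 alpha0 eta BM.
pose X n : {RV P >-> borel (skorokhod R)} :=
  HB.pack (ar_process phi0 alpha0 eta y0 n) (isMeasurableFun.Build _ _ _ _ _ (mX n)).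
pose Y : {RV P' >-> borel (skorokhod R)} :=
  HB.pack (brownian_exp_path phi0 alpha0 eta BM) (isMeasurableFun.Build _ _ _ _ _ mY).
exists X, Y; split.
- by move=> n w t t01; rewrite /= /affine_fun t01 addr0 expRN.
- by move=> w t t01; rewrite /= /exp_fun t01.
- move=> f cf [M fM].
  have EX n : ('E_P[fun w => f (X n w)] =
      (\int[P]_w f (ar_process phi0 alpha0 eta y0 n w))%:E)%E.
    by rewrite expectation_Rintegral//; exact: (integrable_comp_path P (mX n) cf fM).
  have EY : ('E_P'[fun w => f (Y w)] =
      (\int[P']_w f (brownian_exp_path phi0 alpha0 eta BM w))%:E)%E.
    by rewrite expectation_Rintegral//; exact: (integrable_comp_path P' mY cf fM).
  rewrite (funext EX) EY; apply: cvg_EFin; first by near=> n.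
  exact: (ar_process_cvg a0 ind ide sym var_fin y0_neq0 ind0 cf fM).
Unshelve. all: by end_near. Qed.
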